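(* Let $(R,\mathfrak m)$ be a commutative Noetherian Cohen-Macaulay local ring of dimension $d$ with canonical module $\omega$, and let $M,N$ be maximal Cohen-Macaulay $R$-modules. Assume that $\mathrm{NF}(M)\cap\mathrm{NF}(N)\subseteq\{\mathfrak m\}$. Then there is an isomorphism $$\underline{\mathrm{Hom}}_R(M,N)^{\vee}\;\cong\;\mathrm{Ext}^1_R(N,\tau M),$$ where $\tau M=\mathrm{Hom}_R(\Omega^d(\mathrm{Tr}\,M),\omega)$.
   Context: For a finitely generated $R$-module $M$, the non-free locus is $\mathrm{NF}(M)=\{\mathfrak p\in\mathrm{Spec}(R): M_{\mathfrak p}\text{ is not }R_{\mathfrak p}\text{-free}\}$. $\underline{\mathrm{Hom}}_R(M,N)$ is the quotient of $\mathrm{Hom}_R(M,N)$ by the submodule of homomorphisms factoring through a free module. $(-)^{\vee}=\mathrm{Hom}_R(-,E_R(R/\mathfrak m))$ is the Matlis dual. $\mathrm{Tr}\,M$ is the Auslander transpose: if $F_1\xrightarrow{\partial}F_0\to M\to 0$ is a minimal free presentation, then $\mathrm{Tr}\,M=\mathrm{Coker}(\mathrm{Hom}_R(\partial,R))$. $\Omega^d$ denotes the $d$-th syzygy in a minimal free resolution. *)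

(* Defs.v *)
From HB Require Import structures.
From mathcomp Require Import all_boot all_algebra generic_quotient ring_quotient.
From mathcomp Require Import boolp ring.
(* eqType and choiceType instances for the types {linear U -> V} *)
From mathcomp Require Import prodnormedzmodule.

Set Implicit Arguments.
Unset Strict Implicit.
Unset Printing Implicit Defensive.

Import GRing.Theory.
Local Open Scope ring_scope.
Local Open Scope quotient_scope.

Section Submodules.
Variables (R : pzRingType) (V : lmodType R) (S : submodClosed V).

Record submod := Submod { submod_val :> V; submod_valP : submod_val \in S }.

HB.instance Definition _ := [isSub for submod_val].
HB.instance Definition _ := [Choice of submod by <:].
HB.instance Definition _ := [SubChoice_isSubLmodule of submod by <:].

End Submodules.

Section QuotientModules.
Variables (R : pzRingType) (V : lmodType R) (S : submodClosed V).

Definition submod_zmod : zmodClosed V :=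
  HB.pack (GRing.SubmodClosed.sort S)
    (GRing.isZmodClosed.Build V (GRing.SubmodClosed.sort S)
       (GRing.submod_closedB (submodClosedP S))).

Definition quotmod := Quotient.quot submod_zmod.

HB.instance Definition _ := GRing.Zmodule.on quotmod.

Definition quotmod_scale (a : R) (x : quotmod) : quotmod :=
  \pi_(Quotient.quot submod_zmod) (a *: repr x).

Lemma quotmod_piP (x y : V) :
  x - y \in S -> \pi_(Quotient.quot submod_zmod) x = \pi_(Quotient.quot submod_zmod) y.
Proof.
by move=> xy; apply/eqP; rewrite -(Quotient.idealrBE submod_zmod).
Qed.

Lemma quotmod_reprP (x : V) : repr (\pi_(Quotient.quot submod_zmod) x) - x \in S.
Proof. by rewrite (Quotient.idealrBE submod_zmod) reprK. Qed.

Lemma quotmod_scaleE a x :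
  quotmod_scale a (\pi_(Quotient.quot submod_zmod) x) = \pi_(Quotient.quot submod_zmod) (a *: x).
Proof. by apply: quotmod_piP; rewrite -scalerBr rpredZ ?quotmod_reprP. Qed.

Lemma quotmod_scaleA a b x :
  quotmod_scale a (quotmod_scale b x) = quotmod_scale (a * b) x.
Proof. by rewrite [X in quotmod_scale a X]/quotmod_scale quotmod_scaleE scalerA. Qed.

Lemma quotmod_scale1 : left_id 1 quotmod_scale.
Proof. by move=> x; rewrite /quotmod_scale scale1r reprK. Qed.

Lemma quotmod_scaleDr : right_distributive quotmod_scale +%R.
Proof.
move=> a; elim/quotW => x; elim/quotW => y.
by rewrite -raddfD !quotmod_scaleE scalerDr raddfD.
Qed.

Lemma quotmod_scaleDl x : {morph quotmod_scale^~ x : a b / a + b}.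
Proof. by move=> a b; rewrite /quotmod_scale scalerDl raddfD. Qed.

HB.instance Definition _ := GRing.Zmodule_isLmodule.Build R quotmod
  quotmod_scaleA quotmod_scale1 quotmod_scaleDr quotmod_scaleDl.

End QuotientModules.

Section HomModules.
Variables (R : comNzRingType) (U V : lmodType R).
Implicit Types f g h : {linear U -> V}.

Lemma linear_ext f g : f =1 g -> f = g.
Proof.
case: f g => f [[f0] [f1]] [g [[g0] [g1]]] /= /funext fg.
by case: _ / fg in g0 g1 *; rewrite (Prop_irrelevance f0 g0) (Prop_irrelevance f1 g1).
Qed.

Definition hom_zero : {linear U -> V} := \0.
Definition hom_opp f : {linear U -> V} := \- f.
Definition hom_add f g : {linear U -> V} := f \+ g.
Definition hom_scale (a : R) f : {linear U -> V} := a \*: f.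

Lemma hom_addA : associative hom_add.
Proof. by move=> f g h; apply: linear_ext => x /=; rewrite addrA. Qed.
Lemma hom_addC : commutative hom_add.
Proof. by move=> f g; apply: linear_ext => x /=; rewrite addrC. Qed.
Lemma hom_add0 : left_id hom_zero hom_add.
Proof. by move=> f; apply: linear_ext => x /=; rewrite add0r. Qed.
Lemma hom_addN : left_inverse hom_zero hom_opp hom_add.
Proof. by move=> f; apply: linear_ext => x /=; rewrite addNr. Qed.

HB.instance Definition _ := GRing.isZmodule.Build {linear U -> V}
  hom_addA hom_addC hom_add0 hom_addN.

Lemma hom_scaleA a b f : hom_scale a (hom_scale b f) = hom_scale (a * b) f.
Proof. by apply: linear_ext => x /=; rewrite scalerA. Qed.
Lemma hom_scale1 : left_id 1 hom_scale.
Proof. by move=> f; apply: linear_ext => x /=; rewrite scale1r. Qed.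
Lemma hom_scaleDr : right_distributive hom_scale +%R.
Proof. by move=> a f g; apply: linear_ext => x /=; rewrite scalerDr. Qed.
Lemma hom_scaleDl f : {morph hom_scale^~ f : a b / a + b}.
Proof. by move=> a b; apply: linear_ext => x /=; rewrite scalerDl. Qed.

HB.instance Definition _ := GRing.Zmodule_isLmodule.Build R {linear U -> V}
  hom_scaleA hom_scale1 hom_scaleDr hom_scaleDl.

End HomModules.

Notation Hom U V := {linear U -> V}.

(* Hom(f, L) : Hom(V, L) -> Hom(U, L) *)
Section HomPrecomp.
Variables (R : comNzRingType) (U V : lmodType R) (f : Hom U V) (L : lmodType R).

Definition hom_pre (h : Hom V L) : Hom U L := h \o f.

Lemma hom_pre_is_linear : linear hom_pre.
Proof. by move=> a g h; apply: linear_ext. Qed.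

HB.instance Definition _ :=
  GRing.isLinear.Build R (Hom V L) (Hom U L) *:%R hom_pre hom_pre_is_linear.

End HomPrecomp.

Arguments hom_pre {R U V} f L h.

Definition isom (R : pzRingType) (U V : lmodType R) : Prop :=
  exists f : {linear U -> V}, bijective f.

Section KernelsAndImages.
Variables (R : pzRingType) (U V W : lmodType R).

Definition ker_pred (f : {linear U -> V}) : {pred U} := fun x => f x == 0.

Lemma ker_pred_submod f : submod_closed (ker_pred f).
Proof.
split=> [|a x y]; rewrite !unfold_in ?raddf0 //= => /eqP fx /eqP fy.
by rewrite linearP fx fy scaler0 addr0.
Qed.

HB.instance Definition _ f :=
  GRing.isSubmodClosed.Build R U (ker_pred f) (ker_pred_submod f).

Definition ker (f : {linear U -> V}) : lmodType R := submod (ker_pred f).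

Definition im_pred (f : {linear U -> V}) : {pred V} :=
  fun y => `[< exists x, y = f x >].

Lemma im_pred_submod f : submod_closed (im_pred f).
Proof.
split=> [|a x y]; first by apply/asboolP; exists 0; rewrite raddf0.
move=> /asboolP[u ->] /asboolP[v ->]; apply/asboolP.
by exists (a *: u + v); rewrite linearP.
Qed.

HB.instance Definition _ f :=
  GRing.isSubmodClosed.Build R V (im_pred f) (im_pred_submod f).

Definition coker (f : {linear U -> V}) : lmodType R := quotmod (im_pred f).

End KernelsAndImages.

Section Homology.
Variables (R : pzRingType) (U V W : lmodType R).
Variables (f : {linear U -> V}) (g : {linear V -> W}).

Definition bound_pred : {pred ker g} := fun z => val z \in im_pred f.

Lemma bound_pred_submod : submod_closed bound_pred.
Proof.
split=> [|a x y]; first by rewrite unfold_in raddf0 rpred0.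
by move=> xS yS; exact: (submodClosedP (im_pred f)).2 a _ _ xS yS.
Qed.

HB.instance Definition _ :=
  GRing.isSubmodClosed.Build R (ker g) bound_pred bound_pred_submod.

(* ker g / im f, for a complex U -f-> V -g-> W *)
Definition homology : lmodType R := quotmod bound_pred.

End Homology.

Definition fin_gen (R : pzRingType) (M : lmodType R) : Prop :=
  exists s : seq M, forall x : M,
    exists c : 'I_(size s) -> R, x = \sum_i c i *: s`_i.

(* Existence of a basis, of arbitrary cardinality. *)
Definition free_module (R : pzRingType) (F : lmodType R) : Prop :=
  exists (I : eqType) (b : I -> F),
    (forall x, exists (s : seq I) (c : I -> R), x = \sum_(i <- s) c i *: b i) /\
    (forall (s : seq I) (c : I -> R), uniq s ->
       \sum_(i <- s) c i *: b i = 0 -> forall i, i \in s -> c i = 0).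

Section LocalRings.
Variable R : comNzRingType.

Definition noetherian : Prop := forall I : submodClosed R^o, fin_gen (submod I).

(* An [idealr] is proper. *)
Definition maximal_ideal (I : idealr R) : Prop :=
  forall J : idealr R, {subset I <= J} -> {subset J <= I}.

Definition local_ring (m : idealr R) : Prop :=
  maximal_ideal m /\ forall J : idealr R, maximal_ideal J -> J =i m.

Definition prime_chain (n : nat) (p : nat -> prime_idealr R) : Prop :=
  forall i, (i < n)%N -> {subset p i <= p i.+1} /\ ~ {subset p i.+1 <= p i}.

Definition krull_dim (d : nat) : Prop :=
  (exists p, prime_chain d p) /\ (forall n p, prime_chain n p -> (n <= d)%N).

End LocalRings.

(* The residue field R/m, as an R-module. *)
Section ResidueField.
Variables (R : comNzRingType) (m : idealr R).

Definition residue := {ideal_quot m}.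

HB.instance Definition _ := GRing.ComNzRing.on residue.

Definition residue_scale (a : R) (x : residue) : residue :=
  \pi_{ideal_quot m} a * x.

Lemma residue_scaleA a b x :
  residue_scale a (residue_scale b x) = residue_scale (a * b) x.
Proof. by rewrite /residue_scale mulrA -rmorphM. Qed.
Lemma residue_scale1 : left_id 1 residue_scale.
Proof. by move=> x; rewrite /residue_scale rmorph1 mul1r. Qed.
Lemma residue_scaleDr : right_distributive residue_scale +%R.
Proof. by move=> a x y; rewrite /residue_scale mulrDr. Qed.
Lemma residue_scaleDl x : {morph residue_scale^~ x : a b / a + b}.
Proof. by move=> a b; rewrite /residue_scale rmorphD mulrDl. Qed.

HB.instance Definition _ := GRing.Zmodule_isLmodule.Build R residue
  residue_scaleA residue_scale1 residue_scaleDr residue_scaleDl.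

End ResidueField.

Section Localization.
Variables (R : comNzRingType) (p : prime_idealr R).

Definition denom := {s : R | s \notin p}.

Lemma denom1P : 1 \notin p. Proof. by rewrite idealr1. Qed.
Definition denom1 : denom := Sub 1 denom1P.

Lemma denomMP (s t : denom) : val s * val t \notin p.
Proof. by rewrite prime_idealrM negb_or (valP s) (valP t). Qed.
Definition denomM (s t : denom) : denom := Sub (val s * val t) (denomMP s t).

Local Ltac scal := by rewrite ?scalerA; congr (_ *: _); rewrite /=; ring.

Section LocalizedModule.
Variable M : lmodType R.

Definition frac_eq (x y : M * denom) : bool :=
  `[< exists u : denom,
        val u *: (val y.2 *: x.1) = val u *: (val x.2 *: y.1) >].

Lemma frac_eq_equiv : equiv_class_of frac_eq.
Proof.
split=> [[x s]|[x s] [y t]|[y t] [x s] [z r]].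
- by apply/asboolP; exists denom1.
- by apply/asboolP/asboolP => -[u e]; exists u.
- move=> /asboolP[u eu] /asboolP[v ev]; apply/asboolP.
  exists (denomM (denomM u v) t) => /=; move: eu ev => /= eu ev.
  have -> : (val u * val v * val t) *: (val r *: x) =
            (val v * val r) *: (val u *: (val t *: x)) by scal.
  rewrite eu.
  have -> : (val v * val r) *: (val u *: (val s *: y)) =
            (val u * val s) *: (val v *: (val r *: y)) by scal.
  by rewrite ev; scal.
Qed.

Canonical frac_equivRel := EquivRelPack frac_eq_equiv.
Canonical frac_encModRel := defaultEncModRel frac_eq.

Definition localization := {eq_quot frac_eq}.

HB.instance Definition _ : EqQuotient (M * denom)%type frac_eq localization :=
  EqQuotient.on localization.
HB.instance Definition _ := Choice.on localization.

(* the fraction x / s *)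
Definition frac (x : M) (s : denom) : localization := \pi_localization (x, s).

Definition num (z : localization) : M := (repr z).1.
Definition den (z : localization) : denom := (repr z).2.

Lemma frac_numden z : frac (num z) (den z) = z.
Proof. by rewrite /frac /num /den -surjective_pairing reprK. Qed.

Lemma fracP x s y t :
  frac x s = frac y t <->
  exists u : denom, val u *: (val t *: x) = val u *: (val s *: y).
Proof.
split=> [/eqquotP/asboolP //|e].
by apply/eqquotP/asboolP.
Qed.

Lemma frac_ind (P : localization -> Prop) :
  (forall x s, P (frac x s)) -> forall z, P z.
Proof. by move=> fP z; rewrite -(frac_numden z). Qed.

Definition loc_zero : localization := frac 0 denom1.
Definition loc_opp z := frac (- num z) (den z).
Definition loc_add z w :=
  frac (val (den w) *: num z + val (den z) *: num w) (denomM (den z) (den w)).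

Lemma loc_oppE x s : loc_opp (frac x s) = frac (- x) s.
Proof.
have /fracP[u e] := frac_numden (frac x s).
by apply/fracP; exists u; rewrite !scalerN e.
Qed.

Lemma loc_addE x s y t :
  loc_add (frac x s) (frac y t) = frac (val t *: x + val s *: y) (denomM s t).
Proof.
have /fracP[u] := frac_numden (frac x s).
have /fracP[v] := frac_numden (frac y t).
set x' := num (frac x s); set s' := den (frac x s).
set y' := num (frac y t); set t' := den (frac y t) => ev eu.
rewrite /loc_add -/x' -/y' -/s' -/t'.
apply/fracP; exists (denomM u v) => /=; rewrite !scalerDr; congr (_ + _).
  transitivity ((val v * val t * val t') *: (val u *: (val s *: x'))); first scal.
  by rewrite eu; scal.
transitivity ((val u * val s * val s') *: (val v *: (val t *: y'))); first scal.
by rewrite ev; scal.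
Qed.

Lemma loc_addA : associative loc_add.
Proof.
elim/frac_ind=> x s; elim/frac_ind=> y t; elim/frac_ind=> z r.
rewrite !loc_addE; apply/fracP; exists denom1.
rewrite !scalerDr !addrA /=; congr (_ + _ + _); scal.
Qed.

Lemma loc_addC : commutative loc_add.
Proof.
elim/frac_ind=> x s; elim/frac_ind=> y t.
rewrite !loc_addE; apply/fracP; exists denom1.
rewrite !scalerDr /= addrC; congr (_ + _); scal.
Qed.

Lemma loc_add0 : left_id loc_zero loc_add.
Proof.
elim/frac_ind=> x s; rewrite loc_addE; apply/fracP; exists denom1.
by rewrite scaler0 add0r /=; scal.
Qed.

Lemma loc_addN : left_inverse loc_zero loc_opp loc_add.
Proof.
elim/frac_ind=> x s; rewrite loc_oppE loc_addE; apply/fracP; exists denom1.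
by rewrite scalerN addNr !scaler0.
Qed.

HB.instance Definition _ := GRing.isZmodule.Build localization
  loc_addA loc_addC loc_add0 loc_addN.

Lemma fracD x s y t :
  frac x s + frac y t = frac (val t *: x + val s *: y) (denomM s t).
Proof. exact: loc_addE. Qed.

End LocalizedModule.

Definition locring := localization R^o.

HB.instance Definition _ := GRing.Zmodule.on locring.

Section LocalizedScale.
Variable M : lmodType R.

Definition loc_scale (a : locring) (z : localization M) : localization M :=
  frac ((num a : R) *: num z) (denomM (den a) (den z)).

Lemma loc_scaleE (r : R^o) s (x : M) t :
  loc_scale (frac r s) (frac x t) = frac ((r : R) *: x) (denomM s t).
Proof.
have /fracP[u] := frac_numden (frac r s).
have /fracP[v] := frac_numden (frac x t).
rewrite /loc_scale.
set r' : R := num (frac r s); set s' := den (frac r s).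
set x' := num (frac x t); set t' := den (frac x t) => ev eu.
have {}eu : val u * (val s * r') = val u * (val s' * r) by exact: eu.
apply/fracP; exists (denomM u v) => /=.
transitivity ((val u * (val s * r')) *: (val v *: (val t *: x'))); first scal.
by rewrite eu ev; scal.
Qed.

Lemma loc_scaleDr (a : locring) : {morph loc_scale a : z w / z + w}.
Proof.
elim/frac_ind: a => r s; elim/frac_ind=> x t; elim/frac_ind=> y t'.
rewrite fracD !loc_scaleE fracD; apply/fracP; exists denom1.
by rewrite !scalerDr /=; congr (_ + _); scal.
Qed.

Lemma loc_scaleDl (z : localization M) :
  {morph loc_scale^~ z : a b / a + b}.
Proof.
elim/frac_ind: z => x t; elim/frac_ind=> r s; elim/frac_ind=> r' s'.
rewrite fracD !loc_scaleE fracD; apply/fracP; exists denom1.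
rewrite scalerDl !scalerDr /=; congr (_ + _).
  by rewrite !scalerA; congr (_ *: _); rewrite /= /GRing.scale /=; ring.
by rewrite !scalerA; congr (_ *: _); rewrite /= /GRing.scale /=; ring.
Qed.

End LocalizedScale.

Definition loc_one : locring := frac (1 : R^o) denom1.
Definition loc_mul (a b : locring) : locring := loc_scale a b.

Lemma loc_scaleA (M : lmodType R) (a b : locring) (z : localization M) :
  loc_scale a (loc_scale b z) = loc_scale (loc_mul a b) z.
Proof.
elim/frac_ind: a => r s; elim/frac_ind: b => r' s'; elim/frac_ind: z => x t.
rewrite /loc_mul (loc_scaleE r' s' x t) (loc_scaleE r s (r' *: x)).
rewrite (loc_scaleE r s r' s') (loc_scaleE (r *: r') _ x t); apply/fracP; exists denom1.
by rewrite !scalerA; congr (_ *: _); rewrite /= /GRing.scale /=; ring.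
Qed.

Lemma loc_scale1 (M : lmodType R) (z : localization M) : loc_scale loc_one z = z.
Proof.
elim/frac_ind: z => x t; rewrite /loc_one loc_scaleE.
by apply/fracP; exists denom1; rewrite scale1r /=; scal.
Qed.

Lemma loc_mulA : associative loc_mul.
Proof. by move=> a b c; rewrite /loc_mul loc_scaleA. Qed.

Lemma loc_mulC : commutative loc_mul.
Proof.
elim/frac_ind=> r s; elim/frac_ind=> r' s'.
rewrite /loc_mul (loc_scaleE r s) (loc_scaleE r' s'); apply/fracP; exists denom1.
by rewrite /= /GRing.scale /=; ring.
Qed.

Lemma loc_mul1 : left_id loc_one loc_mul.
Proof. by move=> a; exact: loc_scale1. Qed.

Lemma loc_mulDl : left_distributive loc_mul +%R.
Proof. by move=> a b c; exact: (loc_scaleDl c a b). Qed.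

Lemma loc_one_neq0 : loc_one != 0.
Proof.
apply/negP => /eqP/fracP[u] /=; rewrite scaler0 scaler0 /GRing.scale /= !mulr1 => u0.
by have := valP u; rewrite [val u]u0 idealr0.
Qed.

HB.instance Definition _ := GRing.Zmodule_isComNzRing.Build locring
  loc_mulA loc_mulC loc_mul1 loc_mulDl loc_one_neq0.

HB.instance Definition _ (M : lmodType R) :=
  GRing.Zmodule_isLmodule.Build locring (localization M)
    (@loc_scaleA M) (@loc_scale1 M) (@loc_scaleDr M) (@loc_scaleDl M).

End Localization.

(* The prime [p] lies in NF(M). *)
Definition nonfree_locus (R : comNzRingType) (M : lmodType R)
    (p : prime_idealr R) : Prop :=
  ~ free_module (localization p M : lmodType (locring p)).

Section Depth.
Variable R : comNzRingType.

(* The submodule (s_0, ..., s_(n-1)) M. *)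
Definition seqmul_pred (M : lmodType R) (s : seq R) : {pred M} :=
  fun x => `[< exists y : 'I_(size s) -> M, x = \sum_(i < size s) s`_i *: y i >].

Lemma seqmul_pred_submod M s : submod_closed (@seqmul_pred M s).
Proof.
split=> [|a x y].
  apply/asboolP; exists (fun=> 0).
  by rewrite big1 // => i _; rewrite scaler0.
move=> /asboolP[u ->] /asboolP[v ->]; apply/asboolP.
exists (fun i => a *: u i + v i); rewrite scaler_sumr -big_split.
by apply: eq_bigr => i _; rewrite /= scalerDr !scalerA mulrC.
Qed.

HB.instance Definition _ M s :=
  GRing.isSubmodClosed.Build R M (@seqmul_pred M s) (@seqmul_pred_submod M s).

Definition regular_seq (M : lmodType R) (s : seq R) : Prop :=
  (forall i, (i < size s)%N ->
     forall x : quotmod (@seqmul_pred M (take i s)), s`_i *: x = 0 -> x = 0) /\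
  (exists x : quotmod (@seqmul_pred M s), x <> 0).

Definition depth (m : idealr R) (M : lmodType R) (n : nat) : Prop :=
  (exists2 s : seq R, {subset s <= m} /\ regular_seq M s & size s = n) /\
  (forall s : seq R, {subset s <= m} -> regular_seq M s -> (size s <= n)%N).

Definition cohen_macaulay_ring (m : idealr R) : Prop :=
  exists2 d, krull_dim R d & depth m R^o d.

(* The zero module counts as maximal Cohen-Macaulay. *)
Definition maximal_cohen_macaulay (m : idealr R) (M : lmodType R) : Prop :=
  fin_gen M /\
  ((exists x : M, x <> 0) -> exists2 d, krull_dim R d & depth m M d).

End Depth.

(* Finite free modules are taken to be the modules of row vectors R^n; a
   finitely generated module over a noetherian ring has such a resolution. *)
Record free_resolution (R : comNzRingType) (M : lmodType R) := FreeResolution {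
  fr_rank : nat -> nat;
  fr_aug : Hom 'rV[R]_(fr_rank 0) M;
  fr_diff : forall i, Hom 'rV[R]_(fr_rank i.+1) 'rV[R]_(fr_rank i);
  fr_aug_surj : forall x, exists u, x = fr_aug u;
  fr_aug_exact : forall u, fr_aug u = 0 <-> exists v, u = fr_diff 0 v;
  fr_exact : forall i u, fr_diff i u = 0 <-> exists v, u = fr_diff i.+1 v }.

Section Resolutions.
Variables (R : comNzRingType) (M : lmodType R) (F : free_resolution M).

Definition minimal_resolution (m : idealr R) : Prop :=
  forall i v j, fr_diff F i v 0 j \in m.

Definition syzygy (i : nat) : lmodType R :=
  match i with
  | 0 => M
  | 1 => ker (fr_aug F)
  | i.+2 => ker (fr_diff F i)
  end.

(* Ext^i_R(M, L), as the cohomology of Hom(F, L). *)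
Definition Ext (i : nat) (L : lmodType R) : lmodType R :=
  match i with
  | 0 => ker (hom_pre (fr_diff F 0) L)
  | i.+1 => homology (hom_pre (fr_diff F i) L) (hom_pre (fr_diff F i.+1) L)
  end.

End Resolutions.

(* F1 -> F0 -> M -> 0, with F0 -> M and F1 -> ker (F0 -> M) minimal covers:
   their kernels lie in m F0 and m F1. *)
Record minimal_presentation (R : comNzRingType) (m : idealr R) (M : lmodType R)
  := MinimalPresentation {
  mp_rank0 : nat;
  mp_rank1 : nat;
  mp_aug : Hom 'rV[R]_mp_rank0 M;
  mp_diff : Hom 'rV[R]_mp_rank1 'rV[R]_mp_rank0;
  mp_aug_surj : forall x, exists u, x = mp_aug u;
  mp_exact : forall u, mp_aug u = 0 <-> exists v, u = mp_diff v;
  mp_aug_minimal : forall u, mp_aug u = 0 -> forall j, u 0 j \in m;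
  mp_diff_minimal : forall v, mp_diff v = 0 -> forall j, v 0 j \in m }.

Definition Tr (R : comNzRingType) (m : idealr R) (M : lmodType R)
    (P : minimal_presentation m M) : lmodType R :=
  coker (hom_pre (mp_diff P) R^o).

Section FreeProduct.
Variables (R : comNzRingType).

Lemma free_module0 : free_module ('rV[R]_0 : lmodType R).
Proof.
exists void, (fun v : void => match v with end).
split=> [x|s c _ _ []]; exists [::], (fun=> 0).
by rewrite big_nil thinmx0.
Qed.

Definition oleft (I J : Type) (k : I + J) : option I :=
  if k is inl i then Some i else None.
Definition oright (I J : Type) (k : I + J) : option J :=
  if k is inr j then Some j else None.

Lemma free_module_prod (F G : lmodType R) :
  free_module F -> free_module G -> free_module (F * G : lmodType R)%type.
Proof.
move=> [I [b [bspan bfree]]] [J [b' [bspan' bfree']]].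
pose B (k : (I + J)%type) : F * G :=
  match k with inl i => (b i, 0) | inr j => (0, b' j) end.
have BE (s : seq (I + J)) (c : I + J -> R) : \sum_(k <- s) c k *: B k =
    (\sum_(i <- pmap (@oleft I J) s) c (inl i) *: b i,
     \sum_(j <- pmap (@oright I J) s) c (inr j) *: b' j).
  elim: s => [|[i|j] s IH]; rewrite /= ?big_nil // ?big_cons IH.
  - by congr (_, _) => /=; rewrite ?scaler0 ?add0r.
  - by congr (_, _) => /=; rewrite ?scaler0 ?add0r.
exists (I + J)%type, B; split=> [[x y]|s c us].
  have [s [c ->]] := bspan x; have [t [e ->]] := bspan' y.
  exists (map inl s ++ map inr t).
  exists (fun k => match k with inl i => c i | inr j => e j end).
  have lE : pmap (@oleft I J) (map inl s ++ map inr t) = s.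
    by rewrite pmap_cat; elim: s => /= [|i s ->] //; elim: t.
  have rE : pmap (@oright I J) (map inl s ++ map inr t) = t.
    by elim: {lE} s => //=; elim: t => //= j t ->.
  by rewrite BE lE rE.
rewrite BE => -[l0 r0] [i|j] ks.
  apply: (bfree _ (fun i => c (inl i)) _ l0).
    by apply: (pmap_uniq (g := inl)) us => -[].
  by rewrite mem_pmap; apply/mapP; exists (inl i).
apply: (bfree' _ (fun j => c (inr j)) _ r0).
  by apply: (pmap_uniq (g := inr)) us => -[].
by rewrite mem_pmap; apply/mapP; exists (inr j).
Qed.

Definition pair_map (U V W : lmodType R) (f : Hom U V) (g : Hom U W) (x : U) :
  V * W := (f x, g x).

Lemma pair_map_is_linear (U V W : lmodType R) (f : Hom U V) (g : Hom U W) :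
  linear (pair_map f g).
Proof. by move=> a x y; rewrite /pair_map !linearP. Qed.

HB.instance Definition _ (U V W : lmodType R) (f : Hom U V) (g : Hom U W) :=
  GRing.isLinear.Build R U (V * W)%type *:%R (pair_map f g)
    (pair_map_is_linear f g).

End FreeProduct.

Section StableHom.
Variables (R : comNzRingType) (M N : lmodType R).

Definition factors_through_free : {pred Hom M N} := fun f =>
  `[< exists (F : lmodType R) (g : Hom M F) (h : Hom F N),
        free_module F /\ f =1 h \o g >].

Lemma factors_through_free_submod : submod_closed factors_through_free.
Proof.
split=> [|a f g].
  apply/asboolP; exists 'rV[R]_0, \0, \0; split=> //.
  exact: free_module0.
move=> /asboolP[F [u [v [freeF fE]]]] /asboolP[G [u' [v' [freeG gE]]]].
apply/asboolP; exists (F * G)%type, (pair_map u u').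
exists ((a \*: (v \o fst)) \+ (v' \o snd)); split.
  exact: free_module_prod.
by move=> x /=; rewrite -[v _]fE -[v' _]gE.
Qed.

HB.instance Definition _ := GRing.isSubmodClosed.Build R (Hom M N)
  factors_through_free factors_through_free_submod.

Definition stable_Hom : lmodType R := quotmod factors_through_free.

End StableHom.

Section InjectiveModules.
Variable R : comNzRingType.

Definition injective_module (E : lmodType R) : Prop :=
  forall (A B : lmodType R) (i : Hom A B) (f : Hom A E),
    injective i -> exists g : Hom B E, g \o i =1 f.

Definition injective_hull (K E : lmodType R) : Prop :=
  injective_module E /\
  exists2 i : Hom K E, injective i &
    forall S : submodClosed E, (exists2 x, x \in S & x <> 0) ->
      exists2 y : K, i y \in S & i y <> 0.

Definition finite_injective_dim (M : lmodType R) : Prop :=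
  exists (n : nat) (I : nat -> lmodType R) (e : Hom M (I 0))
    (delta : forall i, Hom (I i) (I i.+1)),
    [/\ forall i, injective_module (I i),
        injective e,
        forall x, delta 0 x = 0 <-> exists y, x = e y,
        forall i x, delta i.+1 x = 0 <-> exists y, x = delta i y
      & forall i, (n < i)%N -> forall x : I i, x = 0].

(* r(M) = dim_k Ext^t_R(k, M), where t = depth M and k = R/m; a basis of the
   k-vector space Ext^t_R(k, M) is recorded as an R-isomorphism with k^r. *)
Definition cm_type (m : idealr R) (M : lmodType R) (r : nat) : Prop :=
  exists2 t, depth m M t &
    exists F : free_resolution (residue m : lmodType R),
      isom (Ext F t M) {ffun 'I_r -> residue m}.

Definition canonical_module (m : idealr R) (omega : lmodType R) : Prop :=
  [/\ maximal_cohen_macaulay m omega, cm_type m omega 1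
    & finite_injective_dim omega].

End InjectiveModules.

Definition matlis_dual (R : comNzRingType) (E X : lmodType R) : lmodType R :=
  Hom X E.

Definition tau (R : comNzRingType) (m : idealr R) (M : lmodType R)
    (P : minimal_presentation m M) (G : free_resolution (Tr P)) (d : nat)
    (omega : lmodType R) : lmodType R :=
  Hom (syzygy G d) omega.

(* Main.v *)
Require Import Defs.
From HB Require Import structures.
From mathcomp Require Import all_boot all_algebra ring_quotient.
From mathcomp Require Import generic_quotient boolp ring.

Set Implicit Arguments.
Unset Strict Implicit.
Unset Printing Implicit Defensive.

Import Defs GRing.Theory.
Local Open Scope ring_scope.
Local Open Scope quotient_scope.

(* Let T = Tr M, let G be the resolution of T, C = G (x) N, and B_j the image of
   C_(j+1) in C_j. The stable module Hom(M, N) is H_1(C) = Tor_1(T, N). At every prime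
   p <> m one of M_p, N_p is free, so for each j >= 1 the module H_j(C) is killed by a
   power of m, and Ext^i(H_j(C), omega) = 0 for i < d, while Ext^i(X, omega) = 0 for
   i > d and every finitely generated X. Since N is maximal Cohen-Macaulay,
   Ext^i(C_j, omega) = 0 for i > 0, and the exact sequences
   0 -> H_(j+1)(C) -> C_(j+1)/B_(j+1) -> C_j -> C_j/B_j -> 0
   shift H^(d+1)(Hom(C, omega)) step by step to Ext^d(H_1(C), omega), which is
   Hom(H_1(C), E) by local duality for modules of finite length. On the other side
   H^(d+1)(Hom(C, omega)) = Ext^1(Omega^d T, Hom(N, omega)) = Ext^1(N, tau M), because
   Ext^1(N, omega) = Ext^1(Omega^d T, omega) = 0. *)

(** * Modules and homomorphisms *)

(** The transpose enters through a presentation [P_1 -> P_0] of [M]: T is the cokernel of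
    [Hom(P_0, R) -> Hom(P_1, R)]. After tensoring with N the kernel of this map is [Hom(M, N)], and
    boundaries from the next free module are maps through a free module. About the non-free loci
    only this is used: if s times the identity of M or of N factors through a free module, then s
    kills all H_j(C), j >= 1. Hence the common annihilator of these modules lies in no prime other
    than m, and contains a power of each element of m. About omega, only the definition is
    available. Type 1 says that Ext^d(R/m, omega) is R/m; vanishing above d has to be extracted from
    finite injective dimension. The duality is therefore built by hand: one functional from the d-th
    injective to E matches a generator of Ext^d(R/m, omega) with a generator of the socle of E, and
    devissage does the rest. The d in the syzygy is the number of shifts that carry a class from Ext
    degree 0 to degree d, the degree in which R/m has its generator; each shift uses up one
    vanishing degree below d. *)

Section Toolkit.
Variable R : comNzRingType.
Implicit Types A B C J K L Q U V W X Y : lmodType R.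

Lemma hom_of_linear U V (f : U -> V) : linear f -> exists g : Hom U V, g =1 f.
Proof.
move=> lf; pose mix := GRing.isLinear.Build R U V *:%R f lf.
pose g : Hom U V := HB.pack f mix.
by exists g.
Qed.

Definition submodule V (P : V -> Prop) : Prop :=
  P 0 /\ forall a x y, P x -> P y -> P (a *: x + y).

Lemma submodule_closed V (P : V -> Prop) : submodule P ->
  exists S : submodClosed V, forall x, x \in S <-> P x.
Proof.
move=> [P0 Pl].
pose p : {pred V} := fun x => `[<P x>].
have sp : submod_closed p.
  split=> [|a x y /asboolP Px /asboolP Py]; first exact/asboolP.
  by apply/asboolP; apply: Pl.
pose mix := GRing.isSubmodClosed.Build R V p sp.
pose S : submodClosed V := HB.pack p mix.
by exists S => x; split=> /asboolP.
Qed.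

Definition surj U V (f : U -> V) : Prop := forall y, exists x, y = f x.

Lemma submod_incl V (S : submodClosed V) :
  exists i : Hom (submod S) V,
  [/\ i =1 val, injective i & forall x, x \in S <-> exists k, x = i k].
Proof.
have [i iE] := hom_of_linear (fun a x y => erefl : (submod_val (a *: x + y : submod S) = _)).
exists i; split; [by []|by move=> x y; rewrite !iE => e; apply: val_inj|].
move=> x; split=> [xS|[k ->]]; last by rewrite iE; apply: submod_valP.
by exists (Submod xS); rewrite iE.
Qed.

Lemma submodule_type V (P : V -> Prop) : submodule P ->
  exists (K : lmodType R) (i : Hom K V),
    injective i /\ forall x, P x <-> exists k, x = i k.
Proof.
move=> /submodule_closed[S SP]; have [i [_ ii iE]] := submod_incl S.
by exists (submod S : lmodType R), i; split=> // x; rewrite -SP.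
Qed.

Lemma quotmod_proj V (S : submodClosed V) :
  exists p : Hom V (quotmod S), surj p /\ forall x, p x = 0 <-> x \in S.
Proof.
have lp : linear (fun x : V => \pi_(Quotient.quot (submod_zmod S)) x : quotmod S).
  by move=> a x y; rewrite raddfD; congr (_ + _); rewrite /= -quotmod_scaleE.
have [p pE] := hom_of_linear lp.
exists p; split.
  by move=> y; exists (repr y); rewrite pE reprK.
move=> x; rewrite pE; split=> [e|xS].
  have := quotmod_reprP S x; rewrite e => h.
  have := quotmod_reprP S 0; rewrite raddf0 subr0 => h0.
  have := @rpredB _ (submod_zmod S) _ _ h0 h; rewrite subKr; exact.
by rewrite -[RHS](raddf0 (\pi_(Quotient.quot (submod_zmod S)))); apply: quotmod_piP; rewrite subr0.
Qed.

Lemma quotient_type V (P : V -> Prop) : submodule P ->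
  exists (Q : lmodType R) (p : Hom V Q), surj p /\ forall x, p x = 0 <-> P x.
Proof.
move=> /submodule_closed[S SP]; have [p [sp pE]] := quotmod_proj S.
by exists (quotmod S : lmodType R), p; split=> // x; rewrite -SP.
Qed.

Lemma ker_incl U V (f : Hom U V) :
  exists i : Hom (ker f) U,
  [/\ i =1 val, injective i & forall x, f x = 0 <-> exists k, x = i k].
Proof.
have [i [iv ii iE]] := submod_incl (ker_pred f); exists i; split=> // x.
by rewrite -iE; split=> /eqP.
Qed.

Lemma coker_proj U V (f : Hom U V) :
  exists p : Hom V (coker f), surj p /\ forall x, p x = 0 <-> exists u, x = f u.
Proof.
have [p [sp pE]] := quotmod_proj (im_pred f); exists p; split=> // x.
by rewrite pE; split=> /asboolP.
Qed.

Lemma homology_proj U V W (f : Hom U V) (g : Hom V W) :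
  exists (K : lmodType R) (i : Hom K V) (p : Hom K (homology f g)),
  [/\ injective i, forall x, g x = 0 <-> exists k, x = i k,
      surj p & forall k, p k = 0 <-> exists u, i k = f u].
Proof.
have [i [iv ii iE]] := ker_incl g.
have [p [sp pE]] := quotmod_proj (@bound_pred _ _ _ _ f g).
exists (ker g), i, p; split=> // k.
by rewrite pE unfold_in /= iv; split=> /asboolP.
Qed.

Lemma hom0 U V (f : Hom U V) : f 0 = 0. Proof. exact: raddf0. Qed.
Lemma homN U V (f : Hom U V) x : f (- x) = - f x. Proof. exact: raddfN. Qed.
Lemma homD U V (f : Hom U V) x y : f (x + y) = f x + f y.
Proof. exact: raddfD. Qed.
Lemma homB U V (f : Hom U V) x y : f (x - y) = f x - f y.
Proof. exact: raddfB. Qed.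
Lemma homZ U V (f : Hom U V) a x : f (a *: x) = a *: f x.
Proof. exact: linearZ. Qed.
Lemma homP U V (f : Hom U V) a x y : f (a *: x + y) = a *: f x + f y.
Proof. exact: linearP. Qed.

Lemma hom_factor U V W (p : Hom U V) (f : Hom U W) : surj p ->
  (forall x, p x = 0 -> f x = 0) -> exists g : Hom V W, forall x, f x = g (p x).
Proof.
move=> /choice[s sE] pf.
have fE x y : p x = p y -> f x = f y.
  by move=> e; apply/eqP; rewrite -subr_eq0; have := pf (x - y); rewrite !homB e subrr => ->.
have lg : linear (f \o s).
  by move=> a x y /=; rewrite -homP; apply: fE; rewrite homP -!sE.
have [g gE] := hom_of_linear lg.
by exists g => x; rewrite gE /=; apply: fE; rewrite -sE.
Qed.

Lemma hom_lift_inj U V W (i : Hom W V) (f : Hom U V) : injective i ->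
  (forall u, exists k, f u = i k) -> exists g : Hom U W, forall u, f u = i (g u).
Proof.
move=> inji /choice[s sE].
have lg : linear s by move=> a x y; apply: inji; rewrite homP -!sE homP.
by have [g gE] := hom_of_linear lg; exists g => x; rewrite gE.
Qed.

Lemma row_hom V n (v : 'I_n -> V) :
  exists f : Hom 'rV[R]_n V, forall u, f u = \sum_j u 0 j *: v j.
Proof.
have lf : linear (fun u : 'rV[R]_n => \sum_j u 0 j *: v j).
  move=> a x y; rewrite scaler_sumr -big_split; apply: eq_bigr => j _.
  by rewrite !mxE scalerDl scalerA.
by have [g gE] := hom_of_linear lf; exists g => u; rewrite gE.
Qed.

Lemma row_homE V n (f : Hom 'rV[R]_n V) u : f u = \sum_j u 0 j *: f (delta_mx 0 j).
Proof.
rewrite {1}(row_sum_delta u) raddf_sum; apply: eq_bigr => j _.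
exact: homZ.
Qed.

Lemma row_hom_delta V n (v : 'I_n -> V) :
  exists f : Hom 'rV[R]_n V, forall j, f (delta_mx 0 j) = v j.
Proof.
have [f fE] := row_hom v; exists f => j; rewrite fE (bigD1 j) //= big1 => [|k kj].
  by rewrite mxE !eqxx scale1r addr0.
by rewrite mxE (negPf kj) andbF scale0r.
Qed.

Lemma row_hom_ext V n (f g : Hom 'rV[R]_n V) :
  (forall j, f (delta_mx 0 j) = g (delta_mx 0 j)) -> f =1 g.
Proof.
by move=> fg u; rewrite row_homE [RHS]row_homE; apply: eq_bigr => j _; rewrite fg.
Qed.

Lemma row_hom_lift U V n (p : Hom U V) (f : Hom 'rV[R]_n V) :
  (forall u, exists x, f u = p x) -> exists g : Hom 'rV[R]_n U, forall u, f u = p (g u).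
Proof.
move=> /choice[s sE]; have [g gE] := row_hom_delta (fun j => s (delta_mx 0 j)).
exists g; apply: (row_hom_ext (g := (p \o g : Hom _ _))) => j /=.
by rewrite gE -sE.
Qed.

Lemma row_hom_mx n k (f : Hom 'rV[R]_n 'rV[R]_k) :
  exists D : 'M[R]_(n, k), forall u, f u = u *m D.
Proof.
exists (\matrix_i f (delta_mx 0 i)) => u; rewrite row_homE mulmx_sum_row.
by apply: eq_bigr => i _; rewrite rowK.
Qed.

(** Here [a] need not be injective: it is split into a surjection onto its image, through which [f]
    factors, and an inclusion, along which [J] extends. *)
Lemma injective_ext A B J (a : Hom A B) (f : Hom A J) :
  injective_module J -> (forall x, a x = 0 -> f x = 0) ->
  exists g : Hom B J, forall x, f x = g (a x).
Proof.
move=> Jinj af.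
have sa : submodule (fun y => exists x, y = a x).
  split=> [|c _ _ [x ->] [y ->]]; first by exists 0; rewrite hom0.
  by exists (c *: x + y); rewrite homP.
have [K [i [ii iE]]] := submodule_type sa.
have [a' a'E] := hom_lift_inj ii (fun u => (iE (a u)).1 (ex_intro _ u erefl)).
have [||f' f'E] := @hom_factor _ _ _ a' f.
- move=> y; have /iE[x e] : exists k, i y = i k by exists y.
  by exists x; apply: ii; rewrite e a'E.
- by move=> x e; apply: af; rewrite a'E e hom0.
have [g gE] := Jinj _ _ i f' ii.
by exists g => x; rewrite f'E -gE /= -a'E.
Qed.

Lemma injective_ext_inj A B J (i : Hom A B) (f : Hom A J) :
  injective_module J -> injective i -> exists g : Hom B J, forall x, f x = g (i x).
Proof.
by move=> Jinj ii; have [g gE] := Jinj _ _ i f ii; exists g => x; rewrite -gE.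
Qed.

End Toolkit.

(** * Isomorphisms of subquotients by linear relations *)

Section Subquotients.
Variable R : comNzRingType.
Implicit Types A B C J K L Q U V W X Y : lmodType R.

(* Z/B is isomorphic to Z'/B', for submodules Z, B of V and Z', B' of V'. The
   isomorphism is given by a linear relation, so connecting maps can be described
   by their zigzags, without choosing lifts. *)
Definition subquot_iso V V' (Z B : V -> Prop) (Z' B' : V' -> Prop) : Prop :=
  exists r : V -> V' -> Prop,
  [/\ forall a x y x' y', r x x' -> r y y' -> r (a *: x + y) (a *: x' + y'),
      forall x, Z x -> exists2 x', Z' x' & r x x',
      forall x', Z' x' -> exists2 x, Z x & r x x'
    & forall x x', Z x -> Z' x' -> r x x' -> (B x <-> B' x')].

Lemma subquot_iso_sym V V' (Z B : V -> Prop) (Z' B' : V' -> Prop) :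
  subquot_iso Z B Z' B' -> subquot_iso Z' B' Z B.
Proof.
move=> [r [rl rt rs rB]]; exists (fun x' x => r x x'); split=> //.
- by move=> a x y x' y'; apply: rl.
- by move=> x x' Zx Zx' /(rB _ _ Zx' Zx)[]; split.
Qed.

(** The composite relation passes through elements of [Z'] only, since the middle relation is
    controlled only there. This is why [Z'] has to be closed under linear combinations. *)
Lemma subquot_iso_trans V V' V'' (Z B : V -> Prop) (Z' B' : V' -> Prop)
    (Z'' B'' : V'' -> Prop) :
  (forall a x y, Z' x -> Z' y -> Z' (a *: x + y)) ->
  subquot_iso Z B Z' B' -> subquot_iso Z' B' Z'' B'' -> subquot_iso Z B Z'' B''.
Proof.
move=> Zl [r [rl rt rs rB]] [r' [rl' rt' rs' rB']].
exists (fun x z => exists y, [/\ Z' y, r x y & r' y z]); split.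
- move=> a x y x' y' [u [Zu rxu rux]] [v [Zv ryv rvy]].
  by exists (a *: u + v); split; [apply: Zl|apply: rl|apply: rl'].
- move=> x /rt[y Zy rxy]; have [z Zz ryz] := rt' _ Zy.
  by exists z => //; exists y.
- move=> z /rs'[y Zy ryz]; have [x Zx rxy] := rs _ Zy.
  by exists x => //; exists y.
- move=> x z Zx Zz [y [Zy rxy ryz]].
  by rewrite (rB _ _ Zx Zy rxy) (rB' _ _ Zy Zz ryz).
Qed.

(** Two values related to the same x differ by a value related to 0, which the last clause of the
    relation forces to be 0. So the relation is the graph of a bijection. *)
Lemma subquot_iso_isom Q Q' :
  subquot_iso (fun _ : Q => True) (fun x => x = 0) (fun _ : Q' => True) (fun x => x = 0) ->
  isom Q Q'.
Proof.
move=> [r [rl rt rs rB]].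
have dif x y x' y' : r x x' -> r y y' -> r (x - y) (x' - y').
  by move=> rx ry; have := rl (-1) _ _ _ _ ry rx; rewrite !scaleN1r ![- _ + _]addrC.
have uni x y y' : r x y -> r x y' -> y = y'.
  move=> rxy rxy'; apply/eqP; rewrite -subr_eq0; apply/eqP.
  by apply: (rB _ _ I I (dif _ _ _ _ rxy rxy')).1; rewrite subrr.
have /choice[f fE] : forall x, exists y, r x y.
  by move=> x; have [y _ ?] := rt x I; exists y.
have /choice[g gE] : forall y, exists x, r x y.
  by move=> y; have [x _ ?] := rs y I; exists x.
have lf : linear f by move=> a x y; apply: uni (fE _) _; apply: rl.
have [h hE] := hom_of_linear lf; exists h; exists g => x.
  apply/eqP; rewrite -subr_eq0; apply/eqP; rewrite hE.
  by apply: (rB _ _ I I (dif _ _ _ _ (gE (f x)) (fE x))).2; rewrite subrr.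
by rewrite hE; apply: uni (fE _) (gE _).
Qed.

Lemma subquot_iso_quot V Q (Z B : V -> Prop) K (i : Hom K V) (p : Hom K Q) :
  (forall x, Z x <-> exists k, x = i k) -> surj p -> (forall k, p k = 0 <-> B (i k)) ->
  subquot_iso Z B (fun _ : Q => True) (fun x => x = 0).
Proof.
move=> ZE sp pE; exists (fun x q => exists k, x = i k /\ q = p k); split.
- move=> a _ _ _ _ [k [-> ->]] [l [-> ->]].
  by exists (a *: k + l); rewrite !homP.
- by move=> x /ZE[k ->]; exists (p k) => //; exists k.
- by move=> q _; have [k ->] := sp q; exists (i k); [apply/ZE; exists k|exists k].
- by move=> _ _ _ _ [k [-> ->]]; rewrite pE.
Qed.

Lemma subquot_iso_homology U V W (f : Hom U V) (g : Hom V W) :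
  subquot_iso (fun x => g x = 0) (fun x => exists u, x = f u)
    (fun _ : homology f g => True) (fun x => x = 0).
Proof.
have [K [i [p [ii iE sp pE]]]] := homology_proj f g.
exact: subquot_iso_quot iE sp pE.
Qed.

Lemma subquot_iso_ker U V (f : Hom U V) :
  subquot_iso (fun x => f x = 0) (fun x => x = 0) (fun _ : ker f => True) (fun x => x = 0).
Proof.
have [i [iv ii iE]] := ker_incl f.
apply: (subquot_iso_quot (i := i) (p := idfun : Hom _ _) iE).
  by move=> x; exists x.
by move=> k /=; split=> [->|]; [rewrite hom0|rewrite -{1}(hom0 i) => /ii].
Qed.

Lemma subquot_iso_quotmod V (S : submodClosed V) :
  subquot_iso (fun _ : V => True) (fun x => x \in S)
    (fun _ : quotmod S => True) (fun x => x = 0).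
Proof.
have [p [sp pE]] := quotmod_proj S.
by apply: (subquot_iso_quot (i := idfun : Hom _ _)) sp pE => x; split=> // _; exists x.
Qed.

Lemma subquot_iso_of_isom Q Q' : isom Q Q' ->
  subquot_iso (fun _ : Q => True) (fun x => x = 0) (fun _ : Q' => True) (fun x => x = 0).
Proof.
move=> [f bf]; exists (fun x y => y = f x); split=> //.
- by move=> a x y _ _ -> ->; rewrite homP.
- by move=> x _; exists (f x).
- by move=> y _; case: bf => g _ fg; exists (g y).
- by move=> x _ _ _ ->; split=> [->|]; [rewrite hom0|rewrite -{1}(hom0 f) => /(bij_inj bf)].
Qed.

End Subquotients.

(** * Noetherian and local rings *)

Section FinitelyGenerated.
Variable R : comNzRingType.
Implicit Types A B C K L Q U V W X Y : lmodType R.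

(** The span of a list, peeled off one generator at a time so that proofs can go by induction on the
    list; [genP] recovers the usual linear combinations. *)
Fixpoint gen V (s : seq V) (x : V) : Prop :=
  if s is v :: s' then exists c, gen s' (x - c *: v) else x = 0.

Lemma genP V (s : seq V) x :
  gen s x <-> exists c : 'I_(size s) -> R, x = \sum_i c i *: s`_i.
Proof.
elim: s x => [|v s IH] x /=.
  by split=> [->|[c ->]]; [exists (fun=> 0)|]; rewrite big_ord0.
split=> [[a /IH[c e]]|[c e]].
  exists (fun i => if unlift ord0 i is Some j then c j else a).
  rewrite big_ord_recl unlift_none -(subrK (a *: v) x) e addrC; congr (_ + _).
  by apply: eq_bigr => i _; rewrite liftK.
exists (c ord0); apply/IH; exists (fun i => c (lift ord0 i)).
by rewrite e big_ord_recl addrC addKr.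
Qed.

Lemma gen_submodule V (s : seq V) : submodule (gen s).
Proof.
elim: s => [|v s [IH0 IHl]]; split=> //=.
- by move=> a x y -> ->; rewrite scaler0 addr0.
- by exists 0; rewrite scale0r subr0.
- move=> a x y [c gx] [c' gy]; exists (a * c + c').
  have := IHl a _ _ gx gy; rewrite scalerBr scalerA addrACA -opprD -scalerDl; exact.
Qed.

Lemma submoduleB V (P : V -> Prop) x y : submodule P -> P x -> P y -> P (x - y).
Proof. by move=> [_ Pl] Px Py; have := Pl (-1) _ _ Py Px; rewrite scaleN1r addrC. Qed.

Lemma submoduleD V (P : V -> Prop) x y : submodule P -> P x -> P y -> P (x + y).
Proof. by move=> [_ Pl] Px Py; have := Pl 1 _ _ Px Py; rewrite scale1r. Qed.

Lemma submoduleZ V (P : V -> Prop) a x : submodule P -> P x -> P (a *: x).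
Proof. by move=> [P0 Pl] Px; have := Pl a _ _ Px P0; rewrite addr0. Qed.

Lemma gen_cons V v (s : seq V) x : gen s x -> gen (v :: s) x.
Proof. by exists 0; rewrite scale0r subr0. Qed.

Lemma gen_head V v (s : seq V) : gen (v :: s) v.
Proof. by exists 1; rewrite scale1r subrr; case: (gen_submodule s). Qed.

Lemma gen_cat V (s t : seq V) x : gen (s ++ t) x <-> exists2 y, gen s y & gen t (x - y).
Proof.
elim: s x => [|v s IH] x /=.
  by split=> [g|[y ->]]; [exists 0|]; rewrite ?subr0.
split=> [[c /IH[y gy gt]]|[y [c gy] gt]].
  exists (y + c *: v); first by exists c; rewrite addrK.
  by rewrite opprD addrA addrAC.
exists c; apply/IH; exists (y - c *: v) => //.
by rewrite opprB addrA subrK.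
Qed.

Lemma gen_map V W (f : Hom V W) (s : seq V) y :
  gen (map f s) y <-> exists2 x, gen s x & y = f x.
Proof.
elim: s y => [|v s IH] y /=.
  by split=> [->|[x -> ->]]; [exists 0|]; rewrite ?hom0.
split=> [[c /IH[x gx e]]|[x [c gx] ->]].
  exists (x + c *: v); first by exists c; rewrite addrK.
  by rewrite homD homZ -e subrK.
by exists c; apply/IH; exists (x - c *: v); rewrite // (homB f) (homZ f).
Qed.

Lemma fin_gen_gen V : fin_gen V <-> exists s : seq V, forall x, gen s x.
Proof. by split=> -[s sP]; exists s => x; apply/genP; apply: sP. Qed.

Lemma fin_gen_surj V W (f : Hom V W) : surj f -> fin_gen V -> fin_gen W.
Proof.
move=> sf /fin_gen_gen[s sP]; apply/fin_gen_gen; exists (map f s) => y.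
by apply/gen_map; have [x ->] := sf y; exists x.
Qed.

Lemma fin_gen_row n : fin_gen ('rV[R]_n : lmodType R).
Proof.
apply/fin_gen_gen; exists [seq delta_mx 0 j | j <- enum 'I_n] => x.
rewrite (row_sum_delta x).
apply: (big_ind (gen (V := 'rV[R]_n : lmodType R) _)) => [|u v gu gv|j _].
- by case: (gen_submodule (V := 'rV[R]_n : lmodType R) [seq delta_mx 0 j | j <- enum 'I_n]).
- exact: submoduleD (gen_submodule _) gu gv.
apply: submoduleZ; first exact: gen_submodule.
have: j \in enum 'I_n by rewrite mem_enum.
elim: (enum 'I_n) => //= k s IH; rewrite inE => /orP[/eqP ->|/IH]; first exact: gen_head.
exact: gen_cons.
Qed.

Lemma fin_gen_cover X : fin_gen X -> exists n (p : Hom 'rV[R]_n X), surj p.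
Proof.
move=> [s sP]; have [p pE] := row_hom (fun i : 'I_(size s) => s`_i).
exists (size s), p => x; have [c ->] := sP x; exists (\row_i c i).
by rewrite pE; apply: eq_bigr => i _; rewrite mxE.
Qed.

Definition ideal (I : R -> Prop) : Prop :=
  I 0 /\ forall a x y, I x -> I y -> I (a * x + y).

Lemma idealMl I a x : ideal I -> I x -> I (a * x).
Proof. by move=> [I0 Il] Ix; have := Il a _ _ Ix I0; rewrite addr0. Qed.

Lemma idealD I x y : ideal I -> I x -> I y -> I (x + y).
Proof. by move=> [I0 Il] Ix Iy; have := Il 1 _ _ Ix Iy; rewrite mul1r. Qed.

Lemma idealr_ideal (p : idealr R) : ideal (fun x => x \in p).
Proof.
by split=> [|a x y xp yp]; rewrite ?idealr0 // rpredD // idealMr.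
Qed.

Hypothesis R_noeth : noetherian R.

Lemma ideal_gen (I : R -> Prop) : ideal I ->
  exists s : seq (R^o : lmodType R), forall x, I x <-> gen s x.
Proof.
move=> Ii; have [S SP] := @submodule_closed _ (R^o : lmodType R) I Ii.
have [i [_ ii iE]] := submod_incl S.
have /fin_gen_gen[s sP] := R_noeth S.
exists (map i s) => x; rewrite -SP iE gen_map.
by split=> -[k]; [exists k|exists k].
Qed.

(** Induction on the generators. The coefficients at [v] of elements of [P] form an ideal [I], which
    is finitely generated. Lifts [ys] of its generators, together with generators of the part of [P]
    lying in the span of [s], generate [P]. *)
Lemma noetherian_submodule V (s : seq V) (P : V -> Prop) : submodule P ->
  (forall x, P x -> gen s x) -> exists t, forall x, P x <-> gen t x.
Proof.
elim: s P => [|v s IH] P sP Ps.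
  by exists [::] => x; split=> [/Ps //|-> ]; case: sP.
pose I a := exists2 y, P y & gen s (y - a *: v).
have [gs0 gsl] := gen_submodule s.
have Ii : ideal I.
  split=> [|a x y [u Pu gu] [w Pw gw]].
    by exists 0; [case: sP|rewrite scale0r subr0].
  exists (a *: u + w); first by case: sP => _; apply.
  by have := gsl a _ _ gu gw; rewrite scalerBr scalerA addrACA -opprD -scalerDl.
have [tI tIP] := ideal_gen Ii.
have [ys ysP ysg] : exists2 ys, forall y, gen ys y -> P y &
    forall a : R^o, gen tI a -> exists2 y, gen ys y & gen s (y - a *: v).
  have: forall a : R^o, gen tI a -> I a by move=> a /tIP.
  elim: (tI) => [|a l IHl] lI.
    exists [::] => [y ->|b ->]; first by case: sP.
    by exists 0; rewrite // scale0r subr0.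
  have [|ys ysP ysg] := IHl; first by move=> b gb; apply/lI/gen_cons.
  have [y Py gy] := lI _ (gen_head a l).
  exists (y :: ys) => [z [c /ysP Pz]|b [c /ysg[z gz gz']]].
    by rewrite -(subrK (c *: y) z); apply: submoduleD => //; apply: submoduleZ.
  exists (c *: y + z); first by exists c; rewrite addrC addrA addNr add0r.
  have := gsl c _ _ gy gz'; rewrite scalerBr scalerA addrACA -opprD -scalerDl.
  by rewrite [c * a + _]addrC; rewrite subrK.
have [||t tP] := IH (fun x => P x /\ gen s x).
- split=> [|a x y [Px gx] [Py gy]]; first by split=> //; case: sP.
  by split; [case: sP => _; apply|apply: gsl].
- by move=> x [].
exists (ys ++ t) => x; rewrite gen_cat; split=> [Px|[y /ysP Py /tP[Pxy _]]].
  have [c gx] := Ps _ Px.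
  have /tIP/ysg[y gy gy'] : I c by exists x.
  exists y => //; apply/tP; split; first by apply: submoduleB => //; apply: ysP.
  by have := submoduleB (gen_submodule s) gx gy'; rewrite opprB addrA subrK.
by rewrite -(subrK y x); apply: submoduleD.
Qed.

Lemma fin_gen_sub V K (i : Hom K V) : injective i -> fin_gen V -> fin_gen K.
Proof.
move=> ii /fin_gen_gen[s sP].
have si : submodule (fun y => exists x, y = i x).
  split=> [|a _ _ [x ->] [y ->]]; first by exists 0; rewrite hom0.
  by exists (a *: x + y); rewrite homP.
have [t tP] := noetherian_submodule si (fun x _ => sP x).
have [u tE] : exists u, t = map i u.
  have: forall x, x \in t -> exists k, x = i k.
    move=> x xt; apply/tP; elim: (t) xt => //= y l IH; rewrite inE => /orP[/eqP ->|/IH].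
      exact: gen_head.
    exact: gen_cons.
  elim: (t) => [|y l IH] h; first by exists [::].
  have [u ->] := IH (fun x xl => h x (mem_behead (s := y :: l) xl)).
  by have [k ->] := h y (mem_head y l); exists (k :: u).
apply/fin_gen_gen; exists u => x.
have /tP : exists y, i x = i y by exists x.
by rewrite tE => /gen_map[y gy /ii ->].
Qed.

(** Induction from larger ideals to smaller ones. A counterexample would, by choice, start a
    strictly ascending chain of ideals; the union is finitely generated, so the chain stops growing
    at some stage. *)
Lemma noetherian_ind (Phi : (R -> Prop) -> Prop) :
  (forall I, ideal I ->
     (forall J, ideal J -> (forall x, I x -> J x) -> (exists x, J x /\ ~ I x) -> Phi J) ->
     Phi I) ->
  forall I, ideal I -> Phi I.
Proof.
move=> step I Ii; apply: contrapT => nPhi.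
pose T := {J : R -> Prop | ideal J /\ ~ Phi J}.
have /choice[next nextP] : forall J : T, exists J' : T,
    (forall x, sval J x -> sval J' x) /\ exists x, sval J' x /\ ~ sval J x.
  move=> [J [Ji nJ]] /=; apply: contrapT => nex; apply: nJ; apply: step => // J' J'i sub ex.
  by apply: contrapT => nJ'; apply: nex; exists (exist _ J' (conj J'i nJ')).
pose c n := iter n next (exist _ I (conj Ii nPhi)).
have cle n k x : sval (c n) x -> sval (c (n + k)%N) x.
  by elim: k => [|k IH]; rewrite ?addn0 // addnS => /IH; apply: (nextP (c (n + k)%N)).1.
have cle' n k x : (n <= k)%N -> sval (c n) x -> sval (c k) x.
  by move=> /subnKC <-; apply: cle.
pose U x := exists n, sval (c n) x.
have Ui : ideal U.
  split=> [|a x y [n xn] [k yk]]; first by exists 0%N; exact: Ii.1.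
  exists (maxn n k); have [[_ h] _] := svalP (c (maxn n k)).
  by apply: h; [apply: cle' xn; apply: leq_maxl|apply: cle' yk; apply: leq_maxr].
have [s sP] := ideal_gen Ui.
have [n nP] : exists n, forall x, gen s x -> sval (c n) x.
  have: forall x, gen s x -> U x by move=> x /sP.
  elim: (s) => [|v l IH] h; first by exists 0%N => x ->; exact: Ii.1.
  have [|n nP] := IH; first by move=> x gx; apply/h/gen_cons.
  have [k kP] := h _ (gen_head v l).
  exists (maxn n k) => x [a /nP xn]; have [ci _] := svalP (c (maxn n k)).
  rewrite -(subrK (a *: v) x); apply: idealD => //; first by apply: cle' xn; apply: leq_maxl.
  by apply: idealMl => //; apply: cle' kP; apply: leq_maxr.
have [_ [x [xn nx]]] := nextP (c n).
by apply/nx/nP/sP; exists n.+1.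
Qed.

Lemma ideal_idealr (I : R -> Prop) : ideal I -> ~ I 1 ->
  exists p : idealr R, forall x, x \in p <-> I x.
Proof.
move=> [I0 Il] I1; pose p : {pred R} := fun x => `[<I x>].
have cp : idealr_closed p.
  split; [exact/asboolP|exact/asboolP|].
  by move=> a x y /asboolP Ix /asboolP Iy; apply/asboolP/Il.
pose mix := isIdealr.Build R p cp.
pose q : idealr R := HB.pack p mix.
by exists q => x; split=> /asboolP.
Qed.

Variable m : idealr R.
Hypothesis R_local : local_ring m.

(** A proper ideal with no strictly larger proper ideal is maximal, hence equal to m; any other one
    is enlarged and the induction applies. *)
Lemma proper_sub_max (I : R -> Prop) : ideal I -> ~ I 1 -> forall x, I x -> x \in m.
Proof.
move=> Ii; move: I Ii; apply: noetherian_ind => I Ii IH I1 x Ix.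
have [[J [Ji [J1 [sub ex]]]]|nJ] := pselect (exists J, ideal J /\ ~ J 1 /\
   (forall x, I x -> J x) /\ (exists x, J x /\ ~ I x)).
  by apply: (IH J) => //; apply: sub.
have [p pE] := ideal_idealr Ii I1.
rewrite -(R_local.2 p); first exact/pE.
move=> J sub y yJ; apply: contrapT => yp; apply: nJ; exists (fun x => x \in J).
split; first exact: idealr_ideal.
split; first by rewrite idealr1.
split; first by move=> z /pE; apply: sub.
by exists y; split=> // /pE.
Qed.

Lemma max_unit x : x \notin m -> exists y, y * x = 1.
Proof.
move=> xm; apply: contrapT => nex; move/negP: xm; apply.
apply: (@proper_sub_max (fun z => exists y, y * x = z)).
- split=> [|a _ _ [y <-] [z <-]]; first by exists 0; rewrite mul0r.
  by exists (a * y + z); rewrite mulrDl mulrA.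
- by [].
- by exists 1; rewrite mul1r.
Qed.

(** Nakayama for the quotient of [Z] by [B], stated with predicates because it is applied to
    cocycles modulo coboundaries, whose ambient module of maps need not be finitely generated. The
    generators are removed one by one. *)
Lemma nakayama V (Z B : V -> Prop) (s : seq V) a : a \in m ->
  submodule Z -> submodule B -> (forall x, gen s x -> Z x) ->
  (forall x, Z x -> exists2 y, gen s y & B (x - y)) ->
  (forall x, Z x -> exists2 y, Z y & B (x - a *: y)) -> forall x, Z x -> B x.
Proof.
move=> am sZ sB; elim: s => [|v s IH] sg gs aZ.
  by move=> x Zx; have [_ -> ] := gs _ Zx; rewrite subr0.
suff gs' : forall x, Z x -> exists2 y, gen s y & B (x - y).
  by apply: (IH _ gs' aZ) => y gy; apply/sg/gen_cons.
move=> x Zx.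
have gsm := gen_submodule s.
have [w gw Bw] : exists2 w, gen s w & B (v - w).
  have [y Zy By] := aZ _ (sg _ (gen_head v s)).
  have [z [c gz] Bz] := gs _ Zy.
  (* Modulo [B], [v] is a times z, and z has coefficient c at [v]. Collecting terms leaves (1 - a c)
     v in the span of [s], and 1 - a c is a unit because a lies in m. *)
  have [|u uE] := @max_unit (1 - a * c).
    apply/negP => h; have := idealD (idealr_ideal m) h (idealMr c am).
    by rewrite mulrC subrK idealr1.
  exists ((u * a) *: (z - c *: v)); first exact: submoduleZ.
  have := submoduleZ u sB (submoduleD sB By (submoduleZ a sB Bz)).
  rewrite scalerBr addrA subrK => h.
  have -> : v - (u * a) *: (z - c *: v) = u *: (v - a *: z); last exact: h.
  have vE : v = u *: v - (u * a * c) *: v.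
    by rewrite -scalerBl -mulrA -{1}[u]mulr1 -mulrBr uE scale1r.
  by rewrite {1}vE !scalerBr !scalerA opprB addrA subrK.
have [y [c gy] By] := gs _ Zx.
exists (c *: w + (y - c *: v)); first by apply: submoduleD => //; apply: submoduleZ.
have := submoduleD sB By (submoduleZ c sB Bw).
rewrite scalerBr; congr (B _).
by rewrite opprD opprB [- _ + (_ - _)]addrC -!addrA; congr (_ + _); rewrite addrCA.
Qed.

End FinitelyGenerated.

(** * Devissage, prime ideals and socles *)

Section LocalAlgebra.
Variable R : comNzRingType.
Implicit Types A B C K Q U V W X Y M : lmodType R.

Definition short_exact A B C (i : Hom A B) (p : Hom B C) : Prop :=
  [/\ injective i, surj p & forall b, p b = 0 <-> exists a, b = i a].

Lemma short_exact_submodule V (P : V -> Prop) : submodule P ->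
  exists (A C : lmodType R) (i : Hom A V) (p : Hom V C),
    short_exact i p /\ forall x, P x <-> exists a, x = i a.
Proof.
move=> sP; have [A [i [ii iE]]] := submodule_type sP.
have [C [p [sp pE]]] := quotient_type sP.
by exists A, C, i, p; split=> //; split=> // b; rewrite pE.
Qed.

Lemma scalar_submodule V (v : V) : submodule (fun y => exists r, y = r *: v).
Proof.
split=> [|a _ _ [r ->] [r' ->]]; first by exists 0; rewrite scale0r.
by exists (a * r + r'); rewrite scalerDl scalerA.
Qed.

Lemma multiple_submodule V (a : R) : submodule (fun y : V => exists z, y = a *: z).
Proof.
split=> [|b _ _ [r ->] [r' ->]]; first by exists 0; rewrite scaler0.
by exists (b *: r + r'); rewrite scalerDr !scalerA mulrC.
Qed.

Lemma cyclic_hom X Q (x : X) (y : Q) : (forall z, exists r, z = r *: x) ->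
  (forall r, r *: x = 0 -> r *: y = 0) -> exists g : Hom X Q, g x = y.
Proof.
move=> xg xy.
have lin V (v : V) : linear (fun r : R^o => (r : R) *: v).
  by move=> a r r'; rewrite scalerDl scalerA.
have [p pE] := hom_of_linear (lin _ x); have [f fE] := hom_of_linear (lin _ y).
have [||g gE] := @hom_factor _ _ _ _ p f.
- by move=> z; have [r ->] := xg z; exists r; rewrite pE.
- by move=> r; rewrite pE fE; apply: xy.
by exists g; have := gE 1; rewrite pE fE !scale1r.
Qed.

Definition annih X (x : X) (r : R) : Prop := r *: x = 0.

Lemma annih_ideal X (x : X) : ideal (annih x).
Proof.
by split=> [|a r r']; rewrite /annih ?scale0r // scalerDl -scalerA => -> ->; rewrite scaler0 addr0.
Qed.

Hypothesis R_noeth : noetherian R.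
Variable m : idealr R.

(** Extensions reduce the claim to cyclic modules, treated by noetherian induction on the
    annihilator. If some a in m neither kills the generator x nor is regular on X, split X into aX
    and X/aX. The annihilator grows in both: for aX it gains r, where z = r x is a nonzero element
    killed by a, and for X/aX it gains a. *)
Lemma devissage (Phi : lmodType R -> Prop) :
  (forall A B C (i : Hom A B) (p : Hom B C), short_exact i p -> Phi A -> Phi C -> Phi B) ->
  (forall X (x : X), (forall y, exists r, y = r *: x) ->
     (forall a, a \in m -> a *: x = 0) -> Phi X) ->
  (forall X a, fin_gen X -> a \in m -> (forall x : X, a *: x = 0 -> x = 0) -> Phi X) ->
  forall X, fin_gen X -> Phi X.
Proof.
move=> ext base reg.
have cyc : forall I, ideal I -> forall X (x : X), (forall y, exists r, y = r *: x) ->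
    (forall r, annih x r <-> I r) -> Phi X.
  apply: noetherian_ind => // I Ii IH X x xg xI.
  have [xm|] := pselect (forall a, a \in m -> a *: x = 0); first exact: base xg xm.
  move=> /existsNP[a /not_implyP[am ax]].
  have fgX : fin_gen X.
    apply/fin_gen_gen; exists [:: x] => y; have [r ->] := xg y.
    by exists r; rewrite subrr.
  have [areg|] := pselect (forall y : X, a *: y = 0 -> y = 0); first exact: reg areg.
  move=> /existsNP[z /not_implyP[az z0]].
  have [A [C [i [p [se iE]]]]] := short_exact_submodule (multiple_submodule X a).
  case: (se) => ii sp pE.
  have [a' a'E] : exists a', a *: x = i a' by apply/iE; exists x.
  apply: (ext _ _ _ _ _ se).
    apply: (IH (annih a') (annih_ideal _) _ _ _ a') => //.
    - move=> r /xI rx; apply: ii; rewrite homZ -a'E scalerA mulrC -scalerA rx.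
      by rewrite scaler0 hom0.
    - have [r zr] := xg z; exists r; split.
        by apply: ii; rewrite homZ -a'E scalerA mulrC -scalerA -zr az hom0.
      by move=> /xI rx; apply: z0; rewrite zr.
    - move=> y; have /iE[w wE] : exists k, i y = i k by exists y.
      have [r wr] := xg w; exists r; apply: ii; rewrite wE wr homZ -a'E !scalerA mulrC //.
  apply: (IH (annih (p x)) (annih_ideal _) _ _ _ (p x)) => //.
  - by move=> r /xI rx; rewrite /annih -homZ rx hom0.
  - exists a; split; last by move=> /xI.
    by rewrite /annih -homZ; apply/pE; exists a'.
  - by move=> y; have [w ->] := sp y; have [r ->] := xg w; exists r; rewrite homZ.
suff gens n : forall X (s : seq X), size s = n -> (forall x, gen s x) -> Phi X.
  by move=> X /fin_gen_gen[s]; apply: gens erefl.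
elim: n => [|n IH] X [|v s] //= sn sg.
  by apply: (base _ (0 : X)) => [y|a _]; [exists 0; rewrite (sg y) scaler0|rewrite scaler0].
have [A [C [i [p [se iE]]]]] := short_exact_submodule (scalar_submodule v).
case: (se) => ii sp pE.
apply: (ext _ _ _ _ _ se).
  have [v' v'E] : exists v', v = i v' by apply/iE; exists 1; rewrite scale1r.
  apply: (cyc _ (annih_ideal v') _ v') => // y.
  have /iE[r rE] : exists k, i y = i k by exists y.
  by exists r; apply: ii; rewrite rE v'E homZ.
apply: (IH _ (map p s)) => [|y]; first by rewrite size_map; case: sn.
have [x ->] := sp y.
have [c gc] := sg x; apply/gen_map; exists (x - c *: v) => //.
rewrite homB homZ; have -> : p v = 0 by apply/pE/iE; exists 1; rewrite scale1r.
by rewrite scaler0 subr0.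
Qed.

(** An ideal maximal among those missing [S] is prime: if u and v lie outside it, then I + (u) and I
    + (v) both meet [S], and the product of the two elements found would lie in I as soon as uv
    does. *)
Lemma prime_avoiding (I S : R -> Prop) : ideal I -> S 1 ->
  (forall x y, S x -> S y -> S (x * y)) -> (forall x, I x -> ~ S x) ->
  exists p : prime_idealr R, (forall x, I x -> x \in p) /\ (forall x, S x -> x \notin p).
Proof.
move=> Ii S1 SM; move: I Ii; apply: noetherian_ind => // I Ii IH IS.
have [[J [Ji [sub [ex JS]]]]|nJ] := pselect (exists J, ideal J /\ (forall x, I x -> J x) /\
   (exists x, J x /\ ~ I x) /\ (forall x, J x -> ~ S x)).
  by have [p [Jp pS]] := IH J Ji sub ex JS; exists p; split=> // x /sub/Jp.
pose p : {pred R} := fun x => `[<I x>].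
have I1 : ~ I 1 by move=> /IS.
have cp : idealr_closed p.
  case: (Ii) => I0 Il; split; [exact/asboolP|exact/asboolP|].
  by move=> a x y /asboolP Ix /asboolP Iy; apply/asboolP/Il.
have meets u : ~ I u -> exists i r, I i /\ S (i + r * u).
  move=> nu; apply: contrapT => nS; apply: nJ.
  exists (fun x => exists i r, I i /\ x = i + r * u); split; [|split; [|split]].
  - split=> [|a _ _ [i [r [Ix ->]]] [j [r' [Ij ->]]]].
      by exists 0, 0; rewrite mul0r addr0; split=> //; case: Ii.
    exists (a * i + j), (a * r + r'); split; first by case: Ii => _; apply.
    by rewrite mulrDr mulrDl addrACA mulrA.
  - by move=> x Ix; exists x, 0; rewrite mul0r addr0.
  - by exists u; split=> //; exists 0, 1; rewrite mul1r add0r; split=> //; case: Ii.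
  - by move=> _ [i [r [Ix ->]]] Sx; apply: nS; exists i, r.
have pp : prime_idealr_closed p.
  move=> u v /asboolP uv; apply: contrapT => /negP; rewrite negb_or => /andP[nu nv].
  have [|i [r [Ix Su]]] := meets u; first by move=> h; move: nu; rewrite unfold_in; move/asboolP.
  have [|j [r' [Ij Sv]]] := meets v; first by move=> h; move: nv; rewrite unfold_in; move/asboolP.
  apply: (IS _ _ (SM _ _ Su Sv)).
  rewrite mulrDl; apply: (idealD Ii); first by rewrite mulrC; apply: idealMl.
  rewrite mulrDr; apply: (idealD Ii); first exact: idealMl.
  by rewrite mulrACA; apply: (idealMl _ Ii).
pose q : prime_idealr R := HB.pack p (isIdealr.Build R p cp) (isPrimeIdealrClosed.Build R p pp).
exists q; split=> x Hx; first exact/asboolP.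
by apply/negP => /asboolP /IS.
Qed.

(* The unit ideal counts as primary. *)
Definition primary (I : R -> Prop) : Prop := forall a, a \in m -> exists n, I (a ^+ n).

(** If no power of a in m lay in I, some prime would contain I and miss all powers of a. Missing a,
    it differs from m, contrary to the hypothesis. *)
Lemma primary_of_primes (I : R -> Prop) : ideal I ->
  (forall p : prime_idealr R, ~ p =i m -> exists x, I x /\ x \notin p) -> primary I.
Proof.
move=> Ii Ip a am; apply: contrapT => na.
have [||||p [Isub Sp]] := @prime_avoiding I (fun x => exists n, x = a ^+ n) => //.
- by exists 0%N.
- by move=> _ _ [n ->] [k ->]; exists (n + k)%N; rewrite exprD.
- by move=> x Ix [n e]; apply: na; exists n; rewrite -e.
have [|x [/Isub xp]] := Ip p; last by rewrite xp.
move=> /(_ a); rewrite am => ap.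
by move: (Sp a (ex_intro _ 1%N (esym (expr1 a)))); rewrite ap.
Qed.

Lemma primary_min X (x : X) a : x <> 0 -> (exists n, a ^+ n *: x = 0) ->
  exists n, a ^+ n *: x <> 0 /\ a *: (a ^+ n *: x) = 0.
Proof.
move=> x0 [n]; elim: n => [|n IH]; first by rewrite expr0 scale1r.
have [|nz] := pselect (a ^+ n *: x = 0); first by move=> /IH.
by rewrite exprS -scalerA => e; exists n.
Qed.

(** Noetherian induction on the annihilator of x. If a in m does not kill x, the last nonzero a^n x
    is killed by a, so its annihilator is strictly larger, and it is still primary. *)
Lemma socle X (x : X) : x <> 0 -> primary (annih x) ->
  exists y : X, y <> 0 /\ forall a, a \in m -> a *: y = 0.
Proof.
suff: forall I, ideal I -> forall x : X, (forall r, annih x r <-> I r) -> x <> 0 ->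
    primary I -> exists y : X, y <> 0 /\ forall a, a \in m -> a *: y = 0.
  by move=> h x0 px; apply: (h _ (annih_ideal x) x).
apply: noetherian_ind => // I Ii IH {}x xI x0 pI.
have [xm|] := pselect (forall a, a \in m -> a *: x = 0); first by exists x.
move=> /existsNP[a /not_implyP[am ax]].
have [|n [nz aa]] := @primary_min _ x a x0.
  by have [n /xI] := pI _ am; exists n.
apply: (IH (annih (a ^+ n *: x)) (annih_ideal _) _ _ (a ^+ n *: x)) => //.
- by move=> r /xI; rewrite /annih scalerA mulrC -scalerA => ->; rewrite scaler0.
- by exists a; split=> // /xI.
- move=> b /pI[k /xI bk]; exists k.
  by rewrite /annih scalerA mulrC -scalerA [_ *: x]bk scaler0.
Qed.

End LocalAlgebra.

(** * Regular sequences and dimension *)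

Section RegularSequences.
Variable R : comNzRingType.
Implicit Types A B C K Q U V W X Y M : lmodType R.

Lemma seqmulP M (t : seq R) x : x \in seqmul_pred (M := M) t <->
  exists y : nat -> M, x = \sum_(i < size t) t`_i *: y i.
Proof.
split=> [/asboolP[y ->]|[y ->]]; last by apply/asboolP; exists y.
exists (fun n => oapp y 0 (insub n)); apply: eq_bigr => i _.
by rewrite valK.
Qed.

Lemma seqmul_rcons M (t : seq R) a x : x \in seqmul_pred (M := M) (rcons t a) <->
  exists y z, z \in seqmul_pred (M := M) t /\ x = a *: y + z.
Proof.
split=> [/seqmulP[y]|[y [_ [/seqmulP[z ->]] ->]]].
  rewrite size_rcons big_ord_recr /= nth_rcons ltnn eqxx => ->.
  exists (y (size t)), (\sum_(i < size t) t`_i *: y i); split; last first.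
    rewrite addrC; congr (_ + _); apply: eq_bigr => i _.
    by rewrite nth_rcons ltn_ord.
  by apply/seqmulP; exists y.
apply/seqmulP; exists (fun n => if n == size t then y else z n).
rewrite size_rcons big_ord_recr /= nth_rcons ltnn eqxx addrC; congr (_ + _).
apply: eq_bigr => i _; rewrite nth_rcons ltn_ord.
by rewrite (ltn_eqF (ltn_ord i)).
Qed.

(* T j is M/(s_0, ..., s_(j-1))M. *)
Record regular_tower M (s : seq R) (T : nat -> lmodType R)
    (pr : forall j, Hom M (T j)) (q : forall j, Hom (T j) (T j.+1)) : Prop := {
  tower_surj : forall j, surj (pr j);
  tower_inj : injective (pr 0%N);
  tower_next_surj : forall j, surj (q j);
  tower_compat : forall j x, q j (pr j x) = pr j.+1 x;
  tower_reg : forall j, (j < size s)%N -> forall x : T j, s`_j *: x = 0 -> x = 0;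
  tower_ker : forall j, (j < size s)%N ->
    forall x, q j x = 0 <-> exists y, x = s`_j *: y;
  tower_neq0 : exists x : T (size s), x <> 0 }.

Lemma regular_towerP M (s : seq R) : regular_seq M s ->
  exists T pr q, @regular_tower M s T pr q.
Proof.
move=> [reg neq0].
pose L j := seqmul_pred (M := M) (take j s).
pose T j : lmodType R := quotmod (L j).
have [pr piP] : {pr : forall j, Hom M (T j) &
    forall j, surj (pr j) /\ forall x, pr j x = 0 <-> x \in L j}.
  by move: (fun j => cid (quotmod_proj (L j))) => /all_sig[pr piP]; exists pr.
have LS j x : (j < size s)%N ->
    x \in L j.+1 <-> exists y z, z \in L j /\ x = s`_j *: y + z.
  by move=> js; rewrite /L (take_nth 0 js); apply: seqmul_rcons.
have LSsub j x : x \in L j -> x \in L j.+1.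
  have [js|js] := ltnP j (size s).
    by move=> xL; apply/LS => //; exists 0, x; rewrite scaler0 add0r.
  by rewrite /L !take_oversize // (leq_trans js).
have qex j : exists q : Hom (T j) (T j.+1), forall x, pr j.+1 x = q (pr j x).
  apply: hom_factor; first by case: (piP j).
  by move=> x /(piP j).2 xL; apply/(piP j.+1).2/LSsub.
have [q qP] : {q : forall j, Hom (T j) (T j.+1) & forall j x, pr j.+1 x = q j (pr j x)}.
  by move: (fun j => cid (qex j)) => /all_sig[q qP]; exists q.
exists T, pr, q; split=> //.
- by move=> j; case: (piP j).
- move=> x y e; apply/eqP; rewrite -subr_eq0; apply/eqP.
  have /(piP 0%N).2/seqmulP : pr 0%N (x - y) = 0 by rewrite homB e subrr.
  by rewrite take0 => -[z]; rewrite big_ord0.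
- move=> j y; have [x ->] := (piP j.+1).1 y; exists (pr j x); exact: qP.
- move=> j js x; have [y ->] := (piP j).1 x; rewrite -qP; split.
    move=> /(piP j.+1).2/(LS _ _ js)[w [z [/(piP j).2 zL ->]]].
    by exists (pr j w); rewrite homD zL addr0 homZ.
  move=> [w]; have [v ->] := (piP j).1 w => e.
  apply/(piP j.+1).2/(LS _ _ js); exists v, (y - s`_j *: v).
  split; last by rewrite addrC subrK.
  by apply/(piP j).2; rewrite homB homZ e subrr.
- have [p [sp pE]] := quotmod_proj (seqmul_pred (M := M) s).
  have [x x0] := neq0; have [v vE] := sp x.
  exists (pr (size s) v) => /(piP _).2; rewrite /L take_size => /pE.
  by rewrite -vE.
Qed.

End RegularSequences.

Section Dimension.
Variable R : comNzRingType.
Hypothesis R_noeth : noetherian R.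
Variable m : idealr R.
Hypothesis R_local : local_ring m.

Lemma krull_dim_unique d d' : krull_dim R d -> krull_dim R d' -> d = d'.
Proof.
move=> [[p pc] pb] [[p' pc'] pb']; apply/eqP; rewrite eqn_leq.
by rewrite (pb' _ _ pc) (pb _ _ pc').
Qed.

Lemma regular_pow (s : seq R) (T : nat -> lmodType R) (pr : forall j, Hom R^o (T j)) q :
  regular_tower s pr q -> forall j, (j < size s)%N ->
  forall k (x : T j), s`_j ^+ k *: x = 0 -> x = 0.
Proof.
move=> tw j js; elim=> [|k IH] x; first by rewrite expr0 scale1r.
by rewrite exprS -scalerA => /(tower_reg tw js)/IH.
Qed.

(* The prime one step below p avoids the multiplicative set generated by s_j
   and the complement of p; this set misses (s_0, ..., s_(j-1)) by regularity. *)
Lemma tower_chain (s : seq R) (T : nat -> lmodType R) (pr : forall j, Hom R^o (T j)) q :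
  regular_tower s pr q -> forall j, (j <= size s)%N -> forall p : prime_idealr R,
  (forall r : R^o, pr j r = 0 -> r \in p) -> exists c, prime_chain j c /\ c j = p.
Proof.
move=> tw; elim=> [|j IH] js p sub; first by exists (fun=> p).
pose S x := exists s0 k, s0 \notin p /\ x = s0 * s`_j ^+ k.
have sp : s`_j \in p.
  apply: sub; rewrite -[s`_j]mulr1 (homZ _ s`_j (1 : R^o)) -(tower_compat tw) -homZ.
  by apply/(tower_ker tw js); exists (pr j 1).
have [||||p' [Ip' Sp']] := @prime_avoiding _ R_noeth (fun r => pr j (r : R^o) = 0) S.
- split=> [|a x y x0 y0]; first exact: hom0.
  by rewrite (homP _ a (x : R^o)) x0 y0 scaler0 addr0.
- by exists 1, 0%N; rewrite idealr1 expr0 mulr1.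
- move=> _ _ [a [k [ap ->]]] [b [l [bp ->]]]; exists (a * b), (k + l)%N.
  by rewrite prime_idealrM negb_or ap bp exprD mulrACA.
- move=> _ /[swap] [[a [k [ap ->]]]]; rewrite mulrC (homZ _ _ (a : R^o)) => /(regular_pow tw js) a0.
  by move/negP: ap; apply; apply: sub; rewrite -(tower_compat tw) a0 hom0.
have [c [cc cj]] := IH (ltnW js) p' Ip'.
have p'p x : x \in p' -> x \in p.
  move=> xp'; case: (boolP (x \in p)) => // xp.
  by have := Sp' x (ex_intro _ x (ex_intro _ 0%N (conj xp (esym (mulr1 x))))); rewrite xp'.
have sp' : s`_j \notin p'.
  by apply: Sp'; exists 1, 1%N; rewrite idealr1 mul1r expr1.
exists (fun i => if (i <= j)%N then c i else p); rewrite ltnn; split=> // i ij.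
have /orP[/eqP ->|{}ij] : (i == j) || (i < j)%N by rewrite -leq_eqVlt.
  rewrite /= leqnn ltnn cj; split=> // sub'.
  by move: (sub' _ sp); rewrite (negPf sp').
by rewrite /= (ltnW ij) ij; apply: cc.
Qed.

(** A prime other than m that contains the regular sequence would be the top of a chain of length
    [size s]. Adding m on top gives a chain longer than the dimension. *)
Lemma regular_primary (s : seq R) (T : nat -> lmodType R) (pr : forall j, Hom R^o (T j)) q :
  krull_dim R (size s) -> regular_tower s pr q ->
  primary m (fun r => pr (size s) (r : R^o) = 0).
Proof.
move=> [_ dimb] tw; apply: primary_of_primes => //.
  split=> [|a x y x0 y0]; first exact: hom0.
  by rewrite (homP _ a (x : R^o)) x0 y0 scaler0 addr0.
move=> p pm; apply: contrapT => nex.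
have sub (r : R^o) : pr (size s) r = 0 -> r \in p.
  by move=> r0; case: (boolP (r \in p)) => // rp; case: nex; exists r.
have [c [cc cs]] := tower_chain tw (leqnn _) sub.
(* The type of [m] does not record that it is prime. [M] is a prime containing it, hence with the
   same elements, that can serve as the top of a chain. *)
have [||||M [mM M1]] := @prime_avoiding _ R_noeth (fun x => x \in m) (fun x => x = 1).
- exact: idealr_ideal.
- by [].
- by move=> _ _ -> ->; rewrite mulr1.
- by move=> x xm x1; move: xm; rewrite x1 idealr1.
have pM x : x \in p -> x \in m.
  apply: (proper_sub_max R_noeth R_local (idealr_ideal p)).
  by rewrite idealr1.
have Mm x : x \in M -> x \in m.
  apply: (proper_sub_max R_noeth R_local (idealr_ideal M)).
  by rewrite idealr1.
have: (size s < size s)%N; last by rewrite ltnn.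
apply: (dimb _ (fun i => if (i <= size s)%N then c i else M)) => i ij.
have /orP[/eqP ->|{}ij] : (i == size s) || (i < size s)%N by rewrite -leq_eqVlt.
  rewrite /= leqnn ltnn cs; split=> [x /pM/mM //|Mp].
  by apply: pm => x; apply/idP/idP => [/pM //|/mM/Mp].
by rewrite /= (ltnW ij) ij; apply: cc.
Qed.

(** The element y spans a copy of R/m inside R/(s_0, ..., s_(d-1)). This embedding later transfers
    vanishing of Ext from the quotient, which has a finite free resolution by the regular sequence,
    to R/m. *)
Lemma cm_ring_tower d : cohen_macaulay_ring m -> krull_dim R d ->
  exists (s : seq R) (T : nat -> lmodType R) (pr : forall j, Hom R^o (T j)) q,
  [/\ size s = d, {subset s <= m}, regular_tower s pr q &
    exists y : T d, y <> 0 /\ forall a, a \in m -> a *: y = 0].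
Proof.
move=> [d' dim' [[s [sm sreg] ss] _]] dim.
have [T [pr [q tw]]] := regular_towerP sreg.
have sd : size s = d by rewrite ss; apply: krull_dim_unique dim' dim.
exists s, T, pr, q; split=> //; rewrite -sd; rewrite -sd in dim.
have prE r : pr (size s) (r : R^o) = r *: pr (size s) (1 : R^o).
  by rewrite -homZ; congr (pr _ _); rewrite /GRing.scale /= mulr1.
have x0 : pr (size s) (1 : R^o) <> 0.
  move=> x0; have [y] := tower_neq0 tw; apply.
  by have [r ->] := tower_surj tw y; rewrite prE x0 scaler0.
apply: (socle R_noeth x0) => a am.
have [n an] := regular_primary dim tw am.
by exists n; rewrite /annih -prE.
Qed.

End Dimension.

(** * Ext into a module of finite injective dimension *)

(* An injective resolution of omega, shifted by two so that [J 0 = J 1 = 0] and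
   omega embeds in [J 2]: this makes all degrees >= -2 uniform. *)
Record injective_complex (R : comNzRingType) (omega : lmodType R)
    (J : nat -> lmodType R) (D : forall i, Hom (J i) (J i.+1))
    (e : Hom omega (J 2)) : Prop := {
  ic_inj : forall i, injective_module (J i);
  ic_zero0 : forall x : J 0, x = 0;
  ic_zero1 : forall x : J 1, x = 0;
  ic_dd : forall i x, D i.+1 (D i x) = 0;
  ic_exact : forall i (x : J i.+3), D i.+3 x = 0 -> exists y, x = D i.+2 y;
  ic_aug_inj : injective e;
  ic_aug_exact : forall x, D 2 x = 0 <-> exists y, x = e y }.

Section InjectiveComplex.
Variables (R : comNzRingType) (omega : lmodType R).
Implicit Types A B C K Q U V W X Y M : lmodType R.
Variables (J : nat -> lmodType R) (D : forall i, Hom (J i) (J i.+1)).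
Variable e : Hom omega (J 2).
Hypothesis IC : injective_complex D e.

Definition cocycle X i (f : Hom X (J i)) : Prop := forall x, D i (f x) = 0.

Definition coboundary X i (f : Hom X (J i.+1)) : Prop :=
  exists g : Hom X (J i), forall x, f x = D i (g x).

(* Ext^(i-1)(X, omega) = 0; the index shift comes from the padding of [J]. *)
Definition ext_vanish i X : Prop :=
  forall f : Hom X (J i.+1), cocycle f -> coboundary f.

Lemma cocycle_submodule X i : submodule (@cocycle X i).
Proof.
split=> [x|a f g cf cg x]; first by rewrite /= hom0.
by rewrite -[(a *: f + g) x]/(a *: f x + g x) homP cf cg scaler0 addr0.
Qed.

Lemma coboundary_submodule X i : submodule (@coboundary X i).
Proof.
split=> [|a f g [u uE] [v vE]]; first by exists 0 => x; rewrite /= hom0.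
by exists (a *: u + v) => x; rewrite -[(a *: f + g) x]/(a *: f x + g x) uE vE -homP.
Qed.

Lemma ic_ext A B i (a : Hom A B) (f : Hom A (J i)) : injective a ->
  exists g : Hom B (J i), forall x, f x = g (a x).
Proof. by apply: injective_ext_inj; apply: (ic_inj IC). Qed.

Lemma ic_ext_ker A B i (a : Hom A B) (f : Hom A (J i)) :
  (forall x, a x = 0 -> f x = 0) -> exists g : Hom B (J i), forall x, f x = g (a x).
Proof. by apply: injective_ext; apply: (ic_inj IC). Qed.

Lemma ext_vanish0 X : ext_vanish 0 X.
Proof. by move=> f _; exists 0 => x; rewrite hom0; apply: (ic_zero1 IC). Qed.

(** This and the next two lemmas are the three exactness statements of the long exact Ext sequence,
    proved by extending maps along injections. Here f extends to B, its differential descends to a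
    cocycle on C, and a primitive of that cocycle corrects the extension to a cocycle on B. *)
Lemma ext_vanish_sub i A B C (a : Hom A B) (p : Hom B C) : short_exact a p ->
  ext_vanish i B -> ext_vanish i.+1 C -> ext_vanish i A.
Proof.
move=> [ia sp pE] vB vC f cf.
have [f' f'E] := ic_ext f ia.
have [|h hE] := @hom_factor _ _ _ _ p (D _ \o f' : Hom _ _) sp.
  by move=> x /pE[y ->] /=; rewrite -f'E cf.
have [|k kE] := vC h.
  by move=> y; have [x ->] := sp y; rewrite -hE /= (ic_dd IC).
have [|g gE] := vB (f' \- (k \o p) : Hom _ _).
  by move=> x /=; rewrite homB -[D _ (f' x)]/((D _ \o f') x) hE kE subrr.
exists (g \o a : Hom _ _) => x /=; rewrite -gE /= -f'E.
have -> : p (a x) = 0 by apply/pE; exists x.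
by rewrite hom0 subr0.
Qed.

Lemma ext_vanish_ext i A B C (a : Hom A B) (p : Hom B C) : short_exact a p ->
  ext_vanish i A -> ext_vanish i C -> ext_vanish i B.
Proof.
move=> [ia sp pE] vA vC f cf.
have [|g gE] := vA (f \o a : Hom _ _); first by move=> x; apply: cf.
have [g' g'E] := ic_ext g ia.
have [|h hE] := @hom_factor _ _ _ _ p (f \- (D _ \o g') : Hom _ _) sp.
  by move=> x /pE[y ->] /=; rewrite -g'E -[f (a y)]/((f \o a) y) gE subrr.
have [|k kE] := vC h.
  by move=> y; have [x ->] := sp y; rewrite -hE /= homB (ic_dd IC) cf subr0.
exists (g' \+ (k \o p) : Hom _ _) => x /=.
by rewrite homD -kE -hE /= addrC subrK.
Qed.

Lemma ext_vanish_quot i A B C (a : Hom A B) (p : Hom B C) : short_exact a p ->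
  ext_vanish i A -> ext_vanish i.+1 B -> ext_vanish i.+1 C.
Proof.
move=> [ia sp pE] vA vB f cf.
have [|g gE] := vB (f \o p : Hom _ _); first by move=> x; apply: cf.
have [|h hE] := vA (g \o a : Hom _ _).
  move=> x /=; rewrite -gE /=; have -> : p (a x) = 0 by apply/pE; exists x.
  exact: hom0.
have [h' h'E] := ic_ext h ia.
have [|k kE] := @hom_factor _ _ _ _ p (g \- (D _ \o h') : Hom _ _) sp.
  by move=> x /pE[y ->] /=; rewrite -h'E -[g (a y)]/((g \o a) y) hE subrr.
exists k => y; have [x ->] := sp y.
by rewrite -kE /= homB (ic_dd IC) subr0 -gE.
Qed.

Lemma ext_vanish_iso i X Y (p : Hom X Y) : injective p -> surj p ->
  ext_vanish i X -> ext_vanish i Y.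
Proof.
move=> ip sp vX f cf; have [|g gE] := vX (f \o p : Hom _ _); first by move=> x; apply: cf.
have [|h hE] := @hom_factor _ _ _ _ p g sp.
  by move=> x x0; have -> : x = 0 by [apply: ip; rewrite hom0]; rewrite hom0.
by exists h => y; have [x ->] := sp y; rewrite -hE -gE.
Qed.

Lemma ext_vanish_zero i X : (forall x : X, x = 0) -> ext_vanish i X.
Proof. by move=> X0 f _; exists 0 => x; rewrite (X0 x) !hom0. Qed.

Lemma ext_vanish_row i n : ext_vanish i.+2 ('rV[R]_n : lmodType R).
Proof. by move=> f cf; apply: row_hom_lift => u; apply: (ic_exact IC). Qed.

Lemma ext_vanish_ring i : ext_vanish i.+2 (R^o : lmodType R).
Proof.
move=> f cf; have [y yE] := ic_exact IC (cf 1).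
have ly : linear (fun r : R^o => (r : R) *: y).
  by move=> a r r'; rewrite scalerDl scalerA.
have [g gE] := hom_of_linear ly; exists g => r.
by rewrite gE homZ -yE -homZ; congr (f _); rewrite /GRing.scale /= mulr1.
Qed.

(** Finite generation of Ext^(i-1)(X, omega) with explicit representing cocycles, in the form that
    [nakayama] expects. *)
Definition ext_fin_gen i X : Prop :=
  exists s : seq (Hom X (J i.+1)), (forall f, gen s f -> cocycle f) /\
    forall f, cocycle f -> exists2 f', gen s f' & coboundary (f - f').

Hypothesis R_noeth : noetherian R.
Hypothesis omega_fg : fin_gen omega.

Lemma fin_gen_hom X Y : fin_gen X -> fin_gen Y -> fin_gen (Hom X Y).
Proof.
move=> /fin_gen_cover[n [p sp]] /fin_gen_cover[k [q sq]].
have inj : injective (hom_pre p Y).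
  move=> f g fg; apply: linear_ext => x; have [u ->] := sp x.
  by have := congr1 (fun h : Hom _ _ => h u) fg.
apply: (fin_gen_sub R_noeth inj).
pose Phi (u : 'rV[R]_(n * k)) : Hom 'rV[R]_n Y := q \o mulmxr (vec_mx u).
have lPhi : linear Phi.
  move=> a u v; apply: linear_ext => w.
  rewrite -[LHS]/(q (w *m vec_mx (a *: u + v))).
  rewrite -[RHS]/(a *: q (w *m vec_mx u) + q (w *m vec_mx v)) -homP.
  by rewrite scalemxAr -mulmxDr; congr (q (_ *m _)); apply: linearP.
have [h hE] := hom_of_linear lPhi.
apply: (@fin_gen_surj _ ('rV[R]_(n * k) : lmodType R) _ h); last exact: fin_gen_row.
move=> f; have [g gE] := row_hom_lift (fun u => sq (f u)).
have [A AE] := row_hom_mx g.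
exists (mxvec A); rewrite hE; apply: linear_ext => u.
by rewrite /= mxvecK gE AE.
Qed.

(** Degree 0 is Hom(X, omega). Above it, for 0 -> K -> R^n -> X -> 0 the connecting map from
    Ext^i(K, omega) onto Ext^(i+1)(X, omega) carries generators to generators; [ext] builds it on
    cocycles. *)
Lemma ext_fin_genP i X : fin_gen X -> ext_fin_gen i X.
Proof.
elim: i X => [|[|i] IH] X fgX.
- exists [::]; split=> [f -> x|f _]; first by rewrite /= hom0.
  by exists 0 => //; exists 0 => x; rewrite [RHS]hom0 [LHS](ic_zero1 IC).
- have /fin_gen_gen[s sP] := fin_gen_hom fgX omega_fg.
  have lin : linear (fun f : Hom X omega => (e \o f : Hom X (J 2))).
    by move=> a f g; apply: linear_ext => x; rewrite /= -homP.
  have [h hE] := hom_of_linear lin.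
  exists (map h s); split=> [_ /gen_map[f _ ->] x|f cf].
    by rewrite hE; apply/(ic_aug_exact IC); exists (f x).
  have [g gE] : exists g : Hom X omega, forall x, f x = e (g x).
    by apply: hom_lift_inj (ic_aug_inj IC) _ => x; apply/(ic_aug_exact IC).
  exists (h g); first by apply/gen_map; exists g.
  exists 0 => x; rewrite hom0 hE -[LHS]/(f x - e (g x)) gE subrr //.
have [n [p sp]] := fin_gen_cover fgX.
have [a [_ ia aE]] := ker_incl p.
have fgK : fin_gen (ker p) by apply: fin_gen_sub ia (fin_gen_row _ _).
have [s [sc sg]] := IH _ fgK.
have ext (g : Hom (ker p) (J i.+2)) : cocycle g -> exists (g' : Hom 'rV[R]_n (J i.+2))
    (f : Hom X (J i.+3)), [/\ forall x, g x = g' (a x), forall u, D _ (g' u) = f (p u) & cocycle f].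
  move=> cg; have [g' g'E] := ic_ext g ia.
  have [|f fE] := @hom_factor _ _ _ _ p (D _ \o g' : Hom _ _) sp.
    by move=> u /aE[k ->] /=; rewrite -g'E cg.
  exists g', f; split=> // x; have [u ->] := sp x.
  by rewrite -fE /= (ic_dd IC).
have [t [tc tg]] : exists t : seq (Hom X (J i.+3)), (forall f, gen t f -> cocycle f) /\
    forall g, gen s g -> exists f (g' : Hom 'rV[R]_n (J i.+2)),
      [/\ gen t f, forall x, g x = g' (a x) & forall u, D _ (g' u) = f (p u)].
  elim: (s) sc => [|g l IHl] sc'.
    exists [::]; split=> [f -> x|g ->]; first by rewrite /= hom0.
    by exists 0, 0; split=> // u; rewrite hom0.
  have [|t [tc tg]] := IHl; first by move=> f gf; apply/sc'/gen_cons.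
  have [g' [f [gE fE cf]]] := ext _ (sc' _ (gen_head g l)).
  exists (f :: t); split=> [f' [c /tc cf']|h [c /tg[f' [h' [gf' hE f'E]]]]].
    rewrite -(subrK (c *: f) f').
    exact: (submoduleD (@cocycle_submodule X _) cf' (submoduleZ c (@cocycle_submodule X _) cf)).
  exists (f' + c *: f), (h' + c *: g'); split.
  - by exists c; rewrite addrK.
  - move=> x; rewrite -[RHS]/(h' (a x) + c *: g' (a x)) -hE -gE.
    by rewrite -[(h - c *: g) x]/(h x - c *: g x) subrK.
  - by move=> u; rewrite -[RHS]/(f' (p u) + c *: f (p u)) -f'E -fE -homZ -homD.
exists t; split=> // f cf.
have [g gE] := @ext_vanish_row i n (f \o p : Hom _ _) (fun x => cf (p x)).
have [|k kg [h hE]] := sg (g \o a : Hom _ _).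
  move=> x /=; rewrite -gE /=; have -> : p (a x) = 0 by apply/aE; exists x.
  exact: hom0.
have [f' [g' [gf' kE f'E]]] := tg _ kg; exists f' => //.
have [h' h'E] := ic_ext h ia.
have [|l lE] := @hom_factor _ _ _ _ p (g \- g' \- (D _ \o h') : Hom _ _) sp.
  move=> u /aE[x ->] /=; rewrite -h'E -hE -kE.
  by rewrite -[((g \o a : Hom _ _) - k) x]/(g (a x) - k x) subrr.
exists l => x; have [u ->] := sp x; rewrite -lE /= !homB (ic_dd IC) subr0.
by rewrite -gE f'E.
Qed.

Variable m : idealr R.
Hypothesis R_local : local_ring m.

Lemma ext_vanish_nakayama i X a : fin_gen X -> a \in m ->
  (forall f : Hom X (J i.+1), cocycle f -> exists2 f', cocycle f' & coboundary (f - a *: f')) ->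
  ext_vanish i X.
Proof.
move=> fgX am af; have [s [sc sg]] := ext_fin_genP i fgX.
exact: (nakayama R_noeth R_local am (@cocycle_submodule X _) (@coboundary_submodule X _)
  sc sg af).
Qed.

Lemma short_exact_mul X Y (q : Hom X Y) a : (forall x : X, a *: x = 0 -> x = 0) ->
  surj q -> (forall x, q x = 0 <-> exists y, x = a *: y) ->
  exists b : Hom X X, (forall x, b x = a *: x) /\ short_exact b q.
Proof.
move=> reg sq qE; exists (a \*: idfun : Hom _ _); split=> //; split=> //.
by move=> x y /= e'; apply/eqP; rewrite -subr_eq0; apply/eqP/reg; rewrite scalerBr e' subrr.
Qed.

(* a acts surjectively on Ext^(i-1)(X, omega), which therefore vanishes by Nakayama. *)
Lemma ext_vanish_regular i X Y (q : Hom X Y) a : fin_gen X -> a \in m ->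
  (forall x : X, a *: x = 0 -> x = 0) -> surj q ->
  (forall x, q x = 0 <-> exists y, x = a *: y) ->
  ext_vanish i.+1 Y -> ext_vanish i X.
Proof.
move=> fgX am reg sq qE vY; have [b [bE [ib _ _]]] := short_exact_mul reg sq qE.
apply: (ext_vanish_nakayama fgX am) => f cf.
have [f' f'E] := ic_ext f ib.
have [|h hE] := @hom_factor _ _ _ _ q (D _ \o f' : Hom _ _) sq.
  by move=> x /qE[y ->] /=; rewrite -bE -f'E cf.
have [|k kE] := vY h.
  by move=> y; have [x ->] := sq y; rewrite -hE /= (ic_dd IC).
exists (f' \- (k \o q) : Hom _ _).
  by move=> x /=; rewrite homB -[D _ (f' x)]/((D _ \o f') x) hE kE subrr.
exists 0 => x; rewrite hom0 -[LHS]/(f x - a *: (f' x - k (q x))).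
have qa : q (a *: x) = 0 by apply/qE; exists x.
by rewrite scalerBr -!homZ qa hom0 subr0 -bE -f'E subrr.
Qed.

(* Descending induction on i, starting above the length n of the resolution. For the
   residue field, right exactness of Ext^i and an embedding of R/m into
   R/(s_0, ..., s_(d-1)), of projective dimension d, give the vanishing. *)
Lemma ext_vanish_fin_inj_dim d n : (forall i, (n < i)%N -> forall x : J i, x = 0) ->
  cohen_macaulay_ring m -> krull_dim R d ->
  forall i X, fin_gen X -> (d.+1 < i)%N -> ext_vanish i X.
Proof.
move=> Jn R_cm R_dim.
have [s [T [pr [q [sd sm tw [y [y0 my]]]]]]] := cm_ring_tower R_noeth R_local R_cm R_dim.
(* R/(s_0, ..., s_(j-1)) behaves as a module of projective dimension j. With the index shift of
   [ext_vanish], degrees above j are the indices above j + 1. *)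
have vT i j : (j <= d)%N -> (j.+1 < i)%N -> ext_vanish i (T j).
  elim: j i => [|j IH] [|[|i]] // jd ji.
    exact: ext_vanish_iso (tower_inj tw) (tower_surj tw (j := 0)) (@ext_vanish_ring i).
  have js : (j < size s)%N by rewrite sd.
  have [b [_ se]] := short_exact_mul (tower_reg tw js) (tower_next_surj tw (j := j)) (tower_ker tw js).
  by apply: ext_vanish_quot se _ _; apply: IH; rewrite ?(ltnW jd) // ltnW.
have fgT j : fin_gen (T j).
  apply: (fin_gen_surj (tower_surj tw (j := j))); apply/fin_gen_gen.
  by exists [:: 1 : R^o] => r; exists r; rewrite /GRing.scale /= mulr1 subrr.
suff: forall k i, (n <= i + k)%N -> forall X, fin_gen X -> (d.+1 < i)%N -> ext_vanish i X.
  by move=> h i X; apply: (h n i); rewrite leq_addl.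
elim=> [|k IH] i ni X fgX di.
  by move=> f cf; exists 0 => x; rewrite hom0; apply: Jn; rewrite ltnS -(addn0 i).
have vS Y : fin_gen Y -> ext_vanish i.+1 Y.
  by move=> fgY; apply: IH => //; [rewrite addSnnS|rewrite ltnW].
apply: (devissage R_noeth (m := m)) fgX => {X}.
- by move=> A B C a p se; apply: ext_vanish_ext se.
- move=> X x xg xm.
  have [x0|x0] := pselect (x = 0).
    by apply: ext_vanish_zero => z; have [r ->] := xg z; rewrite x0 scaler0.
  have rm r : r *: x = 0 -> r \in m.
    move=> rx; case: (boolP (r \in m)) => // /(max_unit R_noeth R_local)[u uE].
    by case: x0; rewrite -[x]scale1r -uE -scalerA rx scaler0.
  have [|g gE] := @cyclic_hom _ X (T d) x y xg; first by move=> r /rm/my.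
  have ig : injective g.
    move=> z w zw; apply/eqP; rewrite -subr_eq0; apply/eqP.
    have := xg (z - w) => -[r rE]; rewrite rE; apply: xm.
    case: (boolP (r \in m)) => // /(max_unit R_noeth R_local)[u uE].
    case: y0; rewrite -[y]scale1r -uE -scalerA -gE -homZ -rE homB zw subrr scaler0 //.
  have [p [sp pE]] := coker_proj g.
  apply: (@ext_vanish_sub i _ _ _ g p); first by split.
    exact: vT.
  by apply: vS; apply: fin_gen_surj sp (fgT d).
- move=> X a fgX am reg.
  have [p [sp pE]] := coker_proj (a \*: idfun : Hom X X).
  by apply: (ext_vanish_regular fgX am reg sp pE); apply: vS; apply: fin_gen_surj sp fgX.
Qed.

End InjectiveComplex.

(** * Ext by free and by injective resolutions *)

Section Resolutions.
Variable R : comNzRingType.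
Implicit Types A B C K Q U V W X Y M : lmodType R.

Lemma subquot_iso_eq V (Z B Z' B' : V -> Prop) :
  (forall x, Z x <-> Z' x) -> (forall x, B x <-> B' x) -> subquot_iso Z B Z' B'.
Proof.
move=> ZZ BB; exists (fun x y => x = y); split.
- by move=> a x y x' y' -> ->.
- by move=> x /ZZ Zx; exists x.
- by move=> x /ZZ Zx; exists x.
- by move=> x y _ _ <-; apply: BB.
Qed.

Section FreeResolution.
Variables (X V : lmodType R) (F : free_resolution X).

Definition resolution_cocycle i (f : Hom 'rV[R]_(fr_rank F i) V) : Prop :=
  forall u, f (fr_diff F i u) = 0.

Definition resolution_coboundary i : Hom 'rV[R]_(fr_rank F i) V -> Prop :=
  match i with
  | 0 => fun f => forall u, f u = 0
  | i.+1 => fun f => exists g : Hom 'rV[R]_(fr_rank F i) V, forall u, f u = g (fr_diff F i u)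
  end.

Lemma resolution_cocycle_submodule i : submodule (@resolution_cocycle i).
Proof.
split=> [u|a f g cf cg u] //.
by rewrite -[LHS]/(a *: f (fr_diff F i u) + g (fr_diff F i u)) cf cg scaler0 addr0.
Qed.

Lemma subquot_iso_Ext i :
  subquot_iso (@resolution_cocycle i) (@resolution_coboundary i)
    (fun _ : Ext F i V => True) (fun x => x = 0).
Proof.
have ZE j (f : Hom 'rV[R]_(fr_rank F j) V) :
    resolution_cocycle f <-> hom_pre (fr_diff F j) V f = 0.
  split=> [cf|e u]; first by apply: linear_ext => u; apply: cf.
  by have := congr1 (fun h : Hom _ _ => h u) e.
case: i => [|i].
  apply: subquot_iso_trans (subquot_iso_ker (hom_pre (fr_diff F 0) V)).
    by move=> a f g f0 g0; rewrite linearP f0 g0 scaler0 addr0.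
  apply: subquot_iso_eq; first exact: ZE.
  by move=> f; split=> [f0|-> //]; apply: linear_ext => u; rewrite f0.
apply: subquot_iso_trans (subquot_iso_homology (hom_pre (fr_diff F i) V) (hom_pre (fr_diff F i.+1) V)).
  by move=> a f g f0 g0; rewrite linearP f0 g0 scaler0 addr0.
apply: subquot_iso_eq; first exact: ZE.
move=> f; split=> -[g gE]; exists g; first exact: linear_ext.
by move=> u; rewrite gE.
Qed.

Lemma fr_aug_diff u : fr_aug F (fr_diff F 0 u) = 0.
Proof. by apply/fr_aug_exact; exists u. Qed.

Lemma fr_diff_diff i u : fr_diff F i (fr_diff F i.+1 u) = 0.
Proof. by apply/fr_exact; exists u. Qed.

(** Multiplication by a is zero on X, hence null-homotopic on F. Only one half [s] of the homotopy
    has to be linear; the other half matters only up to boundaries, so an element v for each u is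
    enough. *)
Lemma resolution_homotopy a : (forall x : X, a *: x = 0) -> forall i,
  exists s : Hom 'rV[R]_(fr_rank F i) 'rV[R]_(fr_rank F i.+1),
    forall u, exists v, a *: u = s (fr_diff F i u) + fr_diff F i.+1 v.
Proof.
move=> aX; elim=> [|i [s sP]].
  have [|s sE] := @row_hom_lift _ _ _ _ (fr_diff F 0) (a \*: idfun : Hom _ _).
    by move=> u /=; apply/fr_aug_exact; rewrite homZ aX.
  exists s => u; have /fr_exact[v vE] : fr_diff F 0 (a *: u - s (fr_diff F 0 u)) = 0.
    by rewrite homB -sE /= homZ subrr.
  by exists v; rewrite -vE addrC subrK.
have [|t tE] := @row_hom_lift _ _ _ _ (fr_diff F i.+1) ((a \*: idfun) \- (s \o fr_diff F i) : Hom _ _).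
  by move=> u /=; have [v vE] := sP u; exists v; rewrite vE addrC addKr.
exists t => u.
have /fr_exact[v vE] : fr_diff F i.+1 (a *: u - t (fr_diff F i.+1 u)) = 0.
  by rewrite homB -tE /= fr_diff_diff hom0 subr0 homZ subrr.
by exists v; rewrite -vE addrC subrK.
Qed.

End FreeResolution.

Variable m : idealr R.

(** Ext^i(X, T_j) = 0 as long as i + j stays below the length of the sequence. As s_j is regular on
    T_j with quotient T_(j+1), the vanishing of Ext^i(X, T_(j+1)) makes s_j injective on
    Ext^(i+1)(X, T_j), where it also acts as zero because it kills X. *)
Lemma resolution_vanish X (F : free_resolution X) V (s : seq R) (T : nat -> lmodType R)
    (pr : forall j, Hom V (T j)) q :
  (forall a (x : X), a \in m -> a *: x = 0) -> {subset s <= m} -> regular_tower s pr q ->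
  forall i j, (i + j < size s)%N ->
  forall f : Hom 'rV[R]_(fr_rank F i) (T j), resolution_cocycle f -> resolution_coboundary f.
Proof.
move=> mX sm tw; elim=> [|i IH] j ijs f cf.
  have js : (j < size s)%N by [].
  move=> u; apply: (tower_reg tw js).
  have /fr_aug_exact[v vE] : fr_aug F (s`_j *: u) = 0.
    by rewrite homZ mX // sm // mem_nth.
  by rewrite -homZ vE cf.
have js : (j < size s)%N by apply: leq_ltn_trans ijs; rewrite leq_addl.
have am : s`_j \in m by rewrite sm // mem_nth.
have [t tP] := resolution_homotopy F (fun x => mX _ x am) i.
have af u : s`_j *: f u = f (t (fr_diff F i u)).
  by have [v vE] := tP u; rewrite -homZ vE homD cf addr0.
have /IH : resolution_cocycle (q j \o (f \o t) : Hom _ (T j.+1)).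
  by move=> u /=; rewrite -af; apply/(tower_ker tw js); exists (f u).
rewrite addnS -addSn => /(_ ijs).
(* The homotopy t writes s_j f as the coboundary of f t. Once f t agrees modulo s_j with a cocycle
   g, the difference is s_j h, and cancelling s_j shows that f is the coboundary of h. The remaining
   cases differ only because a coboundary in degree 0 is zero. *)
have suff_lift : (exists g : Hom 'rV[R]_(fr_rank F i) (T j),
    (forall u, g (fr_diff F i u) = 0) /\ forall u, q j (f (t u)) = q j (g u)) ->
    resolution_coboundary f.
  move=> [g [g0 gE]].
  have [|h hE] := @row_hom_lift _ _ _ _ (s`_j \*: idfun : Hom (T j) (T j)) ((f \o t) \- g : Hom _ _).
    by move=> u /=; apply/(tower_ker tw js); rewrite homB gE subrr.
  exists h => u; apply/eqP; rewrite -subr_eq0; apply/eqP/(tower_reg tw js).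
  rewrite scalerBr af; have := hE (fr_diff F i u) => /= <-.
  by rewrite g0 subr0 subrr.
clear IH tP af; case: i f cf t ijs suff_lift => [|i] f cf t ijs suff_lift /=.
  move=> h; apply: suff_lift; exists 0; split=> [u|u]; first by [].
  by rewrite [q j (_ _)]h /= hom0.
move=> [g gE]; apply: suff_lift.
have [|g' g'E] := @row_hom_lift _ _ _ _ (q j) g.
  by move=> u; have [x ->] := tower_next_surj tw (g u); exists x.
exists (g' \o fr_diff F i : Hom _ _); split=> u /=; first by rewrite fr_diff_diff hom0.
by rewrite -g'E -gE.
Qed.

Definition shift_resolution X (F : free_resolution X) K
    (a : Hom 'rV[R]_(fr_rank F 1) K) (sa : surj a)
    (ea : forall u, a u = 0 <-> exists v, u = fr_diff F 1 v) : free_resolution K :=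
  @FreeResolution R K (fun i => fr_rank F i.+1) a (fun i => fr_diff F i.+1) sa ea
    (fun i => @fr_exact _ _ F i.+1).

Section Comparison.
Variables (omega : lmodType R) (J : nat -> lmodType R) (D : forall i, Hom (J i) (J i.+1)).
Variable e : Hom omega (J 2).
Hypothesis IC : injective_complex D e.

(** The connecting isomorphism from Ext^j(A, omega) to Ext^(j+1)(C, omega). Both vanishing
    hypotheses on B are needed for the zigzag: degree j + 1 to reach every class on C, degree j to
    detect coboundaries on A. *)
Lemma subquot_iso_shift A B C (i : Hom A B) (p : Hom B C) j :
  short_exact i p -> ext_vanish D j.+1 B -> ext_vanish D j.+2 B ->
  subquot_iso (@cocycle _ _ D A j.+2) (@coboundary _ _ D A j.+1)
    (@cocycle _ _ D C j.+3) (@coboundary _ _ D C j.+2).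
Proof.
move=> [ii sp pE] vB vB'.
have pi0 a : p (i a) = 0 by apply/pE; exists a.
have ext (f : Hom A (J j.+2)) : exists h : Hom B (J j.+2), forall x, f x = h (i x).
  exact: (ic_ext IC).
exists (fun (f : Hom A (J j.+2)) (f' : Hom C (J j.+3)) => exists h : Hom B (J j.+2),
  (forall x, f x = h (i x)) /\ forall x, f' (p x) = D _ (h x)); split.
- move=> a f g f' g' [h [hE h'E]] [k [kE k'E]]; exists (a *: h + k); split=> x.
    by rewrite -[LHS]/(a *: f x + g x) hE kE.
  by rewrite -[LHS]/(a *: f' (p x) + g' (p x)) h'E k'E -homP.
- move=> f cf; have [h hE] := ext f.
  have [|f' f'E] := @hom_factor _ _ _ _ p (D _ \o h : Hom _ _) sp.
    by move=> x /pE[y ->] /=; rewrite -hE cf.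
  exists f'; last by exists h; split=> // x; rewrite -f'E.
  by move=> y; have [x ->] := sp y; rewrite -f'E /= (ic_dd IC).
- move=> f' cf'; have [|h hE] := vB' (f' \o p : Hom _ _); first by move=> x; apply: cf'.
  exists (h \o i : Hom _ _); last by exists h.
  by move=> x /=; rewrite -hE /= pi0 hom0.
- move=> f f' cf cf' [h [hE h'E]]; split=> [[g gE]|[g gE]].
    have [g' g'E] : exists h : Hom B (J j.+1), forall x, g x = h (i x).
      exact: (ic_ext IC).
    have [|k kE] := @hom_factor _ _ _ _ p (h \- (D _ \o g') : Hom _ _) sp.
      by move=> x /pE[y ->] /=; rewrite -hE gE -g'E subrr.
    exists k => y; have [x ->] := sp y.
    by rewrite -kE h'E /= homB (ic_dd IC) subr0.
  have [|k kE] := vB (h \- (g \o p) : Hom _ _).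
    by move=> x /=; rewrite homB -gE -h'E subrr.
  exists (k \o i : Hom _ _) => x.
  by rewrite /= -kE /= pi0 hom0 subr0 hE.
Qed.

(** Balance of Ext. From degree 2 on, both sides shift to the first syzygy. Degrees 0 and 1 are done
    by hand: the shift out of degree 0 would require Hom(F_0, omega) to vanish. *)
Lemma subquot_iso_resolution i : forall X (F : free_resolution X),
  subquot_iso (@resolution_cocycle X omega F i) (@resolution_coboundary X omega F i)
    (@cocycle _ _ D X i.+2) (@coboundary _ _ D X i.+1).
Proof.
elim: i => [|[|i] IH] X F.
- exists (fun (f : Hom _ omega) (f' : Hom X (J 2)) => forall u, e (f u) = f' (fr_aug F u)); split.
  + move=> a f g f' g' fE gE u.
    by rewrite -[LHS]/(e (a *: f u + g u)) homP fE gE.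
  + move=> f cf; have [||f' f'E] := @hom_factor _ _ _ _ (fr_aug F) (e \o f : Hom _ _).
    * exact: fr_aug_surj.
    * by move=> u /fr_aug_exact[v ->] /=; rewrite cf hom0.
    exists f'; last by move=> u; rewrite -f'E.
    move=> x; have [u ->] := fr_aug_surj F x; rewrite -f'E.
    by apply/(ic_aug_exact IC); exists (f u).
  + move=> f' cf'; have [|f fE] := @hom_lift_inj _ _ _ _ e (f' \o fr_aug F : Hom _ _) (ic_aug_inj IC).
      by move=> u; apply/(ic_aug_exact IC); apply: cf'.
    exists f => u; last by rewrite -fE.
    by apply: (ic_aug_inj IC); rewrite -fE /= fr_aug_diff !hom0.
  + move=> f f' cf cf' fE; split=> [f0|[g gE] u].
      exists 0 => x; have [u ->] := fr_aug_surj F x.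
      by rewrite -fE f0 !hom0.
    apply: (ic_aug_inj IC); rewrite fE gE hom0.
    by rewrite [g _](ic_zero1 IC) hom0.
- exists (fun (f : Hom _ omega) (f' : Hom X (J 3)) => exists h : Hom _ (J 2),
     (forall u, e (f u) = h (fr_diff F 0 u)) /\
     forall u, f' (fr_aug F u) = D _ (h u)); split.
  + move=> a f g f' g' [h [hE h'E]] [k [kE k'E]]; exists (a *: h + k); split=> u.
      by rewrite -[LHS]/(e (a *: f u + g u)) homP hE kE.
    by rewrite -[LHS]/(a *: f' (fr_aug F u) + g' (fr_aug F u)) h'E k'E -homP.
  + move=> f cf.
    have [|h hE] := @ic_ext_ker _ _ _ _ _ IC _ _ _ (fr_diff F 0) (e \o f : Hom _ _).
      by move=> u /fr_exact[v ->] /=; rewrite cf hom0.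
    have [||f' f'E] := @hom_factor _ _ _ _ (fr_aug F) (D _ \o h : Hom _ _).
    * exact: fr_aug_surj.
    * move=> u /fr_aug_exact[v ->] /=; rewrite -hE.
      by apply/(ic_aug_exact IC); exists (f v).
    exists f'; last by exists h; split=> // u; rewrite -f'E.
    move=> x; have [u ->] := fr_aug_surj F x; rewrite -f'E.
    exact: (ic_dd IC).
  + move=> f' cf'.
    have [|h hE] := @ext_vanish_row _ _ _ _ _ IC 0 _ (f' \o fr_aug F : Hom _ _).
      by move=> u; apply: cf'.
    have [|f fE] := @hom_lift_inj _ _ _ _ e (h \o fr_diff F 0 : Hom _ _) (ic_aug_inj IC).
      by move=> u; apply/(ic_aug_exact IC); rewrite /= -hE /= fr_aug_diff hom0.
    exists f; last by exists h; split=> // u; rewrite -fE.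
    move=> u; apply: (ic_aug_inj IC).
    by rewrite -fE /= fr_diff_diff !hom0.
  + move=> f f' cf cf' [h [hE h'E]]; split=> [[g gE]|[g gE]].
      have [||k kE] := @hom_factor _ _ _ _ (fr_aug F) (h \- (e \o g) : Hom _ _).
      * exact: fr_aug_surj.
      * by move=> u /fr_aug_exact[v ->] /=; rewrite -hE gE subrr.
      exists k => x; have [u ->] := fr_aug_surj F x; rewrite -kE /= homB h'E.
      have -> : D 2 (e (g u)) = 0 by apply/(ic_aug_exact IC); exists (g u).
      by rewrite subr0.
    have [|k kE] := @hom_lift_inj _ _ _ _ e (h \- (g \o fr_aug F) : Hom _ _) (ic_aug_inj IC).
      by move=> u; apply/(ic_aug_exact IC); rewrite /= homB -h'E gE subrr.
    exists k => u; apply: (ic_aug_inj IC).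
    by rewrite -kE /= fr_aug_diff hom0 subr0.
have [a [_ ia aE]] := ker_incl (fr_aug F).
have [|b bE] := @hom_lift_inj _ _ _ _ a (fr_diff F 0) ia.
  by move=> u; apply/aE; apply: fr_aug_diff.
have sb : surj b.
  move=> k; have /fr_aug_exact[v vE] : fr_aug F (a k) = 0 by apply/aE; exists k.
  by exists v; apply: ia; rewrite -bE.
have eb u : b u = 0 <-> exists v, u = fr_diff F 1 v.
  rewrite -fr_exact; split=> [b0|d0]; first by rewrite bE b0 hom0.
  by apply: ia; rewrite -bE d0 hom0.
have se : short_exact a (fr_aug F) by split=> //; apply: fr_aug_surj.
apply: subquot_iso_trans (IH _ (shift_resolution sb eb)) (subquot_iso_shift se _ _).
- by case: (@cocycle_submodule _ _ D (ker (fr_aug F)) i.+3).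
- exact: (ext_vanish_row IC).
- exact: (ext_vanish_row IC).
Qed.

End Comparison.

End Resolutions.

Section Padding.
Variables (R : comNzRingType) (I : nat -> lmodType R) (delta : forall i, Hom (I i) (I i.+1)).

Definition pad (i : nat) : lmodType R :=
  match i with
  | 0 | 1 => 'rV[R]_0
  | i.+2 => I i
  end.

Definition pad_diff (i : nat) : Hom (pad i) (pad i.+1) :=
  match i with
  | 0 | 1 => \0
  | i.+2 => delta i
  end.

Lemma injective_pad (omega : lmodType R) (e : Hom omega (I 0)) : (forall i, injective_module (I i)) ->
  injective e -> (forall x, delta 0 x = 0 <-> exists y, x = e y) ->
  (forall i x, delta i.+1 x = 0 <-> exists y, x = delta i y) ->
  @injective_complex R omega pad pad_diff e.
Proof.
move=> Iinj ie e0 ei; split=> //=.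
- have i0 : injective_module ('rV[R]_0 : lmodType R).
    by move=> A B i f _; exists 0 => x; rewrite [RHS]thinmx0.
  by case=> [|[|i]] //=.
- by move=> x; apply: thinmx0.
- by move=> x; apply: thinmx0.
- case=> [|[|i]] x //=; first exact: hom0.
  by apply/ei; exists x.
- by move=> i x /ei.
Qed.

End Padding.

(** * Ext into the canonical module: the residue field and maximal Cohen-Macaulay modules *)

Section CanonicalModule.
Variable R : comNzRingType.
Implicit Types A B C K Q U V W X Y M L : lmodType R.
Hypothesis R_noeth : noetherian R.
Variable m : idealr R.
Hypothesis R_local : local_ring m.

Lemma residue_gen : exists k : residue m, (forall x, exists r, x = r *: k) /\
  forall r, r *: k = 0 <-> r \in m.
Proof.
exists (\pi_{ideal_quot m} 1).
have sE r : r *: (\pi_{ideal_quot m} 1 : residue m) = \pi_{ideal_quot m} r.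
  by rewrite -[LHS]/(\pi_{ideal_quot m} r * \pi_{ideal_quot m} 1) -rmorphM mulr1.
split=> [x|r]; first by exists (repr x); rewrite sE reprK.
rewrite sE; split=> [r0|rm].
  have := Quotient.idealrBE m r 0; rewrite subr0 => ->.
  by rewrite r0 raddf0.
apply/eqP; have := Quotient.idealrBE m r 0; rewrite subr0 rm raddf0 => /esym; exact.
Qed.

Lemma annih_max X (x : X) r : x <> 0 -> r *: x = 0 -> r \in m.
Proof.
move=> x0 rx; case: (boolP (r \in m)) => // /(max_unit R_noeth R_local)[u uE].
by case: x0; rewrite -[x]scale1r -uE -scalerA rx scaler0.
Qed.

Lemma simple_iso X (x : X) : x <> 0 -> (forall y, exists r, y = r *: x) ->
  (forall a, a \in m -> a *: x = 0) ->
  exists p : Hom (residue m) X, injective p /\ surj p.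
Proof.
move=> x0 xg xm; have [k [kg k0]] := residue_gen.
have [|p pE] := @cyclic_hom _ _ _ k x kg; first by move=> r /k0/xm.
exists p; split; last first.
  by move=> y; have [r ->] := xg y; exists (r *: k); rewrite homZ pE.
move=> y z yz; apply/eqP; rewrite -subr_eq0; apply/eqP.
have [r rE] := kg (y - z); rewrite rE; apply/k0/(annih_max x0).
by rewrite -pE -homZ -rE homB yz subrr.
Qed.

Variables (omega : lmodType R) (J : nat -> lmodType R) (D : forall i, Hom (J i) (J i.+1)).
Variable e : Hom omega (J 2).
Hypothesis IC : injective_complex D e.
Hypothesis omega_fg : fin_gen omega.

(** Along a maximal regular sequence on M, Ext^i(M/(s_0, ..., s_(j-1))M, omega) vanishes for i > j.
    At j = d this is the general bound; each regular element removed improves it by one, down to M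
    itself. *)
Lemma ext_vanish_mcm d M : krull_dim R d ->
  (forall i X, fin_gen X -> (d.+1 < i)%N -> ext_vanish D i X) ->
  maximal_cohen_macaulay m M -> forall i, (1 < i)%N -> ext_vanish D i M.
Proof.
move=> dim vd [fgM Mcm] i i1.
have [M0|] := pselect (forall x : M, x = 0); first exact: ext_vanish_zero.
move=> /existsNP[x x0]; have [|d' dim' [[s [sm sreg] ss] _]] := Mcm; first by exists x.
have sd : size s = d by rewrite ss; apply: krull_dim_unique dim' dim.
have [T [pr [q tw]]] := regular_towerP sreg.
have vT k : forall j, (j + k = d)%N -> forall i, (j.+1 < i)%N -> ext_vanish D i (T j).
  elim: k => [|k IH] j jk l jl.
    apply: vd; first by apply: (fin_gen_surj (tower_surj tw (j := j))) fgM.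
    by rewrite -jk addn0.
  have js : (j < size s)%N by rewrite sd -jk -addSnnS leq_addr.
  apply: (ext_vanish_regular IC R_noeth omega_fg R_local _ _ (tower_reg tw js)
    (tower_next_surj tw (j := j)) (tower_ker tw js)).
  - by apply: (fin_gen_surj (tower_surj tw (j := j))) fgM.
  - by rewrite sm // mem_nth.
  - by apply: IH; rewrite ?addSnnS.
have vT0 := vT d 0%N (add0n d) i i1.
have pi := tower_inj tw.
move=> f cf.
have [|h hE] := @hom_factor _ _ _ _ (pr 0%N) f (tower_surj tw (j := 0%N)).
  by move=> y y0; have -> : y = 0 by [apply: pi; rewrite hom0]; rewrite hom0.
have [|k kE] := vT0 h.
  by move=> y; have [z ->] := tower_surj tw y; rewrite -hE.
by exists (k \o pr 0%N : Hom _ _) => y; rewrite hE kE.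
Qed.

Lemma depth_unique M d d' : depth m M d -> depth m M d' -> d = d'.
Proof.
move=> [[s [sm sr] <-] sb] [[t [tm tr] <-] tb]; apply/eqP.
by rewrite eqn_leq sb // tb.
Qed.

(* y generates Ext^d(R/m, omega), seen inside J (d+2). *)
Definition top_class d (y : J d.+2) : Prop :=
  [/\ forall a, a \in m -> a *: y = 0, D _ y = 0,
     ~ (exists z, (forall a, a \in m -> a *: z = 0) /\ y = D _ z)
   & forall x, (forall a, a \in m -> a *: x = 0) -> D _ x = 0 ->
       exists r z, (forall a, a \in m -> a *: z = 0) /\ x = r *: y + D _ z].

Lemma residue_kill a (x : residue m) : a \in m -> a *: x = 0.
Proof.
move=> am; have [k [kg k0]] := residue_gen; have [r ->] := kg x.
by rewrite scalerA mulrC -scalerA (k0 a).2 // scaler0.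
Qed.

(** Below degree d the vanishing comes from a regular sequence of length d on omega. In degree d,
    type 1 gives Ext^d(R/m, omega) = R/m; a generator is moved to a cocycle f on R/m, and y is the
    value of f at the generator of R/m. *)
Lemma canonical_residue d : canonical_module m omega -> krull_dim R d ->
  (forall i, (i <= d)%N -> ext_vanish D i (residue m : lmodType R)) /\
  exists y : J d.+2, top_class y.
Proof.
move=> [[_ cm] [t dt [F isoF]] _] dim.
have [k [kg k0]] := residue_gen.
(* The depth t in the definition of the type is d, since omega is maximal Cohen-Macaulay; that omega
   is nonzero is read off from the nonzero quotient in a regular sequence. *)
have td : t = d.
  have [|d' dim' dd'] := cm.
    have [[s [_ [_ [x x0]]] _] _] := dt; apply: contrapT => nex.
    have [p [sp pE]] := quotmod_proj (seqmul_pred (M := omega) s).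
    have [v vE] := sp x; apply: x0; rewrite vE.
    have -> : v = 0 by apply: contrapT => v0; apply: nex; exists v.
    exact: hom0.
  by rewrite (depth_unique dt dd'); apply: krull_dim_unique dim' dim.
rewrite {}td in dt isoF; have [[s [sm sr] sd] _] := dt.
have [T [pr [q tw]]] := regular_towerP sr.
split.
  case=> [|i] id; first exact: (ext_vanish0 IC).
  have [r [rl rt rs rB]] := subquot_iso_resolution IC i F.
  move=> f cf; have [f0 cf0 r0] := rs _ cf; apply/(rB _ _ cf0 cf r0).
  have idd : (i + 0 < size s)%N by rewrite addn0 sd.
  have [g0 g0E] : exists g : Hom 'rV[R]_(fr_rank F i) (T 0%N), forall u, g u = pr 0%N (f0 u).
    by exists (pr 0%N \o f0 : Hom _ _).
  have cg0 : resolution_cocycle g0 by move=> u; rewrite g0E cf0 hom0.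
  have := resolution_vanish (fun a x => @residue_kill a x) sm tw idd cg0.
  have pinj := tower_inj tw.
  clear idd rl rt rs rB r0 cf cg0 r f.
  case: i id f0 cf0 g0 g0E => [|i] _ f0 cf0 g0 g0E /=.
    by move=> h u; apply: pinj; rewrite -g0E h hom0.
  move=> [g gE]; have [|h hE] := @hom_lift_inj _ _ _ _ (pr 0%N) g pinj.
    by move=> u; apply: (tower_surj tw).
  by exists h => u; apply: pinj; rewrite -g0E gE hE.
have iso1 := subquot_iso_sym (subquot_iso_of_isom isoF).
have iso2 := subquot_iso_sym (subquot_iso_Ext omega F d).
have iso3 := subquot_iso_resolution IC d F.
have iso23 := subquot_iso_trans (@resolution_cocycle_submodule _ _ omega F d).2 iso2 iso3.
have [r [rl rt rs rB]] := subquot_iso_trans (fun _ _ _ _ _ => Logic.I) iso1 iso23.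
pose g : {ffun 'I_1 -> residue m} := [ffun=> k].
have [f cf rgf] := rt g I.
have fz (h : Hom (residue m) (J d.+1)) a : a \in m -> a *: h k = 0.
  by move=> am; rewrite -homZ (k0 a).2 // hom0.
exists (f k); split.
- by move=> a am; rewrite -homZ (k0 a).2 // hom0.
- exact: cf.
- move=> [z [mz yz]]; have [|h hE] := @cyclic_hom _ _ _ k z kg; first by move=> a /k0/mz.
  have cbf : coboundary D f.
    by exists h => x; have [a ->] := kg x; rewrite !homZ hE yz.
  have /(congr1 (fun u : {ffun 'I_1 -> residue m} => u ord0)) := (rB _ _ I cf rgf).2 cbf.
  rewrite !ffunE => kz; have := idealr1 m; rewrite (k0 1).1 // kz scaler0 //.
- move=> x mx Dx; have [|h hE] := @cyclic_hom _ _ _ k x kg; first by move=> a /k0/mx.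
  have ch : cocycle D h.
    by move=> y; have [a ->] := kg y; rewrite !homZ hE Dx scaler0.
  have [g' _ rg'h] := rs _ ch.
  have [a aE] := kg (g' ord0).
  have g'E : g' = a *: g by apply/ffunP => i; rewrite !ffunE (ord1 i) aE.
  have rag : r (a *: g) (a *: f).
    have r00 : r 0 0 by have := rl (-1) _ _ _ _ rgf rgf; rewrite !scaleN1r !addNr.
    by have := rl a _ _ _ _ rgf r00; rewrite !addr0.
  (* Both h and a f correspond to the same element of R/m, so their difference corresponds to 0 and
     is a coboundary. *)
  have rd : r 0 (h - a *: f).
    have := rl (-1) _ _ _ _ rag rg'h; rewrite !scaleN1r g'E addNr addrC; exact.
  have cd : cocycle D (h - a *: f).
    exact: (submoduleB (@cocycle_submodule _ _ D (residue m) d.+2) ch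
      (submoduleZ a (@cocycle_submodule _ _ D (residue m) d.+2) cf)).
  have [b bE] := (rB _ _ I cd rd).1 erefl.
  exists a, (b k); split; first by move=> c; apply: fz.
  rewrite -bE -[(h - a *: f) k]/(h k - a *: f k) hE addrC subrK //.
Qed.

End CanonicalModule.

(** * Local duality for modules of finite length *)

Section FiniteLengthDuality.
Variable R : comNzRingType.
Implicit Types A B C K Q U V W X Y M L : lmodType R.
Hypothesis R_noeth : noetherian R.
Variable m : idealr R.
Hypothesis R_local : local_ring m.
Variables (omega : lmodType R) (J : nat -> lmodType R) (D : forall i, Hom (J i) (J i.+1)).
Variable e : Hom omega (J 2).
Hypothesis IC : injective_complex D e.

Definition killed_by (I : R -> Prop) X : Prop := forall a, I a -> forall x : X, a *: x = 0.

Lemma killed_by_sub I A B (i : Hom A B) : injective i -> killed_by I B -> killed_by I A.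
Proof. by move=> ii kB a Ia x; apply: ii; rewrite homZ kB // hom0. Qed.

Lemma killed_by_quot I B C (p : Hom B C) : surj p -> killed_by I B -> killed_by I C.
Proof. by move=> sp kB a Ia y; have [x ->] := sp y; rewrite -homZ kB // hom0. Qed.

Lemma primary_regular I X a : primary m I -> killed_by I X -> a \in m ->
  (forall x : X, a *: x = 0 -> x = 0) -> forall x : X, x = 0.
Proof.
move=> pI kX am reg x; have [n In] := pI _ am.
elim: n {In} (kX _ In x) => [|n IH]; first by rewrite expr0 scale1r.
by rewrite exprS -scalerA => /reg.
Qed.

(** Devissage down to R/m. The regular case is harmless: a power of the regular element lies in I
    and kills the module, which is therefore zero. *)
Lemma ext_vanish_primary i I : primary m I -> ext_vanish D i (residue m : lmodType R) ->
  forall L, fin_gen L -> killed_by I L -> ext_vanish D i L.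
Proof.
move=> pI vk; apply: (devissage R_noeth (m := m)).
- move=> A B C a p se vA vC kB; case: (se) => ia sp _.
  apply: (ext_vanish_ext IC se); first exact/vA/(killed_by_sub ia).
  exact/vC/(killed_by_quot sp).
- move=> X x xg xm _; have [x0|x0] := pselect (x = 0).
    by apply: ext_vanish_zero => z; have [r ->] := xg z; rewrite x0 scaler0.
  have [p [ip sp]] := simple_iso R_noeth R_local x0 xg xm.
  exact: ext_vanish_iso ip sp vk.
- move=> X a fgX am reg kX; apply: ext_vanish_zero.
  exact: primary_regular pI kX am reg.
Qed.

(** Injectivity of Ext^i(C, omega) -> Ext^i(B, omega) when Ext^(i-1)(A, omega) = 0. *)
Lemma coboundary_surj i A B C (a : Hom A B) (p : Hom B C) (f : Hom C (J i.+2)) :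
  short_exact a p -> ext_vanish D i A -> coboundary D (f \o p : Hom B (J i.+2)) ->
  coboundary D f.
Proof.
move=> [ia sp pE] vA [g gE].
have [|h hE] := vA (g \o a : Hom _ _).
  move=> x /=; rewrite -gE /=; have -> : p (a x) = 0 by apply/pE; exists x.
  exact: hom0.
have [h' h'E] := ic_ext IC h ia.
have [|k kE] := @hom_factor _ _ _ _ p (g \- (D _ \o h') : Hom _ _) sp.
  by move=> x /pE[y ->] /=; rewrite -h'E -[g (a y)]/((g \o a) y) hE subrr.
by exists k => y; have [x ->] := sp y; rewrite -kE /= homB (ic_dd IC) subr0 -gE.
Qed.

Variables (d : nat) (E : lmodType R) (y0 : J d.+2).
Hypothesis y0_top : top_class m D y0.
Hypothesis residue_vanish : forall i, (i <= d)%N -> ext_vanish D i (residue m : lmodType R).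
Hypothesis E_hull : injective_hull (residue m) E.

(** By definition [y0] has no primitive killed by m; this excludes primitives killed only by I. Such
    a primitive would make the class of [y0] vanish on R/I, but Ext^d(R/m, omega) injects into
    Ext^d(R/I, omega), since the kernel of R/I -> R/m has no Ext^(d-1). *)
Lemma top_class_primary I z : ideal I -> primary m I -> ~ I 1 ->
  (forall a, I a -> a *: z = 0) -> y0 <> D _ z.
Proof.
move=> Ii pI I1 Iz yz; have [ym Dy nb _] := y0_top.
have [Q [p [sp pE]]] := @quotient_type _ (R^o : lmodType R) I Ii.
have [k [kg k0]] := residue_gen m.
have pg q : exists r, q = r *: p 1.
  have [r ->] := sp q; exists (r : R).
  by rewrite -homZ; congr (p _); rewrite /GRing.scale /= mulr1.
have pI1 r : r *: p 1 = 0 -> I r.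
  rewrite -homZ => /pE; rewrite {1}/GRing.scale /= mulr1; exact.
have [|t tE] := @cyclic_hom _ _ _ (p 1) k pg.
  by move=> r /pI1 Ir; apply/k0; apply: (proper_sub_max R_noeth R_local Ii).
have [|g gE] := @cyclic_hom _ _ _ (p 1) z pg; first by move=> r /pI1/Iz.
have [|f fE] := @cyclic_hom _ _ _ k y0 kg; first by move=> r /k0/ym.
have st : surj t by move=> x; have [r ->] := kg x; exists (r *: p 1); rewrite homZ tE.
have [i [_ ii iE]] := ker_incl t.
have fgQ : fin_gen Q.
  by apply/fin_gen_gen; exists [:: p 1] => q; have [r ->] := pg q; exists r; rewrite subrr.
have kQ : killed_by I Q.
  move=> a Ia q; have [r ->] := pg q; rewrite scalerA mulrC -scalerA -(homZ p).
  have -> : p (a *: (1 : R^o)) = 0 by apply/pE; rewrite /GRing.scale /= mulr1.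
  exact: scaler0.
have vK : ext_vanish D d (ker t).
  apply: (ext_vanish_primary pI (residue_vanish (leqnn d))).
    exact: fin_gen_sub ii fgQ.
  exact: killed_by_sub ii kQ.
have se : short_exact i t by split.
have [|h hE] := @coboundary_surj _ _ _ _ i t f se vK.
  by exists g => q; have [r ->] := pg q; rewrite /= !homZ tE fE gE yz.
apply: nb; exists (h k); split; last by rewrite -hE fE.
by move=> a am; rewrite -homZ (k0 a).2 // hom0.
Qed.

(* The functional theta turns cocycles into maps to E; it is obtained by
   extending r y0 + D z |-> r eps0, where eps0 spans the socle of E. *)
Lemma socle_functional I : ideal I -> primary m I -> ~ I 1 ->
  exists (theta : Hom (J d.+2) E) (eps : E),
  [/\ theta y0 = eps, forall r, r *: eps = 0 <-> r \in m,
     forall x : E, (forall a, a \in m -> a *: x = 0) -> exists r, x = r *: eps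
   & forall z, (forall a, I a -> a *: z = 0) -> theta (D _ z) = 0].
Proof.
move=> Ii pI I1; have [ym Dy nb _] := y0_top.
have [Einj [iota ii ess]] := E_hull.
have [k [kg k0]] := residue_gen m.
have eps0 r : r *: iota k = 0 <-> r \in m.
  rewrite -homZ; split=> [|/k0 ->]; last exact: hom0.
  by rewrite -{1}(hom0 iota) => /ii/k0.
have sK : submodule (fun z : J d.+1 => forall a, I a -> a *: z = 0).
  split=> [a _|c x y Ix Iy a Ia]; first exact: scaler0.
  by rewrite scalerDr Iy // scalerA mulrC -scalerA Ix // scaler0 addr0.
have [K [i [inji iE]]] := submodule_type sK.
have la : linear (fun u : (R^o * K)%type => (u.1 : R) *: y0 + D _ (i u.2)).
  move=> a u v /=; rewrite homP homP scalerDl scalerDr -!addrA; congr (_ + _).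
    by rewrite scalerA.
  by rewrite addrCA.
have lb : linear (fun u : (R^o * K)%type => (u.1 : R) *: iota k).
  by move=> a u v /=; rewrite scalerDl scalerA.
have [al alE] := hom_of_linear la; have [be beE] := hom_of_linear lb.
(* The extension is well defined because r y0 + D z = 0 with r a unit would turn [y0] into a
   boundary D z' with z' killed by I. *)
have [|theta tE] := @injective_ext _ _ _ _ al be Einj.
  move=> [r z]; rewrite alE beE /= => rz; apply/eps0.
  case: (boolP (r \in m)) => // /(max_unit R_noeth R_local)[u uE].
  have [] := @top_class_primary I (- (u *: i z)) Ii pI I1.
    move=> a Ia; rewrite scalerN scalerA mulrC -scalerA.
    have /iE iz : exists z', i z = i z' by exists z.
    by rewrite iz // scaler0 oppr0.
  rewrite homN homZ; apply/eqP; rewrite -addr_eq0; apply/eqP.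
  by rewrite -[y0]scale1r -uE -scalerA -scalerDr rz scaler0.
exists theta, (iota k); split=> //.
- have := tE (1, 0); rewrite alE beE /= hom0 hom0 addr0 !scale1r => ->.
  by [].
- move=> x xm; have [->|x0] := pselect (x = 0); first by exists 0; rewrite scale0r.
  have [S SP] := submodule_closed (scalar_submodule x).
  have [|y] := ess S; first by exists x => //; apply/SP; exists 1; rewrite scale1r.
  have [r ->] := kg y; move=> /SP[s sE] i0; rewrite homZ in sE i0.
  case: (boolP (s \in m)) => [sm|/(max_unit R_noeth R_local)[u uE]].
    by case: i0; rewrite sE xm.
  by exists (u * r); rewrite -scalerA sE scalerA uE scale1r.
- move=> z /iE[z' ->]; have := tE (0, z').
  by rewrite alE beE /= !scale0r add0r => <-.
Qed.

Hypothesis omega_top : forall X, fin_gen X -> ext_vanish D d.+2 X.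

(** The duality map sends a cocycle f to theta composed with f. On R/m it matches the generator [y0]
    with [eps]. Through an extension, surjectivity passes because Ext^(d+1) vanishes, so cocycles
    lift from A to B; injectivity passes because theta kills coboundaries of maps on modules killed
    by I. *)
Lemma local_duality I : ideal I -> primary m I ->
  exists theta : Hom (J d.+2) E,
  forall L, fin_gen L -> killed_by I L ->
  [/\ forall h : Hom L E, exists2 f : Hom L (J d.+2), cocycle D f & forall x, h x = theta (f x),
      forall f : Hom L (J d.+2), cocycle D f -> (forall x, theta (f x) = 0) -> coboundary D f
    & forall (g : Hom L (J d.+1)) x, theta (D _ (g x)) = 0].
Proof.
move=> Ii pI; have [I1|I1] := pselect (I 1).
  exists 0 => L _ kL; have L0 (x : L) : x = 0 by rewrite -[x]scale1r kL.
  split=> [h|f cf _|g x] //.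
    by exists 0 => [x|x]; rewrite (L0 x) ?hom0.
  by exists 0 => x; rewrite (L0 x) !hom0.
have [theta [eps [ty eps0 epsg tD]]] := socle_functional Ii pI I1.
have [ym Dy nb yg] := y0_top.
exists theta => L fgL kL.
have tDg X (g : Hom X (J d.+1)) x : killed_by I X -> theta (D _ (g x)) = 0.
  by move=> kX; apply: tD => a Ia; rewrite -homZ kX // hom0.
suff: killed_by I L -> fin_gen L ->
    (forall h : Hom L E, exists2 f : Hom L (J d.+2), cocycle D f & forall x, h x = theta (f x)) /\
    (forall f : Hom L (J d.+2), cocycle D f -> (forall x, theta (f x) = 0) -> coboundary D f).
  by move=> /(_ kL fgL)[]; split=> // g x; apply: tDg.
move: {kL} L fgL; apply: (devissage R_noeth (m := m)).
- move=> A B C a p se dA dC kB fgB; case: (se) => ia sp pE.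
  have [eA uA] := dA (killed_by_sub ia kB) (fin_gen_sub R_noeth ia fgB).
  have fgC := fin_gen_surj sp fgB; have [eC uC] := dC (killed_by_quot sp kB) fgC.
  split=> [h|f cf f0].
    have [f cf fE] := eA (h \o a : Hom _ _).
    have [f' f'E] := ic_ext IC f ia.
    have [|g gE] := @hom_factor _ _ _ _ p (D _ \o f' : Hom _ _) sp.
      by move=> x /pE[y ->] /=; rewrite -f'E cf.
    have [|k kE] := omega_top fgC (f := g).
      by move=> y; have [x ->] := sp y; rewrite -gE /= (ic_dd IC).
    have [|h' h'E] := @hom_factor _ _ _ _ p (h \- (theta \o (f' \- (k \o p))) : Hom _ _) sp.
      move=> x px0; have /pE[y yE] := px0; rewrite /= px0 yE hom0 subr0 -f'E -fE /= subrr //.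
    have [l cl lE] := eC h'.
    exists ((f' \- (k \o p)) \+ (l \o p) : Hom _ _) => x /=.
      by rewrite homD homB cl addr0 -kE -gE /= subrr.
    by rewrite homD -lE -h'E /= addrC subrK.
  have [g gE] := uA (f \o a : Hom _ _) (fun x => cf (a x)) (fun x => f0 (a x)).
  have [g' g'E] := ic_ext IC g ia.
  have [|l lE] := @hom_factor _ _ _ _ p (f \- (D _ \o g') : Hom _ _) sp.
    by move=> x /pE[y ->] /=; rewrite -g'E -gE subrr.
  have [||k kE] := uC l.
  + by move=> y; have [x ->] := sp y; rewrite -lE /= homB cf (ic_dd IC) subr0.
  + move=> y; have [x ->] := sp y; rewrite -lE /= homB f0 sub0r.
    by rewrite (tDg _ _ _ kB) oppr0.
  exists (g' \+ (k \o p) : Hom _ _) => x /=.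
  by rewrite homD -kE -lE /= addrC subrK.
- move=> X x xg xm kX fgX; split=> [h|f cf f0].
    have [r rE] : exists r, h x = r *: eps.
      by apply: epsg => a am; rewrite -homZ xm // hom0.
    have [h0|h0] := pselect (h x = 0).
      exists (\0 : Hom _ _) => z /=; first exact: hom0.
      by have [s ->] := xg z; rewrite homZ h0 scaler0 hom0.
    have x0 : x <> 0 by move=> x0; apply: h0; rewrite x0 hom0.
    have [|f fE] := @cyclic_hom _ _ _ x (r *: y0) xg.
      move=> s /(annih_max R_noeth R_local x0) sm.
      by rewrite scalerA mulrC -scalerA ym // scaler0.
    exists f => z; have [s ->] := xg z; rewrite (homZ f) fE scalerA.
      by rewrite homZ Dy scaler0.
    by rewrite homZ rE (homZ theta) ty scalerA.
  have [x0|x0] := pselect (x = 0).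
    by exists 0 => z; have [r ->] := xg z; rewrite x0 scaler0 !hom0.
  have [||r [z [mz fxE]]] := yg (f x).
  + by move=> a am; rewrite -homZ xm // hom0.
  + exact: cf.
  have rm : r \in m.
    apply/eps0; have := f0 x; rewrite fxE homD (homZ theta) ty tD ?addr0 // => a Ia.
    by apply: mz; apply: (proper_sub_max R_noeth R_local Ii).
  have [|g gE] := @cyclic_hom _ _ _ x z xg.
    by move=> s /(annih_max R_noeth R_local x0)/mz.
  exists g => w; have [s ->] := xg w.
  by rewrite (homZ f) (homZ g) (homZ (D _)) gE fxE ym // add0r.
- move=> X a fgX am reg kX _; have X0 := primary_regular pI kX am reg.
  split=> [h|f cf _].
    by exists 0 => [x|x]; rewrite (X0 x) !hom0.
  by exists 0 => x; rewrite (X0 x) !hom0.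
Qed.

End FiniteLengthDuality.

(** * The double complex Hom(C, J) *)

Section DoubleComplex.
Variable R : comNzRingType.
Variables (omega : lmodType R) (J : nat -> lmodType R) (D : forall i, Hom (J i) (J i.+1)).
Variable e : Hom omega (J 2).
Hypothesis IC : injective_complex D e.
Variables (C : nat -> lmodType R) (b : forall j, Hom (C j.+1) (C j)).
Hypothesis bb : forall j x, b j (b j.+1 x) = 0.
Variable n : nat.
Hypothesis C_vanish : forall i j, ext_vanish D i.+2 (C j).
Hypothesis H_vanish : forall i j, (i <= n)%N -> ext_vanish D i (homology (b j.+1) (b j)).

(* total_cocycle modulo total_coboundary is Ext^i(C_(j+1)/B_(j+1), omega) modulo the
   image of Ext^i(C_j, omega). For i = 0 this is H^(j+1)(Hom(C, omega)). *)
Definition total_cocycle i j (f : Hom (C j.+1) (J i.+2)) : Prop :=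
  (forall y, f (b j.+1 y) = 0) /\ cocycle D f.

Definition total_coboundary i j (f : Hom (C j.+1) (J i.+2)) : Prop :=
  exists (g : Hom (C j.+1) (J i.+1)) (h : Hom (C j) (J i.+2)),
  [/\ forall y, g (b j.+1 y) = 0, cocycle D h
    & forall x, f x = D _ (g x) + h (b j x)].

Lemma total_cocycle_submodule i j : submodule (@total_cocycle i j).
Proof.
have [_ cl] := @cocycle_submodule _ _ D (C j.+1) i.+2.
split=> [|a f g [fb cf] [gb cg]].
  split=> [//|]; by case: (@cocycle_submodule _ _ D (C j.+1) i.+2).
split; last exact: cl.
by move=> y; rewrite -[LHS]/(a *: f (b j.+1 y) + g (b j.+1 y)) fb gb scaler0 addr0.
Qed.

(** Restricted to cycles, f is a cocycle on the homology module, hence a coboundary there. After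
    subtracting an extension of a primitive, f vanishes on all cycles and so extends along [b j]
    into an injective. *)
Lemma homology_vanish i j (f : Hom (C j.+1) (J i.+1)) : (i <= n)%N ->
  (forall y, f (b j.+1 y) = 0) -> (forall x, b j x = 0 -> D _ (f x) = 0) ->
  exists (g : Hom (C j.+1) (J i)) (h : Hom (C j) (J i.+1)),
    (forall y, g (b j.+1 y) = 0) /\ forall x, f x = D _ (g x) + h (b j x).
Proof.
move=> lin fb fz.
have [K [k [p [ik kE sp pE]]]] := homology_proj (b j.+1) (b j).
have [|f' f'E] := @hom_factor _ _ _ _ p (f \o k : Hom _ _) sp.
  by move=> x /pE[u uE] /=; rewrite uE fb.
have [|g gE] := H_vanish lin (f := f').
  move=> x; have [z ->] := sp x; rewrite -f'E; apply: fz; apply/kE; by exists z.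
have [g' g'E] := ic_ext IC (g \o p : Hom _ _) ik.
have [|h hE] := @ic_ext_ker _ _ _ _ _ IC _ _ _ (b j) (f \- (D _ \o g') : Hom _ _).
  move=> x /kE[z ->] /=; rewrite -g'E /= -gE -f'E /= subrr //.
exists g', h; split=> [y|x]; last by rewrite -hE /= addrC subrK.
have /kE[z zE] := bb y; rewrite zE -g'E /=.
have -> : p z = 0 by apply/pE; exists y.
exact: hom0.
Qed.

(** One step of the zigzag: f = D g + h b with g zero on boundaries, and f' = D h. Vanishing on the
    homology produces h from f, and vanishing on C_(j+1) produces it from f'. *)
Lemma total_shift i j : (i < n)%N ->
  subquot_iso (@total_cocycle i j.+1) (@total_coboundary i j.+1)
    (@total_cocycle i.+1 j) (@total_coboundary i.+1 j).
Proof.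
move=> lin.
exists (fun (f : Hom (C j.+2) (J i.+2)) (f' : Hom (C j.+1) (J i.+3)) =>
  exists (h : Hom (C j.+1) (J i.+2)) (g : Hom (C j.+2) (J i.+1)),
  [/\ forall y, g (b j.+2 y) = 0, forall x, f x = D _ (g x) + h (b j.+1 x)
    & forall x, f' x = D _ (h x)]); split.
- move=> a f f1 f' f1' [h [g [gb fE f'E]]] [h1 [g1 [g1b f1E f1'E]]].
  exists (a *: h + h1), (a *: g + g1); split=> x.
  + by rewrite -[LHS]/(a *: g (b j.+2 x) + g1 (b j.+2 x)) gb g1b scaler0 addr0.
  + rewrite -[LHS]/(a *: f x + f1 x) fE f1E.
    rewrite -[(a *: g + g1) x]/(a *: g x + g1 x) -[(a *: h + h1) _]/(a *: h (b j.+1 x) + h1 (b j.+1 x)).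
    by rewrite (homP (D _)) scalerDr addrACA.
  + by rewrite -[LHS]/(a *: f' x + f1' x) f'E f1'E -homP.
- move=> f [fb cf].
  have [g [h [gb fE]]] := homology_vanish lin fb (fun x _ => cf x).
  exists (D _ \o h : Hom _ _); last by exists h, g.
  split=> [y|x] /=; last exact: (ic_dd IC).
  have := cf y; rewrite fE homD (ic_dd IC) add0r; exact.
- move=> f' [f'b cf']; have [h hE] := C_vanish cf'.
  exists (h \o b j.+1 : Hom _ _).
    by split=> [y|x] /=; [rewrite bb hom0|rewrite -hE f'b].
  exists h, (\0 : Hom _ _); split=> // x /=.
  by rewrite hom0 add0r.
- move=> f f' [fb cf] [f'b cf'] [h [g [gb fE f'E]]]; split.
    move=> [g1 [h1 [g1b ch1 f1E]]].
    have gE x : D _ (g1 x - g x) = h (b j.+1 x) - h1 (b j.+1 x).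
      have := f1E x; rewrite fE => fxE; apply/eqP; rewrite homB subr_eq addrAC.
      by rewrite [h _ + _]addrC fxE addrK.
    (* Two decompositions of f have been compared. D (g1 - g) vanishes on cycles, so the vanishing
       one degree lower applies to g1 - g and yields the map l that corrects h - h1 to a primitive
       of f'. *)
    have [||k [l [kb g1E]]] := @homology_vanish i j.+1 (g1 \- g : Hom _ _) (ltnW lin).
    + by move=> y /=; rewrite g1b gb subrr.
    + by move=> x x0 /=; rewrite gE x0 (hom0 h) (hom0 h1) subrr.
    exists (h \- h1 \- (D _ \o l) : Hom _ _), (\0 : Hom _ _); split.
    + move=> x /=; rewrite -gE.
      have -> : g1 x - g x = D _ (k x) + l (b j.+1 x) by rewrite -g1E.
      by rewrite homD (ic_dd IC) add0r subrr.
    + by move=> x /=; rewrite hom0.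
    + by move=> x /=; rewrite addr0 !homB (ic_dd IC) ch1 !subr0.
  move=> [g' [h' [g'b ch' f'E']]]; have [h2 h2E] := C_vanish ch'.
  exists g, (h \- g' \- (h2 \o b j) : Hom _ _); split=> //.
    by move=> x /=; rewrite !homB -h2E -f'E f'E' -addrA -opprD subrr.
  by move=> x /=; rewrite fE bb (hom0 h2) g'b !subr0.
Qed.

Lemma total_shift_iter k j : (k <= n)%N ->
  subquot_iso (@total_cocycle 0 (j + k)) (@total_coboundary 0 (j + k))
    (@total_cocycle k j) (@total_coboundary k j).
Proof.
elim: k j => [|k IH] j kn; first by rewrite addn0; apply: subquot_iso_eq.
have := IH j.+1 (ltnW kn); rewrite addSnnS => h.
exact: subquot_iso_trans (total_cocycle_submodule k j.+1).2 h (total_shift j kn).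
Qed.

Variables (E : lmodType R) (theta : Hom (J n.+2) E).
Let H1 := homology (b 1) (b 0).
Hypothesis theta_surj : forall h : Hom H1 E,
  exists2 f : Hom H1 (J n.+2), cocycle D f & forall x, h x = theta (f x).
Hypothesis theta_inj : forall f : Hom H1 (J n.+2), cocycle D f ->
  (forall x, theta (f x) = 0) -> coboundary D f.
Hypothesis theta_coboundary : forall (g : Hom H1 (J n.+1)) x, theta (D _ (g x)) = 0.
Hypothesis R_noeth : noetherian R.
Hypothesis C0_fg : fin_gen (C 0).
Hypothesis top_vanish : forall X, fin_gen X -> ext_vanish D n.+2 X.

(** Restricting f to the cycles gives a cocycle on H_1, to which theta applies. The obstructions to
    going back lie in Ext^(n+1) of the image of [b 0] (extending a cocycle to C_1) and of its
    cokernel (making the part on C_0 a cocycle), and both vanish. *)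
Lemma total_duality :
  subquot_iso (@total_cocycle n 0) (@total_coboundary n 0)
    (fun _ : Hom H1 E => True) (fun h => h = 0).
Proof.
have [K [k [p [ik kE sp pE]]]] := homology_proj (b 1) (b 0).
have b0k z : b 0 (k z) = 0 by apply/kE; exists z.
exists (fun (f : Hom (C 1) (J n.+2)) (h : Hom H1 E) => forall z, theta (f (k z)) = h (p z)); split.
- move=> a f f1 h h1 fE f1E z.
  by rewrite -[LHS]/(theta (a *: f (k z) + f1 (k z))) (homP theta) fE f1E.
- move=> f [fb cf]; have [|h hE] := @hom_factor _ _ _ _ p (theta \o (f \o k) : Hom _ _) sp.
    by move=> z /pE[u uE] /=; rewrite uE fb hom0.
  by exists h.
- move=> h _; have [f0 cf0 f0E] := theta_surj h.
  have [f1 f1E] := ic_ext IC (f0 \o p : Hom _ _) ik.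
  have f1b y : f1 (b 1 y) = 0.
    have /kE[z zE] := bb y; rewrite zE -f1E /=.
    have -> : p z = 0 by apply/pE; exists y.
    exact: hom0.
  have sB : submodule (fun x => exists y, x = b 0 y).
    split=> [|a _ _ [y ->] [y' ->]]; first by exists 0; rewrite hom0.
    by exists (a *: y + y'); rewrite homP.
  have [B [i [ii iE]]] := submodule_type sB.
  have [|q qE] := @hom_lift_inj _ _ _ _ i (b 0) ii.
    by move=> u; apply/iE; exists u.
  have sq : surj q.
    move=> y; have /iE[u uE] : exists y', i y = i y' by exists y.
    by exists u; apply: ii; rewrite -qE.
  have [|c cE] := @hom_factor _ _ _ _ q (D _ \o f1 : Hom _ _) sq.
    move=> x q0; have /kE[z ->] : b 0 x = 0 by rewrite qE q0 hom0.
    by rewrite /= -f1E /= cf0.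
  have [|c' c'E] := top_vanish (fin_gen_sub R_noeth ii C0_fg) (f := c).
    by move=> y; have [x ->] := sq y; rewrite -cE /= (ic_dd IC).
  exists (f1 \- (c' \o q) : Hom _ _).
    split=> [y|x] /=; last by rewrite homB -c'E -cE /= subrr.
    have -> : q (b 1 y) = 0 by apply: ii; rewrite -qE bb hom0.
    by rewrite f1b hom0 subrr.
  move=> z /=; have -> : q (k z) = 0 by apply: ii; rewrite -qE b0k hom0.
  by rewrite hom0 subr0 -f1E f0E.
- move=> f h [fb cf] _ fh; split=> [[g [l [gb cl fE]]]|h0].
    have [|g' g'E] := @hom_factor _ _ _ _ p (g \o k : Hom _ _) sp.
      by move=> z /pE[u uE] /=; rewrite uE gb.
    apply: linear_ext => x; have [z ->] := sp x.
    by rewrite -fh fE b0k hom0 addr0 -[g (k z)]/((g \o k) z) g'E theta_coboundary.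
  have [|fL fLE] := @hom_factor _ _ _ _ p (f \o k : Hom _ _) sp.
    by move=> z /pE[u uE] /=; rewrite uE fb.
  have [||gL gLE] := theta_inj (f := fL).
  + by move=> x; have [z ->] := sp x; rewrite -fLE /= cf.
  + by move=> x; have [z ->] := sp x; rewrite -fLE /= fh h0.
  have [g gE] := ic_ext IC (gL \o p : Hom _ _) ik.
  have gb y : g (b 1 y) = 0.
    have /kE[z zE] := bb y; rewrite zE -gE /=.
    have -> : p z = 0 by apply/pE; exists y.
    exact: hom0.
  have [|l lE] := @ic_ext_ker _ _ _ _ _ IC _ _ _ (b 0) (f \- (D _ \o g) : Hom _ _).
    by move=> x /kE[z ->] /=; rewrite -gE /= -gLE -fLE /= subrr.
  have [q [sq qE]] := coker_proj (b 0).
  have [|c cE] := @hom_factor _ _ _ _ q (D _ \o l : Hom _ _) sq.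
    by move=> x /qE[u ->] /=; rewrite -lE /= homB cf (ic_dd IC) subr0.
  have [|c' c'E] := top_vanish (fin_gen_surj sq C0_fg) (f := c).
    by move=> y; have [x ->] := sq y; rewrite -cE /= (ic_dd IC).
  exists g, (l \- (c' \o q) : Hom _ _); split=> //.
    by move=> x /=; rewrite homB -c'E -cE /= subrr.
  move=> x /=; have -> : q (b 0 x) = 0 by apply/qE; exists x.
  by rewrite hom0 subr0 -lE /= addrC subrK.
Qed.

End DoubleComplex.

(** * Exchanging the arguments of Ext *)

(* Hom(R^g, N) plays the role of R^g (x) N. *)
Section Tensor.
Variables (R : comNzRingType) (N : lmodType R).
Implicit Types U V W : lmodType R.

(** The pure tensor of v and n, viewed as the map sending y to the product of n with the scalar y
    v^T. *)
Definition tens_fun g (v : 'rV[R]_g) (n : N) (y : 'rV[R]_g) : N := (y *m v^T) 0 0 *: n.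

Lemma tens_is_linear g (v : 'rV[R]_g) n : linear (tens_fun v n).
Proof. by move=> a x y; rewrite /tens_fun mulmxDl -scalemxAl !mxE scalerDl scalerA. Qed.

HB.instance Definition _ g (v : 'rV[R]_g) n :=
  GRing.isLinear.Build R 'rV[R]_g N *:%R (tens_fun v n) (tens_is_linear v n).

Definition tens g (v : 'rV[R]_g) (n : N) : Hom 'rV[R]_g N := tens_fun v n.

Lemma tens_r_hom g (v : 'rV[R]_g) : exists t : Hom N (Hom 'rV[R]_g N), forall n, t n = tens v n.
Proof.
have lt : linear (tens v).
  move=> a x y; apply: linear_ext => u.
  rewrite -[RHS]/(a *: tens v x u + tens v y u) /tens /= /tens_fun.
  by rewrite scalerDr !scalerA mulrC.
by have [t tE] := hom_of_linear lt; exists t.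
Qed.

Lemma tens_l_hom g n : exists t : Hom 'rV[R]_g (Hom 'rV[R]_g N), forall v, t v = tens v n.
Proof.
have lt : linear (fun v : 'rV[R]_g => tens v n).
  move=> a x y; apply: linear_ext => u.
  rewrite -[RHS]/(a *: tens x n u + tens y n u) /tens /= /tens_fun.
  by rewrite linearP /= mulmxDr -scalemxAr !mxE scalerDl scalerA.
by have [t tE] := hom_of_linear lt; exists t.
Qed.

Lemma tens_delta g (c : Hom 'rV[R]_g N) :
  c = \sum_a tens (delta_mx 0 a) (c (delta_mx 0 a)).
Proof.
apply: linear_ext => u; rewrite row_homE.
have -> : (\sum_a tens (delta_mx 0 a) (c (delta_mx 0 a)) : Hom _ _) u =
    \sum_a tens (delta_mx 0 a) (c (delta_mx 0 a)) u.
  by elim/big_rec2: _ => // i x y _ <-.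
apply: eq_bigr => a _; rewrite /tens /= /tens_fun; congr (_ *: _).
by rewrite trmx_delta -colE mxE.
Qed.

Lemma tens_hom_ext g W (f h : Hom (Hom 'rV[R]_g N) W) :
  (forall a n, f (tens (delta_mx 0 a) n) = h (tens (delta_mx 0 a) n)) -> f =1 h.
Proof.
by move=> fh c; rewrite (tens_delta c) !raddf_sum; apply: eq_bigr => a _; apply: fh.
Qed.

Lemma tens_hom g W (k : 'I_g -> Hom N W) :
  exists f : Hom (Hom 'rV[R]_g N) W, forall v n, f (tens v n) = \sum_a v 0 a *: k a n.
Proof.
have lf : linear (fun c : Hom 'rV[R]_g N => \sum_a k a (c (delta_mx 0 a))).
  move=> r c c'; rewrite scaler_sumr -big_split; apply: eq_bigr => a _.
  by rewrite /= -homP.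
have [f fE] := hom_of_linear lf; exists f => v n; rewrite fE; apply: eq_bigr => a _.
by rewrite -(homZ (k a)) /tens /= /tens_fun -rowE !mxE.
Qed.

Lemma tens_mul g h (A : 'M[R]_(g, h)) (v : 'rV[R]_g) n :
  hom_pre (mulmxr A^T : Hom 'rV[R]_h 'rV[R]_g) N (tens v n) = tens (v *m A) n.
Proof.
by apply: linear_ext => u; rewrite /hom_pre /tens /= /tens_fun trmx_mul mulmxA.
Qed.

Lemma pairing_hom g U W (k : 'I_g -> Hom U W) :
  exists beta : Hom U (Hom 'rV[R]_g W), forall w v, beta w v = \sum_a v 0 a *: k a w.
Proof.
pose h w := projT1 (cid (row_hom (fun a => k a w))).
have hE w v : h w v = \sum_a v 0 a *: k a w by rewrite /h; case: cid.
have lh : linear h.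
  move=> r x y; apply: linear_ext => v; rewrite -[RHS]/(r *: h x v + h y v) !hE.
  rewrite scaler_sumr -big_split; apply: eq_bigr => a _.
  by rewrite /= homP scalerDr !scalerA mulrC.
by have [beta betaE] := hom_of_linear lh; exists beta => w v; rewrite betaE hE.
Qed.

End Tensor.

Section DualComplex.
Variables (R : comNzRingType) (N : lmodType R) (g : nat -> nat).
Variable A : forall j, 'M[R]_(g j.+1, g j).

Definition dual_obj (j : nat) : lmodType R := Hom 'rV[R]_(g j) N.

(** The transpose compensates for the contravariance of Hom(-, N): on pure tensors the map is v |->
    v A_j, that is, A_j tensored with N. *)
Definition dual_diff (j : nat) : Hom (dual_obj j.+1) (dual_obj j) :=
  hom_pre (mulmxr (A j)^T : Hom 'rV[R]_(g j) 'rV[R]_(g j.+1)) N.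

Lemma dual_diff_tens j v n : dual_diff j (tens v n) = tens (v *m A j) n.
Proof. exact: tens_mul. Qed.

Hypothesis A_exact : forall j (u : 'rV[R]_(g j.+1)),
  u *m A j = 0 <-> exists v, u = v *m A j.+1.

Lemma mulAA j : A j.+1 *m A j = 0.
Proof.
by apply/row_matrixP => i; rewrite row0 row_mul; apply/A_exact; exists (delta_mx 0 i); rewrite rowE.
Qed.

Lemma dual_diff_diff j x : dual_diff j (dual_diff j.+1 x) = 0.
Proof.
by apply: linear_ext => u; rewrite /= -mulmxA -trmx_mul mulAA trmx0 mulmx0 hom0.
Qed.

Variables (omega : lmodType R) (J : nat -> lmodType R) (D : forall i, Hom (J i) (J i.+1)).
Variable e : Hom omega (J 2).
Hypothesis IC : injective_complex D e.

Lemma ext_vanish_dual i j : ext_vanish D i N -> ext_vanish D i (dual_obj j).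
Proof.
move=> vN f cf.
have kex a : exists h : Hom N (J i), forall n, f (tens (delta_mx 0 a) n) = D _ (h n).
  have [t tE] := tens_r_hom N (delta_mx 0 a : 'rV[R]_(g j)).
  have [|h hE] := vN (f \o t : Hom _ _); first by move=> n; apply: cf.
  by exists h => n; rewrite -hE /= tE.
have /choice[k kE] := kex.
have [h hE] := tens_hom k.
exists h; apply: (tens_hom_ext (h := (D i \o h : Hom _ _))) => a n.
rewrite kE /= hE (bigD1 a) //= big1 => [|l la].
  by rewrite mxE !eqxx scale1r addr0.
by rewrite mxE (negPf la) andbF scale0r.
Qed.

Lemma fin_gen_dual j : noetherian R -> fin_gen N -> fin_gen (dual_obj j).
Proof. by move=> Rn fgN; apply: fin_gen_hom => //; apply: fin_gen_row. Qed.

(** [K] is the cokernel of [a]. After extending f into the first injective, the obstruction to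
    landing in omega is a class in Ext^1(K, omega). *)
Lemma omega_ext (B C K : lmodType R) (a : Hom B C) (q : Hom C K) (f : Hom B omega) :
  surj q -> (forall x, q x = 0 <-> exists y, x = a y) -> (forall x, a x = 0 -> f x = 0) ->
  ext_vanish D 2 K -> exists h : Hom C omega, forall x, f x = h (a x).
Proof.
move=> sq qE af vK.
have [|h hE] := @ic_ext_ker _ _ _ _ _ IC _ _ _ a (e \o f : Hom _ _).
  by move=> x /af x0; rewrite /= x0 hom0.
have [|c cE] := @hom_factor _ _ _ _ q (D _ \o h : Hom _ _) sq.
  by move=> x /qE[y ->] /=; rewrite -hE; apply/(ic_aug_exact IC); exists (f y).
have [|k kE] := vK c.
  by move=> y; have [x ->] := sq y; rewrite -cE /= (ic_dd IC).
have [|l lE] := @hom_lift_inj _ _ _ _ e (h \- (k \o q) : Hom _ _) (ic_aug_inj IC).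
  by move=> x; apply/(ic_aug_exact IC); rewrite /= homB -kE -cE subrr.
exists l => x; apply: (ic_aug_inj IC); rewrite -lE /= -hE.
have -> : q (a x) = 0 by apply/qE; exists x.
by rewrite hom0 subr0.
Qed.

Variables (F : free_resolution N) (d : nat) (X : lmodType R) (p : Hom 'rV[R]_(g d) X).
Hypothesis p_surj : surj p.
Hypothesis p_ker : forall u, p u = 0 <-> exists v, u = v *m A d.
Hypothesis N_vanish : ext_vanish D 2 N.
Hypothesis X_vanish : ext_vanish D 2 X.

Let F0 := 'rV[R]_(fr_rank F 0).
Let F1 := 'rV[R]_(fr_rank F 1).
Let aug := fr_aug F.

Lemma aug_tens (W : lmodType R) (f h : Hom (dual_obj d.+1) W) :
  (forall v w, f (tens v (aug w)) = h (tens v (aug w))) -> f =1 h.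
Proof.
move=> fh; apply: tens_hom_ext => a n; have [w ->] := fr_aug_surj F n; exact: fh.
Qed.

(* The two classes are joined by a zigzag in the double complex Hom(F_i, Hom(G_j, omega));
   beta is its element of bidegree (0, d). *)
Definition ext_pairing (x : Hom F1 (Hom X omega)) (f : Hom (dual_obj d.+1) (J 2)) : Prop :=
  exists beta : Hom F0 (Hom 'rV[R]_(g d) omega),
    (forall u v, beta (fr_diff F 0 u) v = x u (p v)) /\
    (forall w v, e (beta w (v *m A d)) = f (tens v (aug w))).

Lemma aug_values k (W : lmodType R) (h : 'I_k -> Hom F0 W) :
  (forall a u, h a (fr_diff F 0 u) = 0) ->
  exists l : 'I_k -> Hom N W, forall a w, h a w = l a (aug w).
Proof.
move=> h0; have /choice[l lE] : forall a, exists l : Hom N W, forall w, h a w = l (aug w).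
  move=> a; apply: hom_factor; first exact: fr_aug_surj.
  by move=> w /fr_aug_exact[u ->].
by exists l.
Qed.

Lemma ext_pairing_total (x : Hom F1 (Hom X omega)) : resolution_cocycle x ->
  exists2 f, total_cocycle D dual_diff f & ext_pairing x f.
Proof.
move=> cx.
have [ev evE] : exists ev : 'I_(g d) -> Hom F1 omega, forall a u, ev a u = x u (p (delta_mx 0 a)).
  have le a : linear (fun u => x u (p (delta_mx 0 a))).
    by move=> r u v; rewrite homP.
  by have /choice[ev evE] := fun a => hom_of_linear (le a); exists ev => a u; apply: evE.
(* Ext^1(N, omega) = 0 extends each coordinate of x from F_1 to F_0, which gives [beta]. Evaluated
   on the image of A_d, [beta] is zero on the image of F_1 and therefore descends to N. *)
have bex a : exists b : Hom F0 omega, forall u, ev a u = b (fr_diff F 0 u).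
  apply: (omega_ext (q := aug)) => //.
  - exact: fr_aug_surj.
  - exact: fr_aug_exact.
  - by move=> u /fr_exact[v ->]; rewrite evE cx.
have /choice[b bE] := bex.
have [beta betaE] := pairing_hom b.
have beta1 u v : beta (fr_diff F 0 u) v = x u (p v).
  have := row_homE (x u \o p : Hom _ _) v => /= ->; rewrite betaE; apply: eq_bigr => a _.
  by rewrite -bE evE.
have [l lE] : exists l : 'I_(g d.+1) -> Hom N omega,
    forall a w, beta w (delta_mx 0 a *m A d) = l a (aug w).
  have le a : linear (fun w => beta w (delta_mx 0 a *m A d)).
    by move=> r u v; rewrite homP.
  have /choice[h hE] := fun a => hom_of_linear (le a).
  have [|l lE] := @aug_values _ _ h.
    move=> a u; rewrite hE beta1.
    have -> : p (delta_mx 0 a *m A d) = 0 by apply/p_ker; exists (delta_mx 0 a).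
    exact: hom0.
  by exists l => a w; rewrite -lE hE.
have [f fE] := tens_hom (fun a => (e \o l a : Hom _ _)).
have fbeta w v : e (beta w (v *m A d)) = f (tens v (aug w)).
  have := row_homE (e \o (beta w \o mulmxr (A d)) : Hom _ _) v => /= ->; rewrite fE.
  by apply: eq_bigr => a _ /=; rewrite lE.
exists f; last by exists beta.
split=> [y|y].
  apply: (tens_hom_ext (f := (f \o dual_diff d.+1 : Hom (dual_obj d.+2) _)) (h := \0)) => a n /=.
  have [w ->] := fr_aug_surj F n.
  by rewrite dual_diff_tens -fbeta -mulmxA mulAA mulmx0 !hom0.
apply: (aug_tens (f := (D 2 \o f : Hom _ _)) (h := \0)) => v w /=.
by rewrite -fbeta; apply/(ic_aug_exact IC); exists (beta w (v *m A d)).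
Qed.

Lemma tens_aug0 g' (v : 'rV[R]_g') u : tens v (aug (fr_diff F 0 u)) = 0.
Proof.
by rewrite fr_aug_diff; have [t <-] := tens_r_hom N v; rewrite hom0.
Qed.

Lemma ext_pairing_surj (f : Hom (dual_obj d.+1) (J 2)) : total_cocycle D dual_diff f ->
  exists2 x, @resolution_cocycle _ _ _ F 1 x & ext_pairing x f.
Proof.
move=> [fb cf].
have [|f' f'E] := @hom_lift_inj _ _ _ _ e f (ic_aug_inj IC).
  by move=> c; apply/(ic_aug_exact IC); apply: cf.
(* The mirror image: Ext^1(X, omega) = 0 extends f from G_(d+1) to G_d, one basis vector of F_0 at a
   time. *)
have bex c : exists b : Hom 'rV[R]_(g d) omega,
    forall v, f' (tens v (aug (delta_mx 0 c))) = b (v *m A d).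
  have [t tE] := tens_l_hom (g d.+1) (aug (delta_mx 0 c)).
  have [||||b bE] := @omega_ext _ _ _ (mulmxr (A d) : Hom _ _) p (f' \o t : Hom _ _) => //.
    move=> u /= /A_exact[v ->]; apply: (ic_aug_inj IC).
    by rewrite tE -f'E -tens_mul fb hom0.
  by exists b => v; rewrite -tE [LHS]bE.
have /choice[b bE] := bex.
have [beta betaE] := row_hom_delta b.
have beta1 w v : beta w (v *m A d) = f' (tens v (aug w)).
  have [t tE] := tens_r_hom N v.
  have le : linear (fun w => beta w (v *m A d)) by move=> r u u'; rewrite homP.
  have [h hE] := hom_of_linear le.
  rewrite -hE -tE; apply: (row_hom_ext (g := (f' \o (t \o aug) : Hom _ _))) => c /=.
  by rewrite hE betaE -bE tE.
have xex k : exists x : Hom X omega, forall v, beta (fr_diff F 0 (delta_mx 0 k)) v = x (p v).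
  apply: hom_factor p_surj _ => v /p_ker[v' ->].
  by rewrite beta1 tens_aug0 hom0.
have /choice[x' x'E] := xex.
have [x xE] := row_hom_delta x'.
have betax u v : beta (fr_diff F 0 u) v = x u (p v).
  have le1 : linear (fun u => beta (fr_diff F 0 u) v) by move=> r w w'; rewrite !homP.
  have le2 : linear (fun u => x u (p v)) by move=> r w w'; rewrite homP.
  have [h1 h1E] := hom_of_linear le1; have [h2 h2E] := hom_of_linear le2.
  by rewrite -h1E -h2E; apply: row_hom_ext => k; rewrite h1E h2E xE.
exists x; last by exists beta; split=> // w v; rewrite beta1 -f'E.
move=> u; apply: linear_ext => y; have [v ->] := p_surj y.
by rewrite -betax fr_diff_diff hom0.
Qed.

Lemma ext_pairing_boundary (x : Hom F1 (Hom X omega)) f : ext_pairing x f ->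
  @resolution_coboundary _ _ _ F 1 x <-> total_coboundary D dual_diff f.
Proof.
move=> [beta [beta1 beta2]]; split=> [[y yE]|[g0 [h [_ ch fE]]]].
  (* A primitive y of x and [beta] agree on the image of F_1, so their difference descends to N and
     gives the map h on C_d. *)
  have [l lE] : exists l : 'I_(g d) -> Hom N omega,
      forall a w, beta w (delta_mx 0 a) - y w (p (delta_mx 0 a)) = l a (aug w).
    have le a : linear (fun w => beta w (delta_mx 0 a) - y w (p (delta_mx 0 a))).
      move=> r u v; rewrite (homP beta) (homP y) -[(r *: beta u + beta v) _]/(r *: beta u _ + beta v _).
      rewrite -[(r *: y u + y v) _]/(r *: y u _ + y v _).
      by rewrite opprD addrACA scalerBr.
    have /choice[h hE] := fun a => hom_of_linear (le a).
    have [|l lE] := @aug_values _ _ h.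
      by move=> a u; rewrite hE beta1 yE subrr.
    by exists l => a w; rewrite -lE hE.
  have [h hE] := tens_hom (fun a => (e \o l a : Hom _ _)).
  have hbeta w v : h (tens v (aug w)) = e (beta w v - y w (p v)).
    have := row_homE (e \o (beta w \- (y w \o p)) : Hom _ _) v => /= ->; rewrite hE.
    by apply: eq_bigr => a _ /=; rewrite lE.
  exists (\0 : Hom _ _), h; split=> //.
    apply: (tens_hom_ext (f := (D 2 \o h : Hom _ _)) (h := \0)) => a n /=.
    have [w ->] := fr_aug_surj F n.
    by rewrite hbeta; apply/(ic_aug_exact IC); exists (beta w (delta_mx 0 a) - y w (p (delta_mx 0 a))).
  move=> c /=; rewrite hom0 add0r.
  apply: (aug_tens (h := (h \o dual_diff d : Hom _ _))) => v w /=.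
  rewrite dual_diff_tens hbeta -beta2.
  have -> : p (v *m A d) = 0 by apply/p_ker; exists v.
  by rewrite hom0 subr0.
have [|h' h'E] := @hom_lift_inj _ _ _ _ e h (ic_aug_inj IC).
  by move=> c; apply/(ic_aug_exact IC); apply: ch.
(* Ext degree 0 has no coboundaries: [g0] takes values in the padding module [J 1], which is
   zero. *)
have {}fE c : f c = h (dual_diff d c) by rewrite fE [g0 c](ic_zero1 IC) hom0 add0r.
have yex c : exists y : Hom X omega, forall v,
    beta (delta_mx 0 c) v - h' (tens v (aug (delta_mx 0 c))) = y (p v).
  have [t tE] := tens_l_hom (g d) (aug (delta_mx 0 c)).
  have [|y yE] := @hom_factor _ _ _ _ p (beta (delta_mx 0 c) \- (h' \o t) : Hom _ _) p_surj.
    move=> v /p_ker[v' ->] /=; apply/eqP; rewrite subr_eq0; apply/eqP.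
    apply: (ic_aug_inj IC); rewrite beta2 fE dual_diff_tens h'E tE //.
  by exists y => v; rewrite -yE /= tE.
have /choice[y' y'E] := yex.
have [y yE] := row_hom_delta y'.
have ybeta w v : y w (p v) = beta w v - h' (tens v (aug w)).
  have le1 : linear (fun w => y w (p v)) by move=> r u u'; rewrite homP.
  have [t tE] := tens_r_hom N v.
  have le2 : linear (fun w => beta w v - h' (t (aug w))).
    move=> r u u'; rewrite (homP beta) (homP aug) (homP t) (homP h').
    rewrite -[(r *: beta u + beta u') _]/(r *: beta u _ + beta u' _).
    by rewrite opprD addrACA scalerBr.
  have [h1 h1E] := hom_of_linear le1; have [h2 h2E] := hom_of_linear le2.
  rewrite -h1E -tE -h2E; apply: row_hom_ext => k.
  by rewrite h1E h2E yE -y'E tE.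
exists y => u; apply: linear_ext => z; have [v ->] := p_surj z.
by rewrite ybeta tens_aug0 hom0 subr0 beta1.
Qed.

Lemma subquot_iso_pairing :
  subquot_iso (@resolution_cocycle _ _ (Hom X omega) F 1)
    (@resolution_coboundary _ _ (Hom X omega) F 1)
    (@total_cocycle _ _ D _ dual_diff 0 d) (@total_coboundary _ _ D _ dual_diff 0 d).
Proof.
exists ext_pairing; split.
- move=> a x y f h [b [b1 b2]] [c [c1 c2]]; exists (a *: b + c); split=> [u v|w v].
    rewrite -[LHS]/(a *: b (fr_diff F 0 u) v + c (fr_diff F 0 u) v) b1 c1 //.
  rewrite -[RHS]/(a *: f (tens v (aug w)) + h (tens v (aug w))) -b2 -c2 -homP //.
- exact: ext_pairing_total.
- exact: ext_pairing_surj.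
- by move=> x f _ _ /ext_pairing_boundary.
Qed.

End DualComplex.

(** * Stable homomorphisms and Tor *)

Lemma big_fibers (I T : eqType) (V : nmodType) (u : seq I) (l : seq T) (f : T -> I) (F : T -> V) :
  uniq u -> {subset map f l <= u} ->
  \sum_(t <- l) F t = \sum_(i <- u) \sum_(t <- l | f t == i) F t.
Proof.
move=> uu; elim: l => [|t l IH] sub.
  by rewrite big_nil big1 // => i _; rewrite big_nil.
rewrite big_cons IH; last by move=> i il; apply: sub; rewrite inE il orbT.
under [RHS]eq_bigr => i _ do rewrite big_cons.
have tu : f t \in u by apply: sub; rewrite mem_head.
rewrite (bigD1_seq (f t)) //= [RHS](bigD1_seq (f t)) //= eqxx addrA; congr (_ + _).
by apply: eq_bigr => i; rewrite eq_sym => /negPf ->.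
Qed.

Section FreeModules.
Variable R : comNzRingType.
Implicit Types U V W M N Q : lmodType R.

Lemma hom_sum U V (f : Hom U V) (I : Type) (r : seq I) (P : pred I) (F : I -> U) :
  f (\sum_(i <- r | P i) F i) = \sum_(i <- r | P i) f (F i).
Proof. exact: raddf_sum. Qed.

(** Projectivity of free modules of any rank. An expansion in the basis is kept as a list of
    index-coefficient pairs, possibly with repetitions; independence ([lc0]) shows that the lifted
    value does not depend on the list. *)
Lemma free_module_lift Q U V (p : Hom U V) (h : Hom Q V) : free_module Q -> surj p ->
  exists k : Hom Q U, forall x, h x = p (k x).
Proof.
move=> [I [b [span free]]] sp.
have /choice[y yE] : forall i, exists u, h (b i) = p u by move=> i; apply: sp.
pose lc W (w : I -> W) (l : seq (I * R)) : W := \sum_(t <- l) t.2 *: w t.1.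
have lcE W (w : I -> W) l : lc W w l =
    \sum_(i <- undup (map fst l)) (\sum_(t <- l | t.1 == i) t.2) *: w i.
  rewrite /lc (big_fibers (f := fst) (u := undup (map fst l)) _ (undup_uniq _)).
    apply: eq_bigr => i _; rewrite scaler_suml; apply: eq_bigr => t /eqP ->//.
  by move=> i; rewrite mem_undup.
have lc0 l : lc Q b l = 0 -> lc U y l = 0.
  rewrite !lcE => l0; rewrite big_seq big1 // => i iu.
  by rewrite (free _ _ (undup_uniq _) l0 i iu) scale0r.
have lcl W (w : I -> W) a l l' :
    lc W w ([seq (t.1, a * t.2) | t <- l] ++ l') = a *: lc W w l + lc W w l'.
  rewrite /lc big_cat big_map /= scaler_sumr; congr (_ + _).
  by apply: eq_bigr => t _; rewrite scalerA.
have /choice[s sE] : forall x, exists l, x = lc Q b l.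
  move=> x; have [s [c ->]] := span x; exists [seq (i, c i) | i <- s].
  by rewrite /lc big_map.
have lk : linear (fun x => lc U y (s x)).
  move=> a x x'; apply/eqP; rewrite -subr_eq0; apply/eqP.
  pose l1 := [seq (t.1, a * t.2) | t <- s x] ++ s x'; pose l2 := s (a *: x + x').
  rewrite -[X in _ - X](lcl U y) -/l1 -/l2.
  have -> : lc U y l2 - lc U y l1 = lc U y ([seq (t.1, -1 * t.2) | t <- l1] ++ l2).
    by rewrite (lcl U y (-1)) scaleN1r addrC.
  by apply: lc0; rewrite (lcl Q b (-1)) [lc Q b l1](lcl Q b a) -!sE scaleN1r addNr.
have [k kE] := hom_of_linear lk; exists k => x; rewrite kE {1}[x]sE /lc (hom_sum h) (hom_sum p).
by apply: eq_bigr => t _; rewrite (homZ h) yE -homZ.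
Qed.

Lemma free_module_row n : free_module ('rV[R]_n : lmodType R).
Proof.
exists 'I_n, (fun i => delta_mx 0 i); split=> [x|s c us s0 i si].
  exists (index_enum 'I_n), (fun i => x 0 i); exact: row_sum_delta.
have := congr1 (fun u : 'rV[R]_n => u 0 i) s0; rewrite summxE mxE.
rewrite (bigD1_seq i) //= !mxE !eqxx mulr1 big1 ?addr0 // => j ji.
by rewrite !mxE eq_sym (negPf ji) mulr0.
Qed.

Lemma factors_throughP M N n (p : Hom 'rV[R]_n N) (f : Hom M N) : surj p ->
  f \in @factors_through_free _ M N -> exists k : Hom M 'rV[R]_n, forall x, f x = p (k x).
Proof.
move=> sp /asboolP[Q [g [h [fQ fE]]]].
have [k kE] := free_module_lift h fQ sp.
by exists (k \o g : Hom _ _) => x; rewrite fE /= kE.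
Qed.

Lemma factors_through_row M N n (g : Hom M 'rV[R]_n) (h : Hom 'rV[R]_n N) (f : Hom M N) :
  (forall x, f x = h (g x)) -> f \in @factors_through_free _ M N.
Proof.
by move=> fE; apply/asboolP; exists 'rV[R]_n, g, h; split; [apply: free_module_row|].
Qed.

Lemma mx_factor a b c (B : 'M[R]_(a, b)) (C : 'M[R]_(c, b)) :
  (forall u : 'rV_a, exists v, u *m B = v *m C) -> exists X, B = X *m C.
Proof.
move=> /choice[f fE]; exists (\matrix_i f (delta_mx 0 i)).
by apply/row_matrixP => i; rewrite row_mul rowK -fE -rowE.
Qed.

Lemma mx_eq0 a b (B : 'M[R]_(a, b)) : (forall u : 'rV_a, u *m B = 0) -> B = 0.
Proof. by move=> B0; apply/row_matrixP => i; rewrite row0 rowE. Qed.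

Lemma mx_lift k n V (p : Hom 'rV[R]_n V) (f : Hom 'rV[R]_k V) : surj p ->
  exists A : 'M[R]_(k, n), forall u, f u = p (u *m A).
Proof.
move=> sp; have [h hE] := row_hom_lift (fun u => sp (f u)).
by have [A AE] := row_hom_mx h; exists A => u; rewrite -AE.
Qed.

(** Multiplication by s is zero in the stable endomorphism ring of X. *)
Definition stably_kills (s : R) X : Prop :=
  exists n (g : Hom X 'rV[R]_n) (h : Hom 'rV[R]_n X), forall x, h (g x) = s *: x.

Section Comparison.
Variables (M N T : lmodType R) (p0 p1 : nat) (Dp : 'M[R]_(p1, p0)).
Variables (g : nat -> nat) (A : forall j, 'M[R]_(g j.+1, g j)).
Variables (eps : Hom 'rV[R]_p0 M) (q : Hom 'rV[R]_p1 T) (aug : Hom 'rV[R]_(g 0) T).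
Hypothesis A_exact : forall j (u : 'rV[R]_(g j.+1)),
  u *m A j = 0 <-> exists v, u = v *m A j.+1.
Hypotheses (eps_surj : surj eps) (q_surj : surj q) (aug_surj : surj aug).
Hypothesis eps_ker : forall u, eps u = 0 <-> exists v, u = v *m Dp.
Hypothesis q_ker : forall u, q u = 0 <-> exists v, u = v *m Dp^T.
Hypothesis aug_ker : forall u, aug u = 0 <-> exists v, u = v *m A 0.

Let b j := @dual_diff _ N g A j.

Lemma transpose_exact j n (B : 'M[R]_(g j.+1, n)) : (A j)^T *m B = 0 ->
  exists L, B = (A j.+1)^T *m L.
Proof.
move=> AB; have [|L LE] := @mx_factor _ _ _ B^T (A j.+1).
  by move=> u; apply/A_exact; rewrite -mulmxA -[A j]trmxK -trmx_mul AB trmx0 mulmx0.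
by exists L^T; rewrite -trmx_mul -LE trmxK.
Qed.

(** Push a cycle with values in N into R^n by u. There it is a boundary, because G tensored with R^n
    is exact in positive degrees; h brings the primitive back to N. *)
Lemma stably_kills_homology s : stably_kills s N -> forall j (x : homology (b j.+1) (b j)),
  s *: x = 0.
Proof.
move=> [n [u [h hu]]] j x; have [K [i [pp [ii iE sp pE]]]] := homology_proj (b j.+1) (b j).
have [k ->] := sp x; rewrite -homZ; apply/pE.
have ik0 : b j (i k) = 0 by apply/iE; exists k.
have [B BE] := row_hom_mx (u \o i k : Hom _ _).
have [|L LE] := @transpose_exact j _ B.
  apply: mx_eq0 => w; rewrite mulmxA -BE /=.
  by have := congr1 (fun f : Hom _ _ => u (f w)) ik0 => /= ->; rewrite hom0.
exists (h \o mulmxr L : Hom _ _); apply: linear_ext => y.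
rewrite homZ -[LHS]/(s *: i k y) -hu -[u _]/((u \o i k) y) BE LE.
by rewrite /b /= mulmxA.
Qed.

(** The hypothesis starts a contracting homotopy for s on G in positive degrees, s = A_j k + k'
    A_(j+1). It propagates upwards by exactness and survives tensoring with N. *)
Lemma stably_kills_homotopy s : (exists k, A 0 *m k *m A 0 = s *: A 0) ->
  forall j (x : homology (b j.+1) (b j)), s *: x = 0.
Proof.
move=> k0.
have nexts j k : A j *m k *m A j = s *: A j -> exists k', s%:M = A j *m k + k' *m A j.+1.
  move=> kE; have [|k' k'E] := @mx_factor _ _ _ (s%:M - A j *m k) (A j.+1).
    by move=> u; apply/A_exact; rewrite -mulmxA mulmxBl kE mul_scalar_mx subrr mulmx0.
  by exists k'; rewrite -k'E addrC subrK.
have kj j : exists k, A j *m k *m A j = s *: A j.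
  elim: j => [//|j [k /nexts[k' k'E]]]; exists k'.
  have -> : A j.+1 *m k' *m A j.+1 = A j.+1 *m (s%:M - A j *m k).
    by rewrite k'E addrC addKr mulmxA.
  by rewrite mulmxBr mulmxA (mulAA A_exact) mul0mx subr0 mul_mx_scalar.
move=> j x; have [K [i [pp [ii iE sp pE]]]] := homology_proj (b j.+1) (b j).
have [c ->] := sp x; rewrite -homZ; apply/pE.
have ic0 : b j (i c) = 0 by apply/iE; exists c.
have [k /nexts[k' k'E]] := kj j.
exists (i c \o mulmxr k'^T : Hom _ _); apply: linear_ext => y.
have e1 : s *: y = y *m k^T *m (A j)^T + y *m (A j.+1)^T *m k'^T.
  by rewrite -!mulmxA -mulmxDr -!trmx_mul -linearD /= -k'E tr_scalar_mx mul_mx_scalar.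
rewrite homZ -[LHS]/(s *: i c y) -homZ e1 homD.
have := congr1 (fun f : Hom _ _ => f (y *m k^T)) ic0 => /= ->.
by rewrite add0r.
Qed.

(** T has two free presentations, the transposed one of M and the start of G; they are equivalent up
    to homotopy. Row vectors are multiplied on the right, so [c *m a] is c followed by a. *)
Lemma comparison_mx : exists (a : 'M[R]_(p1, g 0)) (c : 'M[R]_(g 0, p1))
    (a1 : 'M[R]_(p0, g 1)) (c1 : 'M[R]_(g 1, p0)) k h,
  [/\ Dp^T *m a = a1 *m A 0, A 0 *m c = c1 *m Dp^T,
      c *m a = 1%:M + k *m A 0 & a *m c = 1%:M + h *m Dp^T].
Proof.
have [a aE] := mx_lift q aug_surj; have [c cE] := mx_lift aug q_surj.
have [|a1 a1E] := @mx_factor _ _ _ (Dp^T *m a) (A 0).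
  by move=> u; apply/aug_ker; rewrite mulmxA -aE; apply/q_ker; exists u.
have [|c1 c1E] := @mx_factor _ _ _ (A 0 *m c) Dp^T.
  by move=> u; apply/q_ker; rewrite mulmxA -cE; apply/aug_ker; exists u.
have [|k kE] := @mx_factor _ _ _ (c *m a - 1%:M) (A 0).
  by move=> u; apply/aug_ker; rewrite mulmxBr mulmx1 homB mulmxA -aE -cE subrr.
have [|h hE] := @mx_factor _ _ _ (a *m c - 1%:M) Dp^T.
  by move=> u; apply/q_ker; rewrite mulmxBr mulmx1 homB mulmxA -cE -aE subrr.
exists a, c, a1, c1, k, h; split=> //; first by rewrite -kE addrC subrK.
by rewrite -hE addrC subrK.
Qed.

(** The factorization of s on M lifts to P_0 as s - H Dp, a map killed by Dp on the left; so Dp H Dp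
    = s Dp. This identity is self-dual, and transposing it gives the claim for the presentation Dp^T
    of T; [comparison_mx] transports it to A_0. *)
Lemma stably_kills_dual s : stably_kills s M -> exists k, A 0 *m k *m A 0 = s *: A 0.
Proof.
move=> [n [u [r ru]]]; have [a [c [a1 [c1 [k [h [a1E c1E kE hE]]]]]]] := comparison_mx.
have [B BE] := mx_lift r eps_surj.
have [G GE] := row_hom_mx (mulmxr B \o (u \o eps) : Hom _ _).
have [|H HE] := @mx_factor _ _ _ (s%:M - G) Dp.
  move=> w; apply/eps_ker; rewrite mulmxBr mul_mx_scalar homB -GE /= -BE ru homZ.
  by rewrite subrr.
have DG : Dp *m G = 0.
  apply: mx_eq0 => w; rewrite mulmxA -GE /=.
  have -> : eps (w *m Dp) = 0 by apply/eps_ker; exists w.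
  by rewrite hom0 mul0mx.
have DHD : Dp^T *m H^T *m Dp^T = s *: Dp^T.
  by rewrite -mulmxA -!trmx_mul -mulmxA -HE mulmxBr DG subr0 mul_mx_scalar linearZ.
pose K := s *: k - c *m H^T *m a1.
have tE : c *m (s%:M - H^T *m Dp^T) *m a = s%:M + K *m A 0.
  rewrite mulmxBr mulmxBl mul_mx_scalar -scalemxAl kE scalerDr scalemx1 /K mulmxBl -scalemxAl.
  by rewrite -!mulmxA a1E !mulmxA addrA.
have : A 0 *m (c *m (s%:M - H^T *m Dp^T) *m a) = 0.
  rewrite !mulmxA c1E -[c1 *m _ *m _]mulmxA mulmxBr mulmxA DHD mul_mx_scalar subrr.
  by rewrite mulmx0 mul0mx.
rewrite tE mulmxDr mul_mx_scalar mulmxA => /eqP; rewrite addrC addr_eq0 => /eqP AKA.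
by exists (- K); rewrite mulmxN mulNmx AKA opprK.
Qed.

(** A map f is sent to the cycle obtained by composing it with [eps] and the comparison a1. If f
    lifts to R^n, the cycle lifts there too and is a boundary by exactness. Conversely, a boundary
    factors through the free module of rank g 2. *)
Lemma subquot_iso_stable n (pi : Hom 'rV[R]_n N) : surj pi ->
  subquot_iso (fun _ : Hom M N => True) (fun f => f \in @factors_through_free _ M N)
    (fun c : dual_obj N g 1 => b 0 c = 0) (fun c => exists u, c = b 1 u).
Proof.
move=> spi; have [a [c [a1 [c1 [k [h [a1E c1E kE hE]]]]]]] := comparison_mx.
have tr1 : (A 0)^T *m a1^T = a^T *m Dp by rewrite -trmx_mul -a1E trmx_mul trmxK.
have tr2 : Dp *m c1^T = c^T *m (A 0)^T by rewrite -[Dp]trmxK -trmx_mul -c1E trmx_mul.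
have [l lE] : exists l, c1 *m a1 = 1%:M + A 0 *m k + l *m A 1.
  have [|l lE] := @mx_factor _ _ _ (c1 *m a1 - 1%:M - A 0 *m k) (A 1).
    move=> u; apply/A_exact; rewrite -mulmxA !mulmxBl mul1mx -!mulmxA -a1E.
    have -> : c1 *m (Dp^T *m a) = A 0 + A 0 *m (k *m A 0).
      by rewrite mulmxA -c1E -mulmxA kE mulmxDr mulmx1.
    by rewrite [A 0 + _]addrC addrK subrr mulmx0.
  by exists l; rewrite -lE [RHS]addrC addrACA subrK addNr addr0.
(* The transposed presentation of T is not continued one step further, so a1 c1 is the identity only
   up to a homotopy term and a defect X. Since X Dp^T = 0, the transpose of X descends to a map from
   M to a free module, and the defect contributes only maps that factor through it. *)
have [X [XE X0]] : exists X, a1 *m c1 = 1%:M + Dp^T *m h + X /\ X *m Dp^T = 0.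
  exists (a1 *m c1 - (1%:M + Dp^T *m h)); split; first by rewrite addrC subrK.
  rewrite mulmxBl mulmxDl mul1mx -!mulmxA -c1E.
  have -> : a1 *m (A 0 *m c) = Dp^T + Dp^T *m (h *m Dp^T).
    by rewrite mulmxA -a1E -mulmxA hE mulmxDr mulmx1.
  by rewrite subrr.
have epsD v : eps (v *m Dp) = 0 by apply/eps_ker; exists v.
have b0P (z : dual_obj N g 1) : b 0 z = 0 -> forall v, z (v *m (A 0)^T) = 0.
  by move=> z0 v; have := congr1 (fun f : Hom _ _ => f v) z0.
have cyc (f : Hom M N) : b 0 (f \o (eps \o mulmxr a1^T) : Hom _ _) = 0.
  by apply: linear_ext => v; rewrite /= -mulmxA tr1 mulmxA epsD hom0.
exists (fun (f : Hom M N) (z : dual_obj N g 1) => exists u : dual_obj N g 2,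
  forall y, z y = f (eps (y *m a1^T)) + u (y *m (A 1)^T)); split.
- move=> r f f' z z' [u uE] [u' u'E]; exists (r *: u + u') => y.
  rewrite -[LHS]/(r *: z y + z' y) uE u'E.
  rewrite -[(r *: f + f') _]/(r *: f (eps (y *m a1^T)) + f' (eps (y *m a1^T))).
  rewrite -[(r *: u + u') _]/(r *: u (y *m (A 1)^T) + u' (y *m (A 1)^T)).
  by rewrite scalerDr addrACA.
- move=> f _; exists (f \o (eps \o mulmxr a1^T) : Hom _ _); first exact: cyc.
  by exists (\0 : Hom _ _) => y /=; rewrite addr0.
- move=> z z0.
  have [|f fE] := @hom_factor _ _ _ _ eps (z \o mulmxr c1^T : Hom _ _) eps_surj.
    by move=> x /eps_ker[v ->] /=; rewrite -mulmxA tr2 mulmxA b0P.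
  exists f => //; exists (\- (z \o mulmxr l^T) : Hom _ _) => y.
  have e1 : (c1 *m a1)^T = 1%:M + k^T *m (A 0)^T + (A 1)^T *m l^T.
    by rewrite lE !linearD /= trmx1 !trmx_mul.
  rewrite -fE /= -[y *m a1^T *m _]mulmxA -trmx_mul e1.
  rewrite !mulmxDr mulmx1 !mulmxA !(homD z) b0P // addr0.
  by rewrite addrK.
- move=> f z _ z0 [u uE]; split=> [ff|[u' u'E]].
    have [w wE] := factors_throughP spi ff.
    have [B BE] := row_hom_mx (w \o (eps \o mulmxr a1^T) : Hom _ _).
    have [|L LE] := @transpose_exact 0 _ B.
      apply: mx_eq0 => v; rewrite mulmxA -BE /= -mulmxA tr1 mulmxA epsD hom0 //.
    exists ((pi \o mulmxr L) \+ u : Hom _ _); apply: linear_ext => y.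
    rewrite uE wE -[w _]/((w \o (eps \o mulmxr a1^T)) y) BE LE mulmxA //.
  have fa1 y : f (eps (y *m a1^T)) = (u' - u) (y *m (A 1)^T).
    have := uE y; rewrite u'E => uy.
    rewrite -[RHS]/(u' (y *m (A 1)^T) - u (y *m (A 1)^T)).
    by rewrite [u' _]uy addrK.
  have [|al alE] := @hom_factor _ _ _ _ eps (mulmxr ((A 1)^T) \o mulmxr c1^T : Hom _ _) eps_surj.
    move=> x /eps_ker[v ->] /=; rewrite -[v *m Dp *m _]mulmxA tr2 -!mulmxA -trmx_mul.
    by rewrite (mulAA A_exact) trmx0 !mulmx0.
  have [|be beE] := @hom_factor _ _ _ _ eps (mulmxr X^T : Hom _ _) eps_surj.
    move=> x /eps_ker[v ->] /=; rewrite -mulmxA -[Dp]trmxK -trmx_mul X0 trmx0 mulmx0 //.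
  have fE x : f x = (u' - u) (al x) - f (eps (be x)).
    have [w ->] := eps_surj x.
    have -> : al (eps w) = w *m c1^T *m (A 1)^T by rewrite -alE.
    have -> : be (eps w) = w *m X^T by rewrite -beE.
    rewrite -fa1.
    have e1 : (a1 *m c1)^T = 1%:M + h^T *m Dp + X^T.
      by rewrite XE !linearD /= trmx1 trmx_mul trmxK.
    rewrite -[w *m c1^T *m _]mulmxA -trmx_mul e1.
    by rewrite !mulmxDr mulmx1 !mulmxA !(homD eps) !(homD f) epsD hom0 addr0 addrK.
  pose f1 : Hom M N := (u' - u : Hom _ _) \o al; pose f2 : Hom M N := (f \o eps) \o be.
  have -> : f = f1 - f2 by apply: linear_ext => x; rewrite fE.
  have ff1 : f1 \in @factors_through_free _ M N by apply: (factors_through_row (g := al)).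
  have ff2 : f2 \in @factors_through_free _ M N.
    by apply: (factors_through_row (g := be) (h := (f \o eps : Hom _ _))).
  have := (@factors_through_free_submod _ M N).2 (-1) _ _ ff2 ff1.
  by rewrite scaleN1r addrC.
Qed.

End Comparison.
End FreeModules.

(** * Localization *)

Section FreeLocalization.
Variables (R : comNzRingType) (p : prime_idealr R).
Implicit Types M X : lmodType R.

Lemma fracDs M (x y : M) (t : denom p) : frac x t + frac y t = frac (x + y) t.
Proof.
rewrite fracD; apply/fracP; exists (denom1 p) => /=.
by rewrite -scalerDr !scalerA !mulrA.
Qed.

Lemma frac0 M (t : denom p) : frac (0 : M) t = 0.
Proof. by apply/fracP; exists (denom1 p); rewrite !scaler0. Qed.

Lemma frac_sum M (I : Type) (r : seq I) (F : I -> M) (t : denom p) :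
  \sum_(i <- r) frac (F i) t = frac (\sum_(i <- r) F i) t.
Proof.
elim: r => [|i r IH]; first by rewrite !big_nil frac0.
by rewrite !big_cons IH fracDs.
Qed.

Lemma fracZ M (r : R) s (x : M) t :
  (frac (r : R^o) s : locring p) *: frac x t = frac (r *: x) (denomM s t).
Proof. exact: loc_scaleE. Qed.

Lemma frac_eqP M (x y : M) (t : denom p) : frac x t = frac y t -> exists u, u \notin p /\ u *: x = u *: y.
Proof.
move=> /fracP[u uE]; exists (val u * val t); split; last by rewrite -!scalerA.
by rewrite prime_idealrM negb_or (valP u) (valP t).
Qed.

Lemma common_denominator M (T : eqType) (s : seq T) (z : T -> localization p M) :
  exists t x, forall i, i \in s -> z i = frac (x i) t.
Proof.
elim: s => [|a s [t [x xE]]]; first by exists (denom1 p), (fun=> 0).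
exists (denomM (den (z a)) t).
exists (fun i => if i == a then val t *: num (z a) else val (den (z a)) *: x i) => i.
have cancel (y : M) (v w : denom p) : frac y v = frac (val w *: y) (denomM v w).
  by apply/fracP; exists (denom1 p); rewrite /= !scalerA !mulrA.
case: eqP => [-> _|ia]; first by rewrite -[LHS]frac_numden; apply: cancel.
rewrite inE => /orP[/eqP //|/xE ->]; rewrite (cancel _ _ (den (z a))).
apply/fracP; exists (denom1 p) => /=; congr (_ *: _).
by rewrite mulrC.
Qed.

Lemma common_multiple (T : eqType) (s : seq T) (Q : T -> R -> Prop) :
  (forall i u v, Q i u -> Q i (v * u)) -> (forall i, i \in s -> exists u, u \notin p /\ Q i u) ->
  exists u, u \notin p /\ forall i, i \in s -> Q i u.
Proof.
move=> Qm; elim: s => [|a s IH] h; first by exists 1; rewrite idealr1.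
have [|u [up uQ]] := IH; first by move=> i si; apply: h; rewrite inE si orbT.
have [v [vp vQ]] := h a (mem_head _ _).
exists (u * v); rewrite prime_idealrM negb_or up vp; split=> // i.
rewrite inE => /orP[/eqP ->|/uQ]; first exact: Qm.
by rewrite mulrC; apply: Qm.
Qed.

(* A basis of X_p involves finitely many fractions in the generators of X; after
   clearing denominators it yields a section of eps up to an element outside p. *)
Lemma free_localization_kills X n k (eps : Hom 'rV[R]_n X) (Dp : 'M[R]_(k, n)) :
  surj eps -> (forall u, eps u = 0 <-> exists v, u = v *m Dp) ->
  free_module (localization p X : lmodType (locring p)) ->
  exists s, s \notin p /\ stably_kills s X.
Proof.
move=> se eE [I [b [span free]]].
pose x i := eps (delta_mx 0 i).
pose K := locring p.
have /choice[sc scE] : forall i, exists q : seq I * (I -> K),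
    frac (x i) (denom1 p) = \sum_(j <- q.1) q.2 j *: b j.
  by move=> i; have [s [c e]] := span (frac (x i) (denom1 p)); exists (s, c).
pose S := undup (flatten [seq (sc i).1 | i <- enum 'I_n]).
have uS : uniq S by apply: undup_uniq.
have sS i j : j \in (sc i).1 -> j \in S.
  move=> ji; rewrite mem_undup; apply/flattenP; exists (sc i).1 => //.
  by apply/mapP; exists i; rewrite // mem_enum.
pose C i j : K := \sum_(l <- (sc i).1 | l == j) (sc i).2 l.
have CE i : frac (x i) (denom1 p) = \sum_(j <- S) C i j *: b j.
  rewrite scE (big_fibers (f := id) (u := S)) //; last by move=> j; rewrite map_id; apply: sS.
  by apply: eq_bigr => j _; rewrite scaler_suml; apply: eq_bigr => l /eqP ->.
pose IJ := [seq (i, j) | i <- enum 'I_n, j <- S].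
have IJE i j : j \in S -> (i, j) \in IJ.
  by move=> jS; apply: allpairs_f; rewrite // mem_enum.
have [t [r rE]] := common_denominator (M := R^o) IJ (fun q => C q.1 q.2).
have [t1 [z zE]] := common_denominator S b.
have /choice[y yE] : forall j, exists y, z j = eps y by move=> j; apply: se.
pose w i := \sum_(j <- S) (r (i, j) : R) *: y j.
(* [w i] lifts to R^n the expansion of the generator x_i in the basis, with denominators t for
   coefficients and t1 for basis elements. The equality in X_p becomes one in X after multiplying by
   some u outside p. *)
have gen i : exists u, u \notin p /\ u *: eps (w i) = u *: ((val t * val t1) *: x i).
  suff /frac_eqP : frac (eps (w i)) (denomM t t1) = frac ((val t * val t1) *: x i) (denomM t t1) by [].
  transitivity (frac (x i) (denom1 p)); last first.
    by apply/fracP; exists (denom1 p) => /=; rewrite !scale1r.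
  rewrite CE hom_sum -frac_sum big_seq [RHS]big_seq; apply: eq_bigr => j jS.
  by rewrite (rE _ (IJE i j jS)) (zE _ jS) fracZ yE homZ.
(* Each relation among the generators of X expands in the basis of X_p with zero coefficients; their
   numerators are therefore killed by some element outside p. *)
have rel l j : j \in S -> exists u, u \notin p /\ u * (\sum_i Dp l i * r (i, j)) = 0.
  move=> jS.
  have e0 : \sum_(j <- S) (\sum_i (frac (Dp l i : R^o) (denom1 p) : K) * C i j) *: b j = 0.
    under eq_bigr => j' _ do rewrite scaler_suml.
    rewrite exchange_big /=.
    transitivity (\sum_i (frac (Dp l i : R^o) (denom1 p) : K) *: frac (x i) (denom1 p)).
      apply: eq_bigr => i _; rewrite CE scaler_sumr; apply: eq_bigr => j' _.
      by rewrite scalerA.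
    transitivity (frac (\sum_i Dp l i *: x i) (denomM (denom1 p) (denom1 p))).
      by rewrite -frac_sum; apply: eq_bigr => i _; rewrite fracZ.
    have -> : \sum_i Dp l i *: x i = 0.
      transitivity (eps (row l Dp)).
        by rewrite [RHS]row_homE; apply: eq_bigr => i _; rewrite mxE.
      by apply/eE; exists (delta_mx 0 l); rewrite rowE.
    exact: frac0.
  have := free S _ uS e0 j jS.
  have -> : \sum_i (frac (Dp l i : R^o) (denom1 p) : K) * C i j =
      frac (\sum_i Dp l i * r (i, j) : R^o) (denomM (denom1 p) t).
    rewrite -frac_sum; apply: eq_bigr => i _.
    by rewrite (rE (i, j) (IJE i j jS)); apply: fracZ.
  rewrite -(frac0 _ (denomM (denom1 p) t)) => /frac_eqP[u [up uE]].
  by exists u; split=> //; move: uE; rewrite scaler0.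
have [u [up uE]] : exists u, u \notin p /\
    forall i, i \in enum 'I_n -> u *: eps (w i) = u *: ((val t * val t1) *: x i).
  apply: common_multiple => [i c v e|i _]; last exact: gen.
  by rewrite -[LHS]scalerA e !scalerA mulrA.
have [v [vp vE]] : exists v, v \notin p /\ forall q, q \in [seq (l, j) | l <- enum 'I_k, j <- S] ->
    v * (\sum_i Dp q.1 i * r (i, q.2)) = 0.
  apply: common_multiple => [i c c' e|[l j]]; first by rewrite -mulrA e mulr0.
  by move=> /allpairsP[[l' j'] /= [_ j'S [-> ->]]]; apply: rel.
(* The factor v makes f kill the relations, so that f descends to X. The factor u makes [eps]
   composed with f the multiplication by v u t t1. *)
have [f fE] := row_hom_delta (fun i => (v * u) *: w i).
have fD l : f (row l Dp) = 0.
  rewrite row_homE.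
  transitivity (\sum_(j <- S) (u * (v * (\sum_i Dp l i * r (i, j)))) *: y j).
    under [RHS]eq_bigr => j _ do rewrite !mulr_sumr scaler_suml.
    rewrite exchange_big /=; apply: eq_bigr => i _.
    rewrite fE mxE /w !scaler_sumr; apply: eq_bigr => j _.
    by rewrite !scalerA; congr (_ *: _); ring.
  rewrite big_seq big1 // => j jS.
  have -> : v * (\sum_i Dp l i * r (i, j)) = 0.
    by apply: (vE (l, j)); apply: allpairs_f; rewrite ?mem_enum.
  by rewrite mulr0 scale0r.
have [|g gE] := @hom_factor _ _ _ _ eps f se.
  move=> _ /eE[a ->].
  apply: (row_hom_ext (f := (f \o mulmxr Dp : Hom _ _)) (g := \0)) => l /=.
  by rewrite -rowE fD.
exists (v * u * (val t * val t1)); split.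
  by rewrite !prime_idealrM !negb_or vp up (valP t) (valP t1).
exists n, g, eps => x0; have [a ->] := se x0; rewrite -gE.
apply: (row_hom_ext (f := (eps \o f : Hom _ _))
  (g := ((v * u * (val t * val t1)) \*: eps : Hom _ _))) => i /=.
by rewrite fE homZ -[in LHS]scalerA uE ?mem_enum // !scalerA !mulrA.
Qed.

End FreeLocalization.

(** * Syzygies and the transpose *)

Section Syzygies.
Variable R : comNzRingType.

Lemma syzygy_short_exact (X : lmodType R) (G : free_resolution X) j :
  exists (i : Hom (syzygy G j.+1) 'rV[R]_(fr_rank G j)) (p : Hom 'rV[R]_(fr_rank G j) (syzygy G j)),
  short_exact i p /\ forall u, p u = 0 <-> exists v, u = fr_diff G j v.
Proof.
case: j => [|[|j]] /=.
- have [i [_ ii iE]] := ker_incl (fr_aug G); exists i, (fr_aug G); split.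
    by split=> //; apply: fr_aug_surj.
  exact: fr_aug_exact.
- have [i [_ ii iE]] := ker_incl (fr_diff G 0).
  have [k [_ ki kE]] := ker_incl (fr_aug G).
  have [|p pE] := @hom_lift_inj _ _ _ _ k (fr_diff G 0) ki.
    by move=> u; apply/kE; apply: fr_aug_diff.
  have p0 u : p u = 0 <-> fr_diff G 0 u = 0.
    by rewrite pE; split=> [->|]; [rewrite hom0|rewrite -{1}(hom0 k) => /ki].
  exists i, p; split; last by move=> u; rewrite p0; apply: fr_exact.
  split=> // [y|u]; last by rewrite p0; apply: iE.
  have /fr_aug_exact[v vE] : fr_aug G (k y) = 0 by apply/kE; exists y.
  by exists v; apply: ki; rewrite -pE.
have [i [_ ii iE]] := ker_incl (fr_diff G j.+1).
have [k [_ ki kE]] := ker_incl (fr_diff G j).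
have [|p pE] := @hom_lift_inj _ _ _ _ k (fr_diff G j.+1) ki.
  by move=> u; apply/kE; apply: fr_diff_diff.
have p0 u : p u = 0 <-> fr_diff G j.+1 u = 0.
  by rewrite pE; split=> [->|]; [rewrite hom0|rewrite -{1}(hom0 k) => /ki].
exists i, p; split; last by move=> u; rewrite p0; apply: fr_exact.
split=> // [y|u]; last by rewrite p0; apply: iE.
have /fr_exact[v vE] : fr_diff G j (k y) = 0 by apply/kE; exists y.
by exists v; apply: ki; rewrite -pE.
Qed.

(** Dimension shifting: the vanishing of Ext^(d+1)(X, omega) moves to Ext^(k+1) of the j-th syzygy
    with j + k = d, and ends at Ext^1 of the d-th. *)
Lemma syzygy_vanish (omega : lmodType R) (J : nat -> lmodType R)
    (D : forall i, Hom (J i) (J i.+1)) (e : Hom omega (J 2)) :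
  injective_complex D e -> forall X (G : free_resolution X) d,
  ext_vanish D d.+2 X -> ext_vanish D 2 (syzygy G d).
Proof.
move=> IC X G d vX.
suff: forall j k, (j + k = d)%N -> ext_vanish D k.+2 (syzygy G j) by apply; rewrite addn0.
elim=> [|j IH] k jk; first by move: jk; rewrite add0n => ->.
have [i [p [se _]]] := syzygy_short_exact G j.
apply: (ext_vanish_sub IC se); first exact: (ext_vanish_row IC).
by apply: IH; rewrite addnS -addSn.
Qed.

(** Rows are identified with functionals by v |-> [tens v 1]. Precomposition with Dp then becomes
    right multiplication by Dp^T. *)
Lemma Tr_cover (m : idealr R) (M : lmodType R) (P : minimal_presentation m M)
    (Dp : 'M[R]_(mp_rank1 P, mp_rank0 P)) : (forall u, mp_diff P u = u *m Dp) ->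
  exists q : Hom 'rV[R]_(mp_rank1 P) (Tr P), surj q /\
    forall u, q u = 0 <-> exists v, u = v *m Dp^T.
Proof.
move=> DpE; have [c [sc cE]] := coker_proj (hom_pre (mp_diff P) R^o).
pose N : lmodType R := R^o.
have [t tE] := tens_l_hom (N := N) (mp_rank1 P) 1.
have row_of k (f : Hom 'rV[R]_k N) : exists v, f = tens v (1 : N).
  exists (\row_a (f (delta_mx 0 a) : R)); apply: linear_ext; apply: row_hom_ext => a.
  by rewrite /tens /= /tens_fun -rowE !mxE /GRing.scale /= mulr1.
have tinj k (v w : 'rV[R]_k) : tens v (1 : N) = tens w 1 -> v = w.
  move=> vw; apply/rowP => a; have := congr1 (fun f : Hom _ _ => f (delta_mx 0 a)) vw.
  by rewrite /tens /= /tens_fun -!rowE !mxE /GRing.scale /= !mulr1.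
have pre v : hom_pre (mp_diff P) N (tens v 1) = tens (v *m Dp^T) 1.
  by apply: linear_ext => u; rewrite /hom_pre /tens /= /tens_fun DpE trmx_mul trmxK mulmxA.
exists (c \o t : Hom _ _); split=> [y|u] /=.
  by have [f ->] := sc y; have [v ->] := row_of _ f; exists v; rewrite tE.
rewrite tE cE; split=> [[f fE]|[v ->]].
  have [v vE] := row_of _ f; exists v; apply: tinj; rewrite fE vE; exact: pre.
by exists (tens v (1 : N)); rewrite -pre.
Qed.

Lemma isom_matlis_dual (E X Y : lmodType R) : isom X Y -> isom (matlis_dual E X) (matlis_dual E Y).
Proof.
move=> [f [f' ff' f'f]].
have [g gE] : exists g : Hom Y X, g =1 f'.
  by apply: hom_of_linear => a x y; rewrite -{1}[x]f'f -{1}[y]f'f -(homP f) ff'.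
exists (hom_pre g E); exists (hom_pre f E) => h; apply: linear_ext => x /=.
  by rewrite gE ff'.
by rewrite gE f'f.
Qed.

End Syzygies.

(** * Assembling the chain of isomorphisms *)

Theorem corollary3p2 (R : comNzRingType) (m : idealr R) (d : nat)
    (omega M N E : lmodType R)
    (R_noetherian : noetherian R) (R_local : local_ring m)
    (R_cm : cohen_macaulay_ring m) (R_dim : krull_dim R d)
    (omega_canonical : canonical_module m omega)
    (M_mcm : maximal_cohen_macaulay m M) (N_mcm : maximal_cohen_macaulay m N)
    (NF_MN : forall p : prime_idealr R,
       nonfree_locus M p -> nonfree_locus N p -> p =i m)
    (E_hull : injective_hull (residue m) E)
    (P : minimal_presentation m M)
    (G : free_resolution (Tr P)) (G_minimal : minimal_resolution G m)
    (F : free_resolution N) :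
  isom (matlis_dual E (stable_Hom M N)) (Ext F 1 (tau G d omega)).
Proof.
have [[omega_fg _] _ [n [I [e [delta [Iinj ie e0 ei In]]]]]] := omega_canonical.
have IC := injective_pad Iinj ie e0 ei.
set J := pad I in IC; set D := pad_diff delta in IC.
(* The bound is raised by two because of the two zero modules put in front of the resolution. *)
have Jn i : (n.+2 < i)%N -> forall x : J i, x = 0 by case: i => [|[|i]] //; apply: In.
have vd := ext_vanish_fin_inj_dim IC R_noetherian omega_fg R_local Jn R_cm R_dim.
have [vk [y0 y0_top]] := canonical_residue IC omega_canonical R_dim.
have vN := ext_vanish_mcm R_noetherian R_local IC omega_fg R_dim vd N_mcm.
have [Dp DpE] := row_hom_mx (mp_diff P).
have [q [sq qE]] := Tr_cover DpE.
have fgT : fin_gen (Tr P) := fin_gen_surj sq (fin_gen_row _ _).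
have vX := syzygy_vanish IC (G := G) (vd _ _ fgT (ltnSn _)).
pose A j := projT1 (cid (row_hom_mx (fr_diff G j))).
have AE j u : fr_diff G j u = u *m A j by rewrite /A; case: cid.
have A_exact j (u : 'rV[R]_(fr_rank G j.+1)) : u *m A j = 0 <-> exists v, u = v *m A j.+1.
  by rewrite -AE fr_exact; split=> -[v vE]; exists v; rewrite vE AE.
have aug_ker u : fr_aug G u = 0 <-> exists v, u = v *m A 0.
  by rewrite fr_aug_exact; split=> -[v vE]; exists v; rewrite vE AE.
have eps_ker u : mp_aug P u = 0 <-> exists v, u = v *m Dp.
  by rewrite mp_exact; split=> -[v vE]; exists v; rewrite vE DpE.
have [i [p [[_ sp _] pE]]] := syzygy_short_exact G d.
have p_ker u : p u = 0 <-> exists v, u = v *m A d.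
  by rewrite pE; split=> -[v vE]; exists v; rewrite vE AE.
pose b j := @dual_diff _ N _ A j.
have bb : forall j x, b j (b j.+1 x) = 0 := dual_diff_diff A_exact.
pose H j : lmodType R := homology (b j.+1) (b j).
have [Dn DnE] := row_hom_mx (fr_diff F 0).
have augN_ker u : fr_aug F u = 0 <-> exists v, u = v *m Dn.
  by rewrite fr_aug_exact; split=> -[v vE]; exists v; rewrite vE DnE.
(* The common annihilator of all [H j], which are the H_(j+1)(C). A single primary ideal then serves
   both the vanishing in every degree and the duality for [H 0]. *)
pose K (s : R) := forall j (x : H j), s *: x = 0.
have Ki : ideal K.
  split=> [j x|a s t Ks Kt j x]; first by rewrite scale0r.
  by rewrite scalerDl -scalerA Ks Kt scaler0 addr0.
have KP : primary m K.
  apply: (primary_of_primes R_noetherian Ki) => p' p'm.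
  (* At a prime other than m one of M, N is locally free. For M this yields a homotopy on G; for N,
     it lets cycles be filled through a free module. *)
  have [fM|nM] := pselect (free_module (localization p' M : lmodType (locring p'))).
    have [s [sp' sM]] := free_localization_kills (@mp_aug_surj _ _ _ P) eps_ker fM.
    exists s; split=> // j x.
    apply: (stably_kills_homotopy A_exact).
    exact: (stably_kills_dual (@mp_aug_surj _ _ _ P) sq (@fr_aug_surj _ _ G) eps_ker qE aug_ker).
  have [fN|nN] := pselect (free_module (localization p' N : lmodType (locring p'))).
    have [s [sp' sN]] := free_localization_kills (@fr_aug_surj _ _ F) augN_ker fN.
    by exists s; split=> // j x; apply: (stably_kills_homology A_exact).
  by case: p'm; apply: NF_MN.
have fgC j : fin_gen (dual_obj N (fr_rank G) j).
  by apply: fin_gen_dual => //; case: N_mcm.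
have fgH j : fin_gen (H j).
  have [L [k [pp [ik _ spp _]]]] := homology_proj (b j.+1) (b j).
  exact: fin_gen_surj spp (fin_gen_sub R_noetherian ik (fgC _)).
have kH j : killed_by K (H j) by move=> a Ka x; apply: Ka.
have vC l j : ext_vanish D l.+2 (dual_obj N (fr_rank G) j).
  by apply: ext_vanish_dual; apply: vN.
have vH l j : (l <= d)%N -> ext_vanish D l (H j).
  move=> ld.
  exact: (ext_vanish_primary R_noetherian R_local IC KP (vk _ ld) (fgH j) (kH j)).
have vd2 X : fin_gen X -> ext_vanish D d.+2 X by move=> fgX; apply: vd.
have [theta thetaP] :=
  local_duality R_noetherian R_local IC y0_top vk E_hull vd2 Ki KP.
have [th1 th2 th3] := thetaP _ (fgH 0%N) (kH 0%N).
have iso1 := subquot_iso_Ext (Hom (syzygy G d) omega) F 1.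
have iso2 := subquot_iso_pairing A_exact IC F sp p_ker (vN 2 isT) vX.
have iso3 := total_shift_iter IC bb vC vH 0 (leqnn d).
have iso4 := total_duality IC bb th1 th2 th3 R_noetherian (fgC 0%N) vd2.
have iso5 := subquot_iso_stable A_exact (@mp_aug_surj _ _ _ P) sq (@fr_aug_surj _ _ G)
  eps_ker qE aug_ker (@fr_aug_surj _ _ F).
have isoH : isom (stable_Hom M N) (H 0%N).
  apply: subquot_iso_isom.
  apply: subquot_iso_trans (subquot_iso_sym (subquot_iso_quotmod _)) _ => //.
  apply: subquot_iso_trans iso5 (subquot_iso_homology _ _).
  by move=> a x y x0 y0'; rewrite homP x0 y0' scaler0 addr0.
(* Ext^1(N, tau M) is carried to total degrees (0, d), from there by d shifts to (d, 0), and finally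
   to Hom(H_1(C), E). *)
have isoA := subquot_iso_trans (@resolution_cocycle_submodule _ _ (Hom (syzygy G d) omega) F 1).2
  (subquot_iso_sym iso1) iso2.
have isoB := subquot_iso_trans (@total_cocycle_submodule _ _ D _ b 0 d).2 isoA iso3.
have isoC := subquot_iso_trans (@total_cocycle_submodule _ _ D _ b d 0).2 isoB iso4.
apply: subquot_iso_isom.
apply: subquot_iso_trans (subquot_iso_of_isom (isom_matlis_dual E isoH)) _ => //.
exact: subquot_iso_sym isoC.
Qed.
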